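(* Let $\mu$ be a measure on the closure $\overline{G}$ of a bounded region $G\subseteq\mathbb{C}$ of class $\Gamma$ with logarithmic capacity $1$. Let $\mathcal{N},\mathcal{M}\subseteq\mathbb{N}$ be infinite subsequences such that for each $j\in\mathcal{M}$, $\kappa_n\kappa_{n-j}^{-1}\to1$ as $n\to\infty$ through $\mathcal{N}$. Then there exists a non-decreasing and unbounded sequence $\{k_n\}_{n\in\mathcal{N}}$ of elements of $\mathcal{M}$ such that $$\lim_{\substack{n\to\infty\\ n\in\mathcal{N}}}\frac{\varphi(z)^{k_n}\,p_{n-k_n}(z;\mu)}{p_n(z;\mu)}=1$$ for all $z\notin\mathrm{ch}(\mu)$. Furthermore, the convergence is uniform on compact subsets of $\overline{\mathbb{C}}\setminus\mathrm{ch}(\mu)$.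
   Context: $\overline{\mathbb{C}}$ is the Riemann sphere. All measures are positive, finite, compactly supported measures on $\mathbb{C}$ with infinite support. $p_n(z;\mu)=\kappa_n z^n+\cdots$, $\kappa_n>0$, is the degree-$n$ orthonormal polynomial of $\mu$: $\int \overline{p_n(z;\mu)}\,p_m(z;\mu)\,d\mu(z)=\delta_{nm}$. $\mathrm{ch}(\mu)$ is the convex hull of $\mathrm{supp}(\mu)$. For a bounded region $G$, $\Omega$ denotes the unbounded component of $\overline{\mathbb{C}}\setminus\overline{G}$ (simply connected in $\overline{\mathbb{C}}$), and $\varphi$ is the conformal map sending $\Omega$ to $\overline{\mathbb{C}}\setminus\overline{\mathbb{D}}$ (with $\overline{\mathbb{D}}$ the closed unit disk) satisfying $\varphi(\infty)=\infty$ and $\varphi'(\infty)>0$. The Faber polynomial $F_n$ of $G$ is the polynomial part of the Laurent expansion of $\varphi^n$ at $\infty$. $G$ is of class $\Gamma$ if $F_n-\varphi^n\to0$ uniformly on $\overline{\Omega}$ as $n\to\infty$. When $G$ has logarithmic capacity $1$, each $F_n$ is monic of degree $n$. Expressions involving the index $n-j$ or $n-k_n$ are considered only when that index is non-negative. *)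

(* Defs.v *)
From HB Require Import structures.
From mathcomp Require Import all_boot all_order all_algebra.
From mathcomp Require Import all_classical all_reals all_analysis.
From mathcomp Require Import complex.

Set Implicit Arguments.
Unset Strict Implicit.
Unset Printing Implicit Defensive.

Import Order.TTheory GRing.Theory Num.Theory.
Import numFieldNormedType.Exports.

Local Open Scope ring_scope.
Local Open Scope classical_set_scope.

(* Typing R[i] as a numClosedFieldType lets it inherit the norm topology that
   MathComp-Analysis puts on every numFieldType.  Norms `|z| and order
   comparisons are C-valued ([0 < z] means that z is real and positive);
   [cabs] is the real-valued modulus. *)
Definition Cplx (R : realType) : numClosedFieldType := R[i].

Definition cRe {R : realType} (z : Cplx R) : R := complex.Re z.
Definition cIm {R : realType} (z : Cplx R) : R := complex.Im z.
Definition cabs {R : realType} (z : Cplx R) : R := cRe `|z|.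

Definition sphere (R : realType) := one_point_compactification (Cplx R).

Definition infty {R : realType} : sphere R := None.

Definition fin {R : realType} (z : Cplx R) : sphere R := Some z.

(* The filter of punctured neighbourhoods of infinity, seen on C; the default
   value 0 given to infinity by [odflt] is never used. *)
Definition near_infty {R : realType} : set_system (Cplx R) :=
  odflt (0 : Cplx R) @ (infty : sphere R)^'.

(* A function on C as a function on the sphere, with its limit as the value at
   infinity. *)
Definition ext_sphere {R : realType} (f : Cplx R -> Cplx R)
    (x : sphere R) : Cplx R :=
  if x is Some z then f z else lim (f @ near_infty).

Definition borelC (R : realType) := g_sigma_algebraType (@open (Cplx R)).

Definition supp {R : realType} (mu : set (borelC R) -> \bar R) :
    set (Cplx R) :=
  [set z | forall U : set (Cplx R), open U -> U z -> (0 < mu U)%E].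

Definition convex_hull {R : realType} (A : set (Cplx R)) : set (Cplx R) :=
  smallest (@convex_set (Cplx R) (Cplx R)) A.

Definition ch {R : realType} (mu : set (borelC R) -> \bar R) :
    set (Cplx R) :=
  convex_hull (supp mu).

Definition cintegral {R : realType} (mu : {measure set (borelC R) -> \bar R})
    (f : Cplx R -> Cplx R) : Cplx R :=
  Complex (\int[mu]_(z in setT) cRe (f z)) (\int[mu]_(z in setT) cIm (f z)).

Definition orthonormal_polys {R : realType}
    (mu : {measure set (borelC R) -> \bar R}) (p : nat -> {poly Cplx R}) :
    Prop :=
  [/\ forall n, size (p n) = n.+1,
      forall n, 0 < lead_coef (p n) &
      forall n m, cintegral mu (fun z => ((p n).[z])^* * (p m).[z])
                  = (n == m)%:R].

(* The energy with kernel log|z - w|, equal to -oo on the diagonal thanks to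
   [lne] ([ln] would give 0 there). *)
Definition energy {R : realType} (nu : {measure set (borelC R) -> \bar R}) :
    \bar R :=
  (\int[nu]_z \int[nu]_w lne (cabs (z - w : Cplx R))%:E)%E.

(* exp (sup I(nu)) over the Borel probability measures nu with compact support
   in E (the inner capacity when E is open); with the kernel log (1/|z - w|)
   this is the usual exp (- inf I). *)
Definition log_capacity {R : realType} (E : set (Cplx R)) : \bar R :=
  ereal_sup [set expeR (energy nu) | nu in
    [set nu : probability (borelC R) R |
       compact (supp nu) /\ supp nu `<=` E]].

Definition bounded_region {R : realType} (G : set (Cplx R)) : Prop :=
  [/\ G !=set0, open G, connected G & bounded_set G].

(* The component of infinity. *)
Definition Omega {R : realType} (G : set (Cplx R)) : set (sphere R) :=
  connected_component (~` (fin @` closure G)) infty.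

(* [phi] is the finite part of the conformal map; phi(oo) = oo and
   phi'(oo) > 0 say that phi has a simple pole at infinity with
   phi'(oo) := lim phi(z)/z > 0. *)
Definition exterior_map {R : realType} (G : set (Cplx R))
    (phi : Cplx R -> Cplx R) : Prop :=
  [/\ forall z, Omega G (fin z) -> derivable phi z 1,
      set_bij (fin @^-1` Omega G) [set w | 1 < `|w|] phi &
      exists2 a : Cplx R, 0 < a & phi z / z @[z --> near_infty] --> a].

(* [F] is the polynomial part of the Laurent expansion of phi^n at infinity:
   phi(z)^n = F(z) + \sum_(k >= 1) c_k z^-k for all large |z|. *)
Definition is_faber {R : realType} (phi : Cplx R -> Cplx R) (n : nat)
    (F : {poly Cplx R}) : Prop :=
  exists (c : nat -> Cplx R) (r : R), forall z : Cplx R, r < cabs z ->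
    series (fun k => c k * z ^- k.+1) @ \oo --> phi z ^+ n - F.[z].

(* Uniform convergence on the closure of Omega in the sphere presupposes values
   of phi on the boundary of Omega: those of its continuous extension. *)
Definition class_Gamma {R : realType} (G : set (Cplx R))
    (phi : Cplx R -> Cplx R) : Prop :=
  {within fin @^-1` closure (Omega G), continuous phi} /\
  exists2 F : nat -> {poly Cplx R}, forall n, is_faber phi n (F n) &
    {uniform closure (Omega G),
      (fun n => ext_sphere (fun z => (F n).[z] - phi z ^+ n)) @ \oo
        --> (fun=> 0 : Cplx R)}.

(* Main.v *)
Require Import Defs.
From HB Require Import structures.
From mathcomp Require Import all_boot all_order all_algebra.
From mathcomp Require Import all_classical all_reals all_analysis.
From mathcomp Require Import measurable_realfun.
From mathcomp Require Import complex.
From mathcomp Require Import ring lra zify.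

Set Implicit Arguments.
Unset Strict Implicit.
Unset Printing Implicit Defensive.

Import Order.TTheory GRing.Theory Num.Theory.
Import numFieldNormedType.Exports.

Local Open Scope ring_scope.
Local Open Scope classical_set_scope.

(* For fixed j the polynomial F_j p_(n-j) has degree n, and its distance to p_n
   in L^2(mu) satisfies
     |F_j p_(n-j) - p_n|^2 <= (max |F_j| over cl G)^2 + 1 - 2 a^j kappa_(n-j) / kappa_n
   with a = phi'(oo).  By the maximum principle |F_j| <= 1 + o(1) on cl G, so the
   right-hand side is small for j in M large and then n in N large as soon as
   a >= 1.  Off ch(mu) every polynomial Q of degree at most n satisfies
   |Q(z)| <= C(z) |Q| |p_n(z)|, so F_j p_(n-j) / p_n is close to 1 there.  This
   also forces the complement of ch(mu) into Omega, where F_j may be replaced by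
   phi^j, and a diagonal choice of j = k_n concludes.

   The capacity only enters through a >= 1.  Unit capacity bounds the products of
   distances of Fekete points of a continuum K in G, which yields monic
   polynomials of degree n that are O(n^c) on a net of K.  If K is close to
   cl G, Lagrange interpolation carries this bound over to cl G up to a factor
   growing at an arbitrarily small exponential rate.  The exterior maximum
   principle, applied to the quotient by F_n, then gives
   1 <= e^(o(n)) a^n. *)

(** All function theory takes place among polynomials: [phi] enters through its approximants F_n, so
    maximum principles for quotients of polynomials suffice, and |phi| = 1 on the boundary of Omega
    is extracted from the uniform convergence of F_n - phi^n. The capacity hypothesis speaks about
    energies of measures with compact support in the open set G. A point mass has energy -oo, so
    Fekete points are smeared over short segments, which must fit inside G; hence the detour through
    a compact K in G with room around it. Passing from K back to cl G is an extrapolation, where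
    equally spaced nodes would cost a fixed exponential rate. Distances s (i^2 + m^2) from the
    evaluation point imitate Chebyshev nodes near an end of an interval and cost only the square of
    the binomial 'C(n + m, m), whose exponential rate tends to 0 with m / n. Connectedness of K
    provides points at these distances. *)

Section Extrema.
Context {R : realType} {T : topologicalType}.

Lemma compact_argmax (f : T -> R) (A : set T) :
  A !=set0 -> compact A -> {within A, continuous f} ->
  exists2 c, A c & forall t, A t -> f t <= f c.
Proof.
move=> A0 cA cf; have [c cA' h] := compact_EVT_max A0 cA cf.
by exists c => [|t At]; [exact: set_mem|apply: h; exact: mem_set].
Qed.

Lemma compact_argmin (f : T -> R) (A : set T) :
  A !=set0 -> compact A -> {within A, continuous f} ->
  exists2 c, A c & forall t, A t -> f c <= f t.
Proof.
move=> A0 cA cf; have [c cA' h] := compact_EVT_min A0 cA cf.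
by exists c => [|t At]; [exact: set_mem|apply: h; exact: mem_set].
Qed.

End Extrema.

(** * Real-valued modulus and neighbourhoods in the plane *)

Section Modulus.
Context {R : realType}.
Implicit Types (z w : Cplx R) (x : R).

Definition rc (x : R) : Cplx R := (x%:C)%C.

Lemma normr_cabs z : `|z| = rc (cabs z).
Proof. by rewrite /cabs normc_def. Qed.

Lemma rc_le x y : (rc x <= rc y) = (x <= y).
Proof. exact: lecR. Qed.

Lemma rc_lt x y : (rc x < rc y) = (x < y).
Proof. exact: ltcR. Qed.

Lemma rcD x y : rc (x + y) = rc x + rc y.
Proof. by apply/eqP; rewrite eq_complex /= addr0 !eqxx. Qed.

Lemma rcN x : rc (- x) = - rc x.
Proof. by apply/eqP; rewrite eq_complex /= oppr0 !eqxx. Qed.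

Lemma rcB x y : rc (x - y) = rc x - rc y.
Proof. by rewrite rcD rcN. Qed.

Lemma rcM x y : rc (x * y) = rc x * rc y.
Proof. by apply/eqP; rewrite eq_complex /= mulr0 mul0r addr0 mulr0 subr0 !eqxx. Qed.

Lemma rc0 : rc 0 = 0. Proof. by []. Qed.
Lemma rc1 : rc 1 = 1. Proof. by []. Qed.

Lemma rc_inj : injective rc. Proof. by move=> x y []. Qed.

Lemma rcV x : rc x^-1 = (rc x)^-1.
Proof.
have [->|x0] := eqVneq x 0; first by rewrite invr0 rc0 invr0.
apply: (@mulfI _ (rc x)); first by apply: contra x0 => /eqP/rc_inj ->.
by rewrite -rcM !divff //; apply: contra x0 => /eqP/rc_inj ->.
Qed.

Lemma rcX x n : rc (x ^+ n) = rc x ^+ n.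
Proof. by elim: n => [|n IH]; rewrite ?expr0 // !exprS rcM IH. Qed.

Lemma cRe_rc x : cRe (rc x) = x. Proof. by []. Qed.
Lemma cIm_rc x : cIm (rc x) = 0. Proof. by []. Qed.

Lemma cReD z w : cRe (z + w) = cRe z + cRe w.
Proof. by case: z => a b; case: w. Qed.
Lemma cImD z w : cIm (z + w) = cIm z + cIm w.
Proof. by case: z => a b; case: w. Qed.
Lemma cReN z : cRe (- z) = - cRe z. Proof. by case: z. Qed.
Lemma cImN z : cIm (- z) = - cIm z. Proof. by case: z. Qed.
Lemma cReB z w : cRe (z - w) = cRe z - cRe w.
Proof. by rewrite cReD cReN. Qed.
Lemma cImB z w : cIm (z - w) = cIm z - cIm w.
Proof. by rewrite cImD cImN. Qed.
Lemma cReM z w : cRe (z * w) = cRe z * cRe w - cIm z * cIm w.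
Proof. by case: z => a b; case: w. Qed.
Lemma cImM z w : cIm (z * w) = cRe z * cIm w + cIm z * cRe w.
Proof. by case: z => a b; case: w. Qed.
Lemma cJE z : z^* = Complex (cRe z) (- cIm z).
Proof.
by apply/eqP; rewrite eq_complex; case: z => a b /=; rewrite !eqxx.
Qed.
Lemma cReJ z : cRe z^* = cRe z. Proof. by rewrite cJE. Qed.
Lemma cImJ z : cIm z^* = - cIm z. Proof. by rewrite cJE. Qed.

Lemma cplx_eqP z w : cRe z = cRe w -> cIm z = cIm w -> z = w.
Proof. by case: z => a b; case: w => c d /= -> ->. Qed.

Lemma cabs_sqr z : cabs z ^+ 2 = cRe z ^+ 2 + cIm z ^+ 2.
Proof.
rewrite /cabs normc_def /= /cRe /= sqr_sqrtr //.
by rewrite addr_ge0 // sqr_ge0.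
Qed.

Lemma cabs_ge0 z : 0 <= cabs z.
Proof. by rewrite -rc_le -normr_cabs normr_ge0. Qed.

Lemma cabs0 : cabs (0 : Cplx R) = 0.
Proof. by apply: rc_inj; rewrite -normr_cabs normr0. Qed.

Lemma cabs1 : cabs (1 : Cplx R) = 1.
Proof. by apply: rc_inj; rewrite -normr_cabs normr1. Qed.

Lemma cabs_eq0 z : (cabs z == 0) = (z == 0).
Proof.
apply/eqP/eqP => [h|->]; last exact: cabs0.
by apply/eqP; rewrite -normr_eq0 normr_cabs h.
Qed.

Lemma cabs_gt0 z : (0 < cabs z) = (z != 0).
Proof. by rewrite lt_def cabs_ge0 andbT cabs_eq0. Qed.

Lemma cabsM z w : cabs (z * w) = cabs z * cabs w.
Proof. by apply: rc_inj; rewrite rcM -!normr_cabs normrM. Qed.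

Lemma cabsV z : cabs z^-1 = (cabs z)^-1.
Proof. by apply: rc_inj; rewrite rcV -!normr_cabs normfV. Qed.

Lemma cabsX z n : cabs (z ^+ n) = cabs z ^+ n.
Proof. by apply: rc_inj; rewrite rcX -!normr_cabs normrX. Qed.

Lemma cabsN z : cabs (- z) = cabs z.
Proof. by apply: rc_inj; rewrite -!normr_cabs normrN. Qed.

Lemma cabsBC z w : cabs (z - w) = cabs (w - z).
Proof. by rewrite -opprB cabsN. Qed.

Lemma cabsD z w : cabs (z + w) <= cabs z + cabs w.
Proof. by rewrite -rc_le rcD -!normr_cabs ler_normD. Qed.

Lemma cabsB z w : cabs (z - w) <= cabs z + cabs w.
Proof. by rewrite -[cabs w]cabsN cabsD. Qed.

Lemma cabs_triangle u z w : cabs (z - w) <= cabs (z - u) + cabs (u - w).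
Proof. by have := cabsD (z - u) (u - w); rewrite addrA subrK. Qed.

Lemma cabs_lb z w : cabs z - cabs w <= cabs (z - w).
Proof. by have := cabsD (z - w) w; rewrite subrK; lra. Qed.

Lemma cabs_lbD z w : cabs z - cabs w <= cabs (z + w).
Proof. by have := cabs_lb z (- w); rewrite opprK cabsN. Qed.

Lemma cabs_rc x : cabs (rc x) = `|x|.
Proof.
apply/eqP; rewrite -(@eqrXn2 _ 2) ?cabs_ge0 //.
by rewrite cabs_sqr cRe_rc cIm_rc expr0n addr0 real_normK ?num_real.
Qed.

Lemma cabsJ z : cabs z^* = cabs z.
Proof.
apply/eqP; rewrite -(@eqrXn2 _ 2) ?cabs_ge0 //.
by rewrite !cabs_sqr cReJ cImJ sqrrN.
Qed.

Lemma cRe_le z : `|cRe z| <= cabs z.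
Proof.
rewrite -(@ler_pXn2r _ 2) ?nnegrE ?cabs_ge0 //.
by rewrite real_normK ?num_real // cabs_sqr lerDl sqr_ge0.
Qed.

Lemma cIm_le z : `|cIm z| <= cabs z.
Proof.
rewrite -(@ler_pXn2r _ 2) ?nnegrE ?cabs_ge0 //.
by rewrite real_normK ?num_real // cabs_sqr lerDr sqr_ge0.
Qed.

Lemma cabs_le z : cabs z <= `|cRe z| + `|cIm z|.
Proof.
rewrite -(@ler_pXn2r _ 2) ?nnegrE ?cabs_ge0 ?addr_ge0 //.
rewrite cabs_sqr sqrrD !real_normK ?num_real //.
have : 0 <= `|cRe z| * `|cIm z| by rewrite mulr_ge0.
lra.
Qed.

Lemma mulJc z : z^* * z = rc (cabs z ^+ 2).
Proof.
apply: cplx_eqP.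
  by rewrite cReM cReJ cImJ cRe_rc cabs_sqr; ring.
by rewrite cImM cReJ cImJ cIm_rc; ring.
Qed.

Lemma cReZ x z : cRe (rc x * z) = x * cRe z.
Proof. by rewrite cReM cRe_rc cIm_rc; ring. Qed.

Lemma cImZ x z : cIm (rc x * z) = x * cIm z.
Proof. by rewrite cImM cRe_rc cIm_rc; ring. Qed.

Lemma cabs_prod I (r : seq I) (P : pred I) (F : I -> Cplx R) :
  cabs (\prod_(i <- r | P i) F i) = \prod_(i <- r | P i) cabs (F i).
Proof. by apply: (big_morph cabs cabsM cabs1). Qed.

Lemma cabs_sum I (r : seq I) (P : pred I) (F : I -> Cplx R) :
  cabs (\sum_(i <- r | P i) F i) <= \sum_(i <- r | P i) cabs (F i).
Proof.
elim/big_rec2 : _ => [|i y x _ h]; first by rewrite cabs0.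
by apply: le_trans (cabsD _ _) _; rewrite lerD2l.
Qed.

(** Balls of [Cplx R] have complex radii, which positivity forces to be real; all later estimates
    use real radii and [cabs] instead. *)
Lemma nbhs_cplxP (z : Cplx R) (A : set (Cplx R)) :
  nbhs z A <-> exists2 e : R, 0 < e & forall w, cabs (w - z) < e -> A w.
Proof.
rewrite -nbhs_ballE; split => [[e e0 h]|[e e0 h]].
  have eE : e = rc (cRe e).
    by apply: cplx_eqP => //; rewrite cIm_rc; exact: ger0_Im (ltW e0).
  exists (cRe e); first by rewrite -rc_lt -eE.
  by move=> w hw; apply: h; rewrite -ball_normE /= eE normr_cabs rc_lt cabsBC.
exists (rc e); first by rewrite /= -rc0 rc_lt.
by move=> w; rewrite -ball_normE /= normr_cabs rc_lt cabsBC; apply: h.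
Qed.

Lemma cvg_cplxP T (F : set_system T) (FF : Filter F) (f : T -> Cplx R) (l : Cplx R) :
  f @ F --> l <-> forall e : R, 0 < e -> \forall t \near F, cabs (f t - l) < e.
Proof.
split => [h e e0|h A /nbhs_cplxP[e e0 eA]].
  by apply: (h [set w | cabs (w - l) < e]); apply/nbhs_cplxP; exists e.
by apply: filterS (h e e0) => t; apply: eA.
Qed.

Lemma continuous_lip1 (f : Cplx R -> R) :
  (forall z w, `|f z - f w| <= cabs (z - w)) -> continuous f.
Proof.
move=> h z; apply/(@cvgrPdist_lt _ _ _ (nbhs z)) => e e0; apply/nbhs_cplxP; exists e => // w.
by rewrite cabsBC; apply: le_lt_trans.
Qed.

Lemma continuous_cRe : continuous (@cRe R).
Proof. by apply: continuous_lip1 => z w; rewrite -cReB cRe_le. Qed.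

Lemma continuous_cIm : continuous (@cIm R).
Proof. by apply: continuous_lip1 => z w; rewrite -cImB cIm_le. Qed.

Lemma continuous_cabs : continuous (@cabs R).
Proof.
apply: continuous_lip1 => z w; rewrite ler_norml.
have := cabs_lb z w; have := cabs_lb w z; rewrite (cabsBC w); lra.
Qed.

Lemma continuous_rc : continuous rc.
Proof.
move=> x; apply/cvg_cplxP => e e0; near=> y.
rewrite -rcB cabs_rc distrC; near: y; exact: (@cvgr_dist_lt _ _ _ _ _ id).
Unshelve. all: by end_near. Qed.

Lemma continuous_complex (T : topologicalType) (f g : T -> R) :
  continuous f -> continuous g ->
  continuous (fun t => Complex (f t) (g t) : Cplx R).
Proof.
move=> cf cg t; apply/cvg_cplxP => e e0.
have e2 : 0 < e / 2 by lra.
near=> s; apply: le_lt_trans (cabs_le _) _.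
rewrite [cRe _]/= [cIm _]/=.
have : `|f t - f s| < e / 2 by near: s; move/(@cvgrPdist_lt _ _ _ (nbhs t)): (cf t) => /(_ _ e2).
have : `|g t - g s| < e / 2 by near: s; move/(@cvgrPdist_lt _ _ _ (nbhs t)): (cg t) => /(_ _ e2).
rewrite (distrC (f t)) (distrC (g t)); lra.
Unshelve. all: by end_near. Qed.

Lemma continuous_horner (P : {poly Cplx R}) : continuous (horner P).
Proof.
elim/poly_ind: P => [|P c IH].
  rewrite (_ : horner 0 = fun=> 0 : Cplx R); last by apply/funext => x; rewrite horner0.
  exact: cst_continuous.
rewrite (_ : horner _ = fun z : Cplx R => P.[z] * z + c); last first.
  by apply/funext => x; rewrite hornerMXaddC.
by move=> z; apply: cvgD (cvgM (IH z) _) (cvg_cst _).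
Qed.

Lemma closed_cball (c : Cplx R) (r : R) : closed [set z : Cplx R | cabs (z - c) <= r].
Proof.
rewrite (_ : [set _ | _] = (fun z => cabs (z - c)) @^-1` [set x | x <= r]) //.
apply: closed_comp (@closed_le _ r) => z _.
apply: continuous_lip1 => {}z w; rewrite ler_norml.
have := cabs_lb (z - c) (w - c); have := cabs_lb (w - c) (z - c).
rewrite (cabsBC (w - c)) !opprB !addrA !subrK (addrC z) (cabsBC w); lra.
Qed.

Lemma closed_cball0 (r : R) : closed [set z : Cplx R | cabs z <= r].
Proof.
rewrite (_ : [set _ | _] = [set z | cabs (z - 0) <= r]); first exact: closed_cball.
by apply/seteqP; split => z /=; rewrite subr0.
Qed.

Lemma open_cball (c : Cplx R) (r : R) : open [set z : Cplx R | cabs (z - c) < r].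
Proof.
rewrite openE => z /= zr; apply/nbhs_cplxP; exists (r - cabs (z - c)); first lra.
by move=> w h; have := cabs_triangle z w c; rewrite /=; lra.
Qed.

Lemma compact_cball (r : R) : compact [set z : Cplx R | cabs z <= r].
Proof.
pose sq : set (R * R) := `[-r, r]%classic `*` `[-r, r]%classic.
have csq : compact sq by apply: compact_setX; apply: segment_compact.
pose f (p : R * R) : Cplx R := Complex p.1 p.2.
have cf : continuous f.
  by apply: continuous_complex => p; [exact: cvg_fst|exact: cvg_snd].
have cI := continuous_compact (continuous_subspaceT cf) csq.
apply: (subclosed_compact _ cI).
  exact: closed_cball0.
move=> z /= h; exists (cRe z, cIm z); last by case: z h.
have := cRe_le z; have := cIm_le z => h1 h2.
split; rewrite /= in_itv /= -ler_norml.
  exact: le_trans h2 h.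
exact: le_trans h1 h.
Qed.

Lemma bounded_cplxP (A : set (Cplx R)) :
  bounded_set A <-> exists r : R, forall z, A z -> cabs z <= r.
Proof.
split.
  move=> [M [Mr h]].
  exists (cabs M + 1) => z Az.
  have : `|z| <= rc (cabs M + 1).
    apply: h => //; rewrite rcD -normr_cabs.
    by apply: le_lt_trans (real_ler_norm _) _ => //; rewrite ltrDl rc1.
  by rewrite normr_cabs rc_le.
move=> [r h]; exists (rc r); split.
  by rewrite complex_real.
move=> x rx z /h hz; apply: le_trans (ltW rx); by rewrite normr_cabs rc_le.
Qed.

Lemma compact_cplx (A : set (Cplx R)) (r : R) :
  closed A -> (forall z, A z -> cabs z <= r) -> compact A.
Proof. by move=> cA h; apply: (subclosed_compact cA (compact_cball (r := r))) => z /h. Qed.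

Lemma compact_bounded_cplx (A : set (Cplx R)) :
  compact A -> exists r : R, forall z, A z -> cabs z <= r.
Proof.
move=> cA; have [->|/set0P A0] := eqVneq A set0; first by exists 0.
have [z _ h] := compact_argmax A0 cA (continuous_subspaceT continuous_cabs).
by exists (cabs z).
Qed.

Lemma bounded_closure (A : set (Cplx R)) : bounded_set A ->
  exists r : R, forall z, closure A z -> cabs z <= r.
Proof.
move=> /bounded_cplxP[r hr]; exists r => z /(closureS hr).
by rewrite -(proj1 (closure_id _) (@closed_cball0 r)).
Qed.

Lemma near_inftyP (A : set (Cplx R)) :
  near_infty A <-> exists r : R, forall z, r < cabs z -> A z.
Proof.
split.
  move=> [B [cB _] /= h].
  have [r hr] := compact_bounded_cplx cB.
  exists r => z rz.
  have := h (fin z); apply => //; left; exists z => // /hr; by rewrite leNgt rz.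
move=> [r h]; exists [set z | cabs z <= r].
  split; first exact: compact_cball.
  exact: closed_cball0.
move=> x [[z /= nz <-]|->]// _ /=; apply: h.
by rewrite ltNge; apply/negP.
Qed.

End Modulus.

(** * Maximum principles for quotients of polynomials *)

Section MaximumPrinciple.
Context {R : realType}.
Implicit Types (z w : Cplx R) (N P Q F : {poly Cplx R}).

(* With [c := N.[z0] / P.[z0]] and [N - c P = T * ('X - z0)^k], moving from [z0]
   along a [k]-th root of [c P.[z0] / T.[z0]] increases the modulus of [N / P]. *)
Lemma quotient_open N P z0 (e : R) : N.[z0] != 0 -> P.[z0] != 0 ->
  N != (N.[z0] / P.[z0]) *: P -> 0 < e ->
  exists w, [/\ cabs (w - z0) < e, P.[w] != 0 &
    cabs N.[z0] / cabs P.[z0] < cabs N.[w] / cabs P.[w]].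
Proof.
move=> Nz Pz NP e0; set c := N.[z0] / P.[z0] in NP.
have c0 : c != 0 by rewrite mulf_neq0 ?invr_neq0.
pose D := N - c *: P.
have D0 : D != 0 by rewrite subr_eq0.
have [k [T /implyP/(_ D0) Tz DE]] := multiplicity_XsubC D z0.
have DE' x : N.[x] - c * P.[x] = T.[x] * (x - z0) ^+ k.
  have := congr1 (horner^~ x) DE.
  by rewrite /D hornerD hornerN hornerZ hornerM horner_exp hornerXsubC.
have {}Tz : T.[z0] != 0 := Tz.
have k0 : (0 < k)%N.
  rewrite lt0n; apply: contraNneq Tz => kE.
  have := DE' z0.
  by rewrite kE expr0 mulr1 /c divfK // subrr => <-.
pose b := c * P.[z0] / T.[z0].
pose beta := k.-root b.
have betaE : beta ^+ k = b by rewrite rootCK.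
pose g w := (P.[z0] / P.[w]) * (T.[w] / T.[z0]).
have cP := @continuous_horner R P z0.
have cT := @continuous_horner R T z0.
have g1 : g w @[w --> z0] --> (1 : Cplx R).
  rewrite (_ : 1 = g z0); last by rewrite /g !divff // mulr1.
  exact: (cvgM (cvgM (cvg_cst _) (cvgV Pz cP)) (cvgM cT (cvg_cst _))).
have Pne : \forall w \near z0, P.[w] != 0.
  have P1 : 0 < cabs P.[z0] by rewrite cabs_gt0.
  near=> w; rewrite -cabs_gt0.
  have : cabs (P.[w] - P.[z0]) < cabs P.[z0].
    by near: w; move/cvg_cplxP : cP => /(_ _ P1).
  have := cabs_lb P.[z0] (P.[z0] - P.[w]).
  by rewrite subKr (cabsBC P.[w]); lra.
have [d d0 hd] : exists2 d : R, 0 < d & forall w, cabs (w - z0) < d ->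
    cabs (g w - 1) < 1 / 2 /\ P.[w] != 0.
  apply/nbhs_cplxP; near=> w; split; near: w => //.
  have h2 : 0 < 1 / 2 :> R by lra.
  by move/cvg_cplxP : g1 => /(_ _ h2).
pose t := Num.min d e / 2 / (cabs beta + 1).
have b1 : 0 < cabs beta + 1 by have := cabs_ge0 beta; lra.
have t0 : 0 < t by rewrite !divr_gt0 // lt_min d0 e0.
pose w := z0 + rc t * beta.
have wz : cabs (w - z0) < Num.min d e.
  rewrite /w addrAC subrr add0r cabsM cabs_rc gtr0_norm //.
  have m0 : 0 < Num.min d e by rewrite lt_min d0 e0.
  apply: (@le_lt_trans _ _ (t * (cabs beta + 1))).
    by apply: ler_wpM2l; [exact: ltW|lra].
  by rewrite /t divfK ?gt_eqF //; lra.
move: wz; rewrite lt_min => /andP[/hd[gw Pw] we].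
exists w; split => //.
have NE : N.[w] = c * P.[w] * (1 + rc t ^+ k * g w).
  have ww : w - z0 = rc t * beta by rewrite /w addrAC subrr add0r.
  have := DE' w; rewrite ww exprMn betaE => /eqP.
  rewrite subr_eq => /eqP ->; rewrite /b /g; field.
  by rewrite Pw Tz.
have tk : 0 < t ^+ k by rewrite exprn_gt0.
have h1 : 1 < cabs (1 + rc t ^+ k * g w).
  have h : 1 - cRe (g w) < 1 / 2.
    have := cRe_le (g w - 1); rewrite cReB (_ : cRe 1 = 1) // ler_norml; lra.
  apply: lt_le_trans (le_trans (ler_norm _) (cRe_le _)).
  rewrite cReD (_ : cRe 1 = 1) // -rcX cReZ.
  have : 0 < t ^+ k * cRe (g w) by apply: mulr_gt0; lra.
  lra.
rewrite NE 2!cabsM (mulrAC _ (cabs P.[w])) mulfK ?gt_eqF ?cabs_gt0 //.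
rewrite /c cabsM cabsV ltr_pMr //.
by rewrite divr_gt0 // cabs_gt0.
Unshelve. all: by end_near. Qed.

Lemma continuous_cabs_horner P : continuous (fun z : Cplx R => cabs P.[z]).
Proof.
move=> z; exact: (continuous_comp (@continuous_horner R P z) (@continuous_cabs R _)).
Qed.

(** By [quotient_open] the modulus of N / P has no interior maximum unless N is a multiple of P. In
    that case the modulus is constant, and a rightmost point of the closure of [U] lies outside [U],
    where the bound is known. *)
Lemma max_principle (U : set (Cplx R)) N P (B : R) :
  open U -> bounded_set U -> 0 <= B -> (forall z, closure U z -> P.[z] != 0) ->
  (forall z, closure U z -> ~ U z -> cabs N.[z] <= B * cabs P.[z]) ->
  forall z, closure U z -> cabs N.[z] <= B * cabs P.[z].
Proof.
move=> oU /bounded_cplxP[r Ur] B0 P0 bd z1 Uz1.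
have clUr z : closure U z -> cabs z <= r.
  by move=> /(closureS Ur); rewrite -(proj1 (closure_id _) (@closed_cball0 R r)).
have cU : compact (closure U).
  by apply: (compact_cplx (@closed_closure _ _) clUr).
have U0 : closure U !=set0 by exists z1.
pose f z := cabs N.[z] / cabs P.[z].
have cf : {within closure U, continuous f}.
  apply: continuous_in_subspaceT => z /set_mem /P0 Pz.
  apply: (cvgM (@continuous_cabs_horner N z) (cvgV _ (@continuous_cabs_horner P z))).
  by rewrite gt_eqF // cabs_gt0.
have fE z : closure U z -> (cabs N.[z] <= B * cabs P.[z]) = (f z <= B).
  by move=> /P0 Pz; rewrite /f ler_pdivrMr // cabs_gt0.
have [z0 Uz0 max0] := compact_argmax U0 cU cf.
rewrite fE //; apply: le_trans (max0 _ Uz1) _.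
rewrite leNgt; apply/negP => Bf.
have inU z : closure U z -> B < f z -> U z.
  move=> clz; apply: contraPP => nU; apply/negP; rewrite -leNgt -fE //.
  exact: bd.
have Uz0' := inU _ Uz0 Bf.
have N0 : N.[z0] != 0.
  by apply: contraTneq Bf => h; rewrite /f h cabs0 mul0r -leNgt.
have [NE|NP] := eqVneq N ((N.[z0] / P.[z0]) *: P).
  have fc z : closure U z -> f z = f z0.
    move=> /P0 Pz; rewrite {1}/f {1}NE hornerZ !cabsM cabsV mulfK //.
    by rewrite gt_eqF // cabs_gt0.
  have [w Uw maxw] := compact_argmax U0 cU (continuous_subspaceT continuous_cRe).
  have Uw' : U w by apply: inU => //; rewrite fc.
  have /nbhs_cplxP[e e0 he] : nbhs w U by apply: open_nbhs_nbhs.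
  have : U (w + rc (e / 2)).
    by apply: he; rewrite addrAC subrr add0r cabs_rc gtr0_norm; lra.
  move=> /subset_closure /maxw; rewrite cReD cRe_rc; lra.
have /nbhs_cplxP[e e0 he] : nbhs z0 U by apply: open_nbhs_nbhs.
have [w [we Pw]] := quotient_open N0 (P0 _ Uz0) NP e0.
apply/negP; rewrite -leNgt; apply: max0; apply: subset_closure; exact: he.
Qed.

Lemma bernoulli_le (x : R) n : 0 <= x -> 1 + n%:R * x <= (1 + x) ^+ n.
Proof.
move=> x0; elim: n => [|n IH]; first by rewrite mul0r addr0 expr0.
rewrite exprS; apply: (@le_trans _ _ ((1 + x) * (1 + n%:R * x))).
  rewrite -natr1; have : 0 <= x * (n%:R * x) by rewrite !mulr_ge0.
  lra.
by apply: ler_wpM2l => //; lra.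
Qed.

Lemma expr_unbounded (x K : R) : 1 < x -> exists n0, forall n, (n0 <= n)%N ->
  K < x ^+ n.
Proof.
move=> x1; have y0 : 0 < x - 1 by lra.
exists (Num.truncn (`|K| / (x - 1))).+1 => n hn.
have := @bernoulli_le (x - 1) n (ltW y0); rewrite (addrC 1 (x - 1)) subrK.
have : `|K| / (x - 1) < n%:R.
  apply: lt_le_trans (_ : (Num.truncn (`|K| / (x - 1))).+1%:R <= _); last first.
    by rewrite ler_nat.
  exact: truncnS_gt.
rewrite ltr_pdivrMr //; have := ler_norm K; lra.
Qed.

(** The factor [cabs z] on the left expresses the order |z|^(n-1) without a truncated exponent at n
    = 0. *)
Lemma poly_growth Q n : (size Q <= n)%N -> exists2 A : R, 0 <= A &
  forall z, 1 <= cabs z -> cabs z * cabs Q.[z] <= A * cabs z ^+ n.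
Proof.
move=> sQ; exists (\sum_(i < n) cabs Q`_i).
  by apply: sumr_ge0 => i _; exact: cabs_ge0.
move=> z z1; rewrite (horner_coef_wide _ sQ).
apply: le_trans (_ : cabs z * \sum_(i < n) cabs (Q`_i * z ^+ i) <= _).
  by apply: ler_wpM2l; [exact: cabs_ge0|exact: cabs_sum].
rewrite mulr_sumr mulr_suml; apply: ler_sum => i _.
rewrite cabsM mulrCA; apply: ler_wpM2l; first exact: cabs_ge0.
by rewrite cabsX -exprS; apply: ler_weXn2l.
Qed.

Lemma horner_infty P n : (size P <= n.+1)%N -> exists2 A : R, 0 <= A &
  forall z, 1 <= cabs z -> cabs z * cabs (P.[z] - P`_n * z ^+ n) <= A * cabs z ^+ n.
Proof.
move=> sP; have [|A A0 hA] := @poly_growth (P - P`_n *: 'X^n) n.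
  apply/leq_sizeP => j; rewrite leq_eqVlt coefB coefZ coefXn => /orP[/eqP<-|nj].
    by rewrite eqxx mulr1 subrr.
  by rewrite gtn_eqF // mulr0 subr0 nth_default // (leq_trans sP).
exists A => // z /hA.
by rewrite hornerD hornerN hornerZ hornerXn.
Qed.

(* Phragmen-Lindelof: for each [M] the maximum principle is applied to
   [Q ^+ M / (('X - b) * F ^+ M)], which is small on large circles. *)
Lemma max_principle_ext (V : set (Cplx R)) Q F (B C d r0 : R) b :
  open V -> 0 <= B -> 0 <= C -> 0 < d -> (forall z, closure V z -> d <= cabs (z - b)) ->
  (forall z, closure V z -> F.[z] != 0) ->
  (forall z, closure V z -> ~ V z -> cabs Q.[z] <= B * cabs F.[z]) ->
  (forall z, closure V z -> r0 < cabs z -> cabs Q.[z] <= C * cabs F.[z]) ->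
  forall z, V z -> cabs Q.[z] <= B * cabs F.[z].
Proof.
move=> oV B0 C0 d0 dV F0 bd bdr z1 Vz1.
have Fz1 := F0 _ (subset_closure Vz1).
rewrite -ler_pdivrMr ?cabs_gt0 //; set q := _ / _.
rewrite leNgt; apply/negP => Bq.
(* [B] may be 0, and the argument divides by the bound, so [B] is replaced by a positive number
   still below [q]. *)
have [B' [B'0 BB' B'q]] : exists B', [/\ 0 < B', B <= B' & 1 < q / B'].
  have h : 0 < (B + q) / 2 by lra.
  by exists ((B + q) / 2); split; [|lra|rewrite ltr_pdivlMr //; lra].
(* The exponent is chosen to contradict (q / B')^M <= |z1 - b| / d, which the maximum principle
   yields below. *)
have [M /(_ M (leqnn M))] := expr_unbounded (cabs (z1 - b) / d) B'q.
apply/negP; rewrite -leNgt.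
(* The terms put [z1] inside the circle of radius [rho], put that circle beyond [r0], and make |z -
   b| at least d (C / B')^M on it. *)
pose rho := 1 + cabs z1 + `|r0| + cabs b + d * (C / B') ^+ M.
have CBM : 0 <= d * (C / B') ^+ M.
  by apply: mulr_ge0 (ltW d0) _; rewrite exprn_ge0 // divr_ge0 // ltW.
pose U := V `&` [set z | cabs z < rho].
have oU : open U.
  apply: openI => //.
  rewrite (_ : [set _ | _] = [set z | cabs (z - 0) < rho]); last first.
    by apply/seteqP; split => z /=; rewrite subr0.
  exact: open_cball.
have bU : bounded_set U by apply/bounded_cplxP; exists rho => z [_ /ltW].
pose Bd := B' ^+ M / d.
have Bd0 : 0 <= Bd by rewrite divr_ge0 ?exprn_ge0 // ltW.
have clU z : closure U z -> closure V z.
  by apply: closureS; exact: subIsetl.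
(* A bound [K] for |Q / F| at [z] is enough when K^M d <= B'^M |z - b|. On the boundary of [V] this
   holds with K = B because |z - b| >= d, on the large circle with K = C because |z - b| is
   large. *)
have hM z (K : R) : closure V z -> 0 <= K -> cabs Q.[z] <= K * cabs F.[z] ->
    K ^+ M * d <= B' ^+ M * cabs (z - b) ->
    cabs (Q ^+ M).[z] <= Bd * cabs (('X - b%:P) * F ^+ M).[z].
  move=> Vz K0 h1 h2.
  rewrite horner_exp hornerM hornerXsubC horner_exp cabsM !cabsX.
  apply: le_trans (_ : (K * cabs F.[z]) ^+ M <= _).
    by apply: lerXn2r; rewrite ?nnegrE ?mulr_ge0 ?cabs_ge0.
  rewrite exprMn mulrA; apply: ler_wpM2r; first by rewrite exprn_ge0 // cabs_ge0.
  by rewrite /Bd mulrAC ler_pdivlMr.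
have := @max_principle U (Q ^+ M) (('X - b%:P) * F ^+ M) Bd oU bU Bd0.
have h1 z : closure U z -> (('X - b%:P) * F ^+ M).[z] != 0.
  move=> /clU Vz; rewrite hornerM horner_exp mulf_neq0 ?expf_neq0 ?F0 //.
  by rewrite hornerXsubC -cabs_gt0 (lt_le_trans d0) // dV.
move=> /(_ h1); have h2 z : closure U z -> ~ U z ->
    cabs (Q ^+ M).[z] <= Bd * cabs (('X - b%:P) * F ^+ M).[z].
  move=> /clU Vz nU; have [inV|nV] := pselect (V z); last first.
    apply: (hM _ B) => //; first exact: bd.
    apply: ler_pM; [by rewrite exprn_ge0|exact: ltW| |exact: dV].
    by apply: lerXn2r; rewrite ?nnegrE // ltW.
  have zr : rho <= cabs z by rewrite leNgt; apply/negP => zr; apply: nU.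
  apply: (hM _ C) => //.
    apply: bdr => //; apply: lt_le_trans zr; rewrite /rho.
    have := ler_norm r0; have := cabs_ge0 z1; have := cabs_ge0 b; lra.
  have -> : C ^+ M * d = B' ^+ M * (d * (C / B') ^+ M).
    by rewrite exprMn exprVn mulrCA [B' ^+ M * _]mulrC divfK ?expf_neq0 ?gt_eqF // mulrC.
  apply: ler_wpM2l; first by rewrite exprn_ge0 // ltW.
  have := cabs_lb z b; move: zr; rewrite /rho; have := cabs_ge0 z1.
  have := normr_ge0 r0; lra.
have Uz1 : closure U z1.
  apply: subset_closure; split => //=; rewrite /rho.
  have := normr_ge0 r0; have := cabs_ge0 b; lra.
move=> /(_ h2 z1 Uz1).
rewrite horner_exp hornerM hornerXsubC horner_exp cabsM !cabsX mulrA.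
rewrite -ler_pdivrMr ?exprn_gt0 ?cabs_gt0 // -exprVn -exprMn -/q /Bd => h.
have -> : (q / B') ^+ M = q ^+ M / B' ^+ M by rewrite expr_div_n.
rewrite ler_pdivrMr ?exprn_gt0 //.
by apply: le_trans h _; rewrite mulrC mulrA mulrAC.
Qed.

End MaximumPrinciple.

(** * The exterior domain *)

Section Sphere.
Context {R : realType}.
Implicit Types (z w u : Cplx R).

Lemma closure_cplxP (A : set (Cplx R)) z :
  closure A z <-> forall e : R, 0 < e -> exists2 w, A w & cabs (w - z) < e.
Proof.
split => [h e e0|h B /nbhs_cplxP[e e0 eB]].
  have [] := h [set w | cabs (w - z) < e]; first by apply/nbhs_cplxP; exists e.
  by move=> w [Aw we]; exists w.
by have [w Aw we] := h _ e0; exists w; split => //; exact: eB.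
Qed.

Lemma nbhs_finP z (A : set (sphere R)) :
  nbhs (fin z) A <-> exists2 e : R, 0 < e & forall w, cabs (w - z) < e -> A (fin w).
Proof. exact: nbhs_cplxP z (fin @^-1` A). Qed.

Lemma nbhs_inftyP (A : set (sphere R)) :
  nbhs infty A <-> A infty /\ exists r : R, forall z, r < cabs z -> A (fin z).
Proof.
split.
  move=> h; split; first exact: nbhs_singleton.
  case: h => B [cB _] /= hB.
  have [r hr] := compact_bounded_cplx cB.
  exists r => z rz.
  by apply: hB; left; exists z => // /hr; rewrite leNgt rz.
move=> [A0 [r h]]; exists [set z | cabs z <= r].
  by split; [exact: compact_cball|exact: closed_cball0].
move=> x [[z /= nz <-]|->//].
by apply: h; rewrite ltNge; apply/negP.
Qed.

Lemma closure_fin (A : set (sphere R)) z :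
  closure A (fin z) <-> closure (fin @^-1` A) z.
Proof.
split => [h|/closure_cplxP h B /nbhs_finP[e e0 eB]].
  apply/closure_cplxP => e e0.
  have [] := h (fin @` [set w | cabs (w - z) < e]).
    by apply/nbhs_finP; exists e => // w we; exists w.
  by move=> x [Ax [w /= we wE]]; exists w => //; rewrite /= wE.
by have [w Aw we] := h _ e0; exists (fin w); split => //; exact: eB.
Qed.

Lemma fin_inj : injective (@fin R).
Proof. by move=> x y []. Qed.

Lemma continuous_line z u : continuous (fun t : R => z + rc t * u).
Proof.
move=> t.
exact: (cvgD (cvg_cst _) (cvgM (@continuous_rc R t) (cvg_cst _))).
Qed.

Definition segment z w : set (Cplx R) :=
  (fun t : R => z + rc t * (w - z)) @` `[0, 1]%classic.

Lemma connected_seg z w : connected (segment z w).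
Proof.
apply: connected_continuous_connected; first exact: segment_connected.
exact/continuous_subspaceT/continuous_line.
Qed.

Lemma compact_seg z w : compact (segment z w).
Proof.
apply: continuous_compact; last exact: segment_compact.
exact/continuous_subspaceT/continuous_line.
Qed.

Lemma segment_l z w : segment z w z.
Proof. by exists 0; rewrite ?rc0 ?mul0r ?addr0 //= in_itv /= lexx ler01. Qed.

Lemma segment_r z w : segment z w w.
Proof. by exists 1; rewrite ?rc1 ?mul1r ?[z + _]addrC ?subrK //= in_itv /= lexx ler01. Qed.

Lemma segment_ball z w y : segment z w y -> cabs (y - z) <= cabs (w - z).
Proof.
move=> [t]; rewrite /= in_itv /= => /andP[t0 t1] <-.
by rewrite addrAC subrr add0r cabsM cabs_rc ger0_norm // ler_piMl // cabs_ge0.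
Qed.

(** Closedness in the plane means that the closure of the ray in the sphere adds only infinity, so
    that it still avoids the closure of [G] in [outer_ray]. *)
Lemma ray_closed z u : u != 0 ->
  closed ((fun t : R => z + rc t * u) @` [set t | 0 <= t]).
Proof.
move=> u0.
pose f w : Cplx R := (w - z) / u.
have cf : continuous f.
  by move=> w; exact: (cvgM (cvgB cvg_id (cvg_cst _)) (cvg_cst _)).
rewrite (_ : _ @` _ = f @^-1` ((@cRe R) @^-1` [set x | 0 <= x] `&`
    (@cIm R) @^-1` [set x | x = 0])).
  apply: closed_comp => [w _|]; first exact: cf.
  apply: closedI.
    by apply: closed_comp (@closed_ge _ 0) => w _; exact: continuous_cRe.
  by apply: closed_comp (@closed_eq _ 0) => w _; exact: continuous_cIm.
apply/seteqP; split => w.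
  move=> [t /= t0 <-]; have fE : f (z + rc t * u) = rc t.
    by rewrite /f addrAC subrr add0r mulfK.
  split.
    by change (0 <= cRe (f (z + rc t * u))); rewrite fE.
  by change (cIm (f (z + rc t * u)) = 0); rewrite fE.
move=> [/= h1 h2]; exists (cRe (f w)) => //.
have -> : rc (cRe (f w)) = f w by apply: cplx_eqP; rewrite ?cRe_rc ?cIm_rc.
by rewrite /f divfK // addrC subrK.
Qed.

End Sphere.

Section OuterDomain.
Context {R : realType} (G : set (Cplx R)).
Implicit Types (z w u : Cplx R).

Definition outer : set (Cplx R) := fin @^-1` Omega G.

Lemma outer_not_closure z : outer z -> ~ closure G z.
Proof.
move=> /connected_component_sub h Gz; apply: h; by exists z.
Qed.

Lemma Omega_infty : Omega G infty.
Proof. by apply: connected_component_refl => -[]. Qed.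

Lemma Omega_absorb (B : set (sphere R)) x : Omega G x -> B x ->
  (forall z, B (fin z) -> ~ closure G z) -> connected B -> B `<=` Omega G.
Proof.
move=> Ox Bx BG cB.
have : B `|` Omega G `<=` Omega G.
  apply: connected_component_max.
  - by right; exact: Omega_infty.
  - move=> y [By [z Gz zE]|Oy]; last exact: connected_component_sub Oy.
    by apply: (BG z) => //; rewrite zE.
  - apply: connectedU => //; first by exists x.
    exact: component_connected.
by move=> h y By; apply: h; left.
Qed.

Lemma outer_absorb (B : set (Cplx R)) z : outer z -> B z ->
  (forall w, B w -> ~ closure G w) -> connected B -> B `<=` outer.
Proof.
move=> Oz Bz BG cB w Bw.
have : fin @` B `<=` Omega G.
  have Bz' : (fin @` B) (fin z) by exists z.
  apply: (Omega_absorb Oz Bz').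
    by move=> w' [y By /fin_inj<-]; exact: BG.
  apply: connected_continuous_connected => //.
  exact/continuous_subspaceT/one_point_compactification_some_continuous.
by apply; exists w.
Qed.

(** The closure of the ray in the sphere is connected and contains infinity, hence lies in the
    component of infinity. *)
Lemma outer_ray z u : u != 0 -> (forall t : R, 0 <= t -> ~ closure G (z + rc t * u)) ->
  outer z.
Proof.
move=> u0 h.
pose A : set (Cplx R) := (fun t : R => z + rc t * u) @` [set t | 0 <= t].
have cA : connected (fin @` A).
  apply: connected_continuous_connected; last first.
    exact/continuous_subspaceT/one_point_compactification_some_continuous.
  apply: connected_continuous_connected; last first.
    exact/continuous_subspaceT/continuous_line.
  apply/connected_intervalP => x y /= x0 y0 w /andP[xw _].
  exact: le_trans xw.
have Az : A z by exists 0; rewrite /= ?rc0 ?mul0r ?addr0.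
have Ainf : closure (fin @` A) infty.
  move=> B /nbhs_inftyP[_ [r hr]].
  pose t := (`|r| + cabs z + 1) / cabs u.
  have u1 : 0 < cabs u by rewrite cabs_gt0.
  have zp := cabs_ge0 z; have rp := normr_ge0 r.
  have t0 : 0 <= t by rewrite divr_ge0 //; lra.
  exists (fin (z + rc t * u)); split; first by exists (z + rc t * u) => //; exists t.
  apply: hr; have := cabs_lbD (rc t * u) z.
  rewrite cabsM cabs_rc ger0_norm // /t divfK ?gt_eqF // (addrC z).
  have := ler_norm r; lra.
have := @Omega_absorb (closure (fin @` A)) infty Omega_infty Ainf.
apply.
- move=> w /closure_fin.
  rewrite (_ : fin @^-1` _ = A); last first.
    by apply/seteqP; split => [y [y' Ay' /fin_inj<-]//|y Ay]; exists y.
  by move=> /(ray_closed u0)[t /= t0 <-]; exact: h.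
- exact: connected_closure.
- by apply: subset_closure; exists z.
Qed.

Lemma open_outer : open outer.
Proof.
rewrite openE => z Oz.
have : open (~` closure G) by apply: closed_openC; exact: closed_closure.
move=> oG; have /nbhs_cplxP[e e0 he] : nbhs z (~` closure G).
  by apply: open_nbhs_nbhs; split => //; exact: outer_not_closure.
apply/nbhs_cplxP; exists e => // w we.
apply: (outer_absorb Oz (segment_l z w) _ (@connected_seg R z w)); last exact: segment_r.
by move=> y /segment_ball yz; apply: he; exact: le_lt_trans we.
Qed.

Lemma closure_Omega z : closure (Omega G) (fin z) <-> closure outer z.
Proof. exact: closure_fin. Qed.

(** Otherwise a disk around [z] misses the closure of [G], and a segment inside it joins [z] to a
    point of [outer]. *)
Lemma boundary_outer z : closure outer z -> ~ outer z -> closure G z.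
Proof.
move=> cz nz; apply: contrapT => nG; apply: nz.
have oG : open (~` closure G) by apply: closed_openC; exact: closed_closure.
have /nbhs_cplxP[e e0 he] : nbhs z (~` closure G) by apply: open_nbhs_nbhs.
have /closure_cplxP/(_ _ e0)[w Ow we] := cz.
apply: (outer_absorb Ow (segment_r z w) _ (@connected_seg R z w)); last exact: segment_l.
by move=> y /segment_ball yz; apply: he; exact: le_lt_trans we.
Qed.

Lemma outer_far (r : R) : (forall z, closure G z -> cabs z <= r) ->
  forall z, r < cabs z -> outer z.
Proof.
move=> Gr z rz; have [z0|z0] := eqVneq z 0.
  apply: (@outer_ray z 1); first exact: oner_neq0.
  move=> t t0 /Gr; rewrite z0 add0r mulr1 cabs_rc ger0_norm //.
  move: rz; rewrite z0 cabs0; lra.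
apply: (@outer_ray z z) => // t t0 /Gr.
rewrite -[X in X + _]mul1r -mulrDl -rc1 -rcD cabsM cabs_rc ger0_norm; last lra.
have : 0 <= t * cabs z by rewrite mulr_ge0 // cabs_ge0.
lra.
Qed.

End OuterDomain.

(** * Faber polynomials *)

(** If P - c z^n had degree at least n, its own leading term would dominate it far out on the
    positive axis and exceed a quarter of itself, against the assumed o(|z|^n). *)
Lemma size_lead_infty (R : realType) (P : {poly Cplx R}) (c : Cplx R) n : c != 0 ->
  (forall e : R, 0 < e -> exists r : R, forall z, r < cabs z ->
     cabs (P.[z] - c * z ^+ n) <= e * cabs z ^+ n) ->
  size P = n.+1 /\ lead_coef P = c.
Proof.
move=> c0 h; pose Q := P - c *: 'X^n.
have sQ : (size Q <= n)%N.
  rewrite leqNgt; apply/negP => nQ.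
  have Q0 : Q != 0 by rewrite -size_poly_gt0 (leq_trans _ nQ).
  pose q := cabs (lead_coef Q).
  have q0 : 0 < q by rewrite cabs_gt0 lead_coef_eq0.
  have sE : size Q = (size Q).-1.+1 by rewrite prednK // size_poly_gt0.
  have [|A A0 hA] := @horner_infty R Q (size Q).-1; first by rewrite -sE.
  have [r hr] := h (q / 4) (divr_gt0 q0 (ltr0Sn _ 3)).
  have [x [rx x1 xq]] : exists x : R, [/\ r < x, 1 <= x & 2 * A < x * q].
    exists (1 + `|r| + 2 * A / q).
    have Aq : 0 <= 2 * A / q by rewrite divr_ge0 ?mulr_ge0 // ltW.
    have := normr_ge0 r; have := ler_norm r => h1 h2.
    split; [lra|lra|].
    have -> : (1 + `|r| + 2 * A / q) * q = (1 + `|r|) * q + 2 * A.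
      by field; rewrite gt_eqF.
    by rewrite ltrDr mulr_gt0 //; lra.
  have xE : cabs (rc x) = x by rewrite cabs_rc ger0_norm //; exact: le_trans x1.
  have := hA (rc x); rewrite xE => /(_ x1).
  have := hr (rc x); rewrite xE => /(_ rx).
  have -> : P.[rc x] - c * rc x ^+ n = Q.[rc x].
    by rewrite /Q hornerD hornerN hornerZ hornerXn.
  have xm : 0 < x ^+ (size Q).-1 by rewrite exprn_gt0 // (lt_le_trans ltr01).
  have h3 : x ^+ n <= x ^+ (size Q).-1.
    by apply: ler_weXn2l => //; rewrite -ltnS -sE.
  have h4 := cabs_lb (Q`_(size Q).-1 * rc x ^+ (size Q).-1) Q.[rc x].
  rewrite cabsM cabsX xE (cabsBC _ Q.[_]) in h4.
  move: h4 xm h3; rewrite -[Q`__]/(lead_coef Q) -/q.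
  move: (cabs (_ - _)) (cabs Q.[_]) (x ^+ n) (x ^+ _) => u v Y X h4 xm h3 h1 h2.
  have h5 : q / 4 * Y <= q / 4 * X by apply: ler_wpM2l => //; lra.
  have h6 : x * (3 / 4 * q * X) <= x * u by apply: ler_wpM2l; lra.
  have h7 : x * (3 / 4 * q) <= A.
    by rewrite -(ler_pM2r xm) -[x * _ * X]mulrA; apply: le_trans h6 _.
  lra.
have PE : P = c *: 'X^n + Q by rewrite /Q addrC subrK.
have sc : size (c *: 'X^n) = n.+1 by rewrite size_scale // size_polyXn.
rewrite PE size_polyDl ?lead_coefDl ?sc //; split => //.
by rewrite lead_coefZ lead_coefXn mulr1.
Qed.

#[local] Instance near_infty_filter (R : realType) : Filter (@near_infty R).
Proof. exact: fmap_filter. Qed.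

Section FaberPolynomials.
Context {R : realType} (V : set (Cplx R)) (phi : Cplx R -> Cplx R) (a : R)
  (F : nat -> {poly Cplx R}).
Hypotheses (oV : open V) (cphi : {within closure V, continuous phi})
  (Vfar : exists r : R, forall z, r < cabs z -> V z)
  (phi_inj : forall z w, V z -> V w -> phi z = phi w -> z = w)
  (phi_gt1 : forall z, V z -> 1 < cabs (phi z))
  (phi_onto : forall w, 1 < cabs w -> exists2 z, V z & phi z = w)
  (a0 : 0 < a) (phi_infty : phi z / z @[z --> near_infty] --> rc a)
  (FE : forall e : R, 0 < e -> exists n0, forall n, (n0 <= n)%N ->
     forall z, closure V z -> cabs ((F n).[z] - phi z ^+ n) <= e).

Lemma phi_near z (e : R) : closure V z -> 0 < e ->
  exists2 d : R, 0 < d & forall w, closure V w -> cabs (w - z) < d ->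
    cabs (phi w - phi z) < e.
Proof.
move=> Vz e0.
have /subspace_continuousP/(_ z Vz) := cphi.
move=> /cvg_cplxP/(_ e e0)/nbhs_cplxP[d d0 h].
by exists d => // w Vw wd; apply: h.
Qed.

Lemma phi_ge1 z : closure V z -> 1 <= cabs (phi z).
Proof.
move=> Vz; rewrite leNgt; apply/negP => h.
have e0 : 0 < 1 - cabs (phi z) by lra.
have [d d0 hd] := phi_near Vz e0.
have /closure_cplxP/(_ d d0)[w Vw wd] := Vz.
have := hd _ (subset_closure Vw) wd; have := phi_gt1 Vw.
have := cabs_lb (phi w) (phi z); lra.
Qed.

Lemma phi_compact_gap (K : set (Cplx R)) w : compact K -> K `<=` V ->
  (forall z, K z -> phi z <> w) ->
  exists2 m : R, 0 < m & forall z, K z -> m <= cabs (phi z - w).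
Proof.
move=> cK KV hw; have [->|/set0P K0] := eqVneq K set0; first by exists 1.
have cg : continuous (fun x : Cplx R => cabs (x - w)).
  apply: continuous_lip1 => x y; rewrite ler_norml.
  have := cabs_triangle y x w; have := cabs_triangle x y w.
  rewrite (cabsBC y x); lra.
have cf : {within K, continuous (fun z => cabs (phi z - w))}.
  have h := continuous_subspaceW (subset_trans KV (@subset_closure _ V)) cphi.
  by move=> z; exact: (continuous_comp (h z) (cg _)).
have [z Kz hz] := compact_argmin K0 cK cf.
exists (cabs (phi z - w)) => //.
by rewrite cabs_gt0 subr_eq0; apply/eqP; apply: hw.
Qed.

(* Otherwise [phi zeta = phi z1] with [z1] in [V], and for [z'] in [V] close to
   [zeta] the quotient [F_j / (F_(j+1) - phi z' * F_j)], which is close to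
   [1 / (phi - phi z')], is larger at [z1] than on a circle around [z1]. *)
Lemma phi_boundary zeta : closure V zeta -> ~ V zeta -> cabs (phi zeta) = 1.
Proof.
move=> Vzeta nV; apply/eqP; rewrite eq_le phi_ge1 // andbT leNgt.
apply/negP => /phi_onto[z1 Vz1 z1E].
have /nbhs_cplxP[s' s'0 hs'] : nbhs z1 V by apply: open_nbhs_nbhs.
pose s := s' / 2; have s0 : 0 < s by rewrite /s; lra.
pose D : set (Cplx R) := [set z | cabs (z - z1) <= s].
have DV : D `<=` V by move=> z Dz; apply: hs'; apply: le_lt_trans Dz _; rewrite /s; lra.
have cD : compact D.
  apply: (@compact_cplx _ _ (s + cabs z1)); first exact: closed_cball.
  by move=> z /= Dz; have := cabs_lb z z1; rewrite /D /= in Dz; lra.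
pose S : set (Cplx R) := [set z | cabs (z - z1) = s].
have cS : compact S.
  apply: (subclosed_compact _ cD); last by move=> z; rewrite /S /D /= => ->.
  rewrite (_ : S = D `&` ~` [set z | cabs (z - z1) < s]).
    apply: closedI; first exact: closed_cball.
    by apply: open_closedC; exact: open_cball.
  apply/seteqP; split => z; rewrite /S /D /=; first by move=> ->; rewrite ltxx.
  by move=> [h /negP]; rewrite -leNgt => h2; apply/eqP; rewrite eq_le h h2.
have SD : S `<=` D by move=> z; rewrite /S /D /= => ->.
have [m m0 hm] : exists2 m : R, 0 < m & forall z, S z -> m <= cabs (phi z - phi z1).
  apply: phi_compact_gap => // [|z Sz E]; first exact: subset_trans DV.
  have Vz : V z by exact/DV/SD.
  by move: Sz; rewrite /S /= (phi_inj Vz Vz1 E) subrr cabs0 => s_0; move: s0; rewrite -s_0 ltxx.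
have [|d d0 hd] := @phi_near zeta (m / 64) Vzeta; first lra.
have Dzeta : s < cabs (zeta - z1) by rewrite ltNge; apply/negP => /DV.
(* The second bound keeps [z'] outside [D], so that phi - phi z' has no zero there. *)
pose d' := Num.min d (cabs (zeta - z1) - s).
have d'0 : 0 < d' by rewrite lt_min d0; lra.
have /closure_cplxP/(_ d' d'0)[z' Vz'] := Vzeta.
rewrite lt_min => /andP[z'd z's].
have Dz' : ~ D z'.
  rewrite /D /= => h; have := cabs_triangle z' zeta z1; rewrite (cabsBC zeta z'); lra.
pose w' := phi z'.
have w'1 : cabs (w' - phi z1) < m / 64 by rewrite z1E; exact: (hd _ (subset_closure Vz') z'd).
have [m' m'0 hm'] : exists2 m' : R, 0 < m' & forall z, D z -> m' <= cabs (phi z - w').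
  apply: phi_compact_gap => // z Dz E; apply: Dz'.
  by rewrite -(phi_inj (DV _ Dz) Vz' E).
pose q := 1 + cabs w'.
have q0 : 0 < q by rewrite /q; have := cabs_ge0 w'; lra.
pose e := Num.min (1 / 2) (Num.min (m / 64 / q) (m' / 4 / q)).
have e0 : 0 < e by rewrite !lt_min !divr_gt0 //; lra.
have e1 : e <= 1 / 2 by rewrite ge_min lexx.
have e2 : e * q <= m / 64 by rewrite -ler_pdivlMr // !ge_min lexx orbT.
have e3 : e * q <= m' / 4 by rewrite -ler_pdivlMr // !ge_min lexx !orbT.
have [j hj] := FE e0.
pose N := F j; pose P := F j.+1 - w' *: F j.
have hN z : V z -> cabs (N.[z] - phi z ^+ j) <= e.
  by move=> Vz; exact: (hj _ (leqnn j) _ (subset_closure Vz)).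
have hP z : V z -> cabs (P.[z] - phi z ^+ j * (phi z - w')) <= e * q.
  move=> Vz; have h1 := hN _ Vz.
  have h2 := hj j.+1 (leqnSn _) z (subset_closure Vz).
  have -> : P.[z] - phi z ^+ j * (phi z - w') =
      ((F j.+1).[z] - phi z ^+ j.+1) - w' * (N.[z] - phi z ^+ j).
    by rewrite /P /N hornerD hornerN hornerZ exprS; ring.
  apply: le_trans (cabsB _ _) _; rewrite cabsM /q.
  have : cabs w' * cabs (N.[z] - phi z ^+ j) <= cabs w' * e.
    by apply: ler_wpM2l => //; exact: cabs_ge0.
  lra.
have phij z : V z -> 1 <= cabs (phi z) ^+ j.
  by move=> Vz; apply: exprn_ege1; exact: ltW (phi_gt1 Vz).
have ltP z (k : R) : V z -> 0 <= k -> k <= cabs (phi z - w') ->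
    cabs (phi z) ^+ j * k - e * q <= cabs P.[z].
  move=> Vz k0 hk.
  have : cabs (phi z) ^+ j * k <= cabs (phi z ^+ j * (phi z - w')).
    by rewrite cabsM cabsX; apply: ler_wpM2l => //; have := phij _ Vz; lra.
  have := cabs_lb (phi z ^+ j * (phi z - w')) P.[z]; have := hP _ Vz.
  rewrite (cabsBC P.[z]); lra.
pose U : set (Cplx R) := [set z | cabs (z - z1) < s].
have UD z : closure U z -> D z.
  have : closure U `<=` closure D by apply: closureS => y /ltW.
  by move=> /[apply]; exact: (@closed_cball R z1 s).
(* With p = |phi z|^j at the point considered, |N| <= 2p and |P| >= m p / 4 on the circle, whereas
   |N| >= p / 2 and |P| <= m p / 32 at the centre. So 8 / m bounds the quotient on the circle and
   not at the centre. *)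
have := @max_principle R U N P (8 / m) (open_cball (c:=z1) (r:=s)).
have bU : bounded_set U.
  apply/bounded_cplxP; exists (s + cabs z1) => z; rewrite /U /= => Uz.
  by have := cabs_lb z z1; lra.
have m8 : 0 <= 8 / m by rewrite divr_ge0 // ltW.
move=> /(_ bU m8).
have h1 z : closure U z -> P.[z] != 0.
  move=> /UD Dz; rewrite -cabs_gt0.
  have := ltP z m' (DV _ Dz) (ltW m'0) (hm' _ Dz).
  have : m' <= cabs (phi z) ^+ j * m'.
    by rewrite -[X in X <= _]mul1r; apply: ler_wpM2r; [exact: ltW|exact/phij/DV].
  lra.
move=> /(_ h1); have h2 z : closure U z -> ~ U z -> cabs N.[z] <= 8 / m * cabs P.[z].
  move=> /UD Dz nU; have Vz := DV _ Dz.
  have Sz : S z by apply/eqP; rewrite eq_le [X in X && _]Dz leNgt; apply/negP.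
  have km : m / 2 <= cabs (phi z - w').
    have := hm _ Sz; have := cabs_triangle w' (phi z) (phi z1); lra.
  have m20 : 0 <= m / 2 by lra.
  have := ltP z _ Vz m20 km.
  have := hN _ Vz; have := cabs_lb N.[z] (phi z ^+ j); rewrite cabsX.
  have pj := phij _ Vz; set p := cabs (phi z) ^+ j in pj *.
  have : m * 1 <= m * p by apply: ler_wpM2l => //; exact: ltW.
  move=> h3 h4 h5 h6.
  have h7 : m * (p / 4) <= cabs P.[z] by lra.
  apply: le_trans (_ : 8 / m * (m * (p / 4)) <= _); last exact: ler_wpM2l.
  have -> : 8 / m * (m * (p / 4)) = 2 * p by field; rewrite gt_eqF.
  lra.
have Uz1 : closure U z1 by apply: subset_closure; rewrite /U /= subrr cabs0.
move=> /(_ h2 z1 Uz1).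
have := hN _ Vz1; have := hP _ Vz1; have pj := phij _ Vz1.
have := cabs_lb (phi z1 ^+ j) N.[z1]; have := cabs_lb P.[z1] (phi z1 ^+ j * (phi z1 - w')).
rewrite cabsM cabsX (cabsBC (phi z1) w') (cabsBC (_ ^+ j)); set p := cabs (phi z1) ^+ j in pj *.
move=> h3 h4 h5 h6 h7.
have h8 : p * cabs (w' - phi z1) <= p * (m / 64) by apply: ler_wpM2l; lra.
have h9 : m / 64 <= p * (m / 64).
  by rewrite -[X in X <= _]mul1r; apply: ler_wpM2r => //; lra.
have h10 : 8 / m * cabs P.[z1] <= 8 / m * (p * (m / 32)) by apply: ler_wpM2l => //; lra.
have : 8 / m * (p * (m / 32)) = p / 4 by field; rewrite gt_eqF.
lra.
Qed.

Lemma faber_lower z (e : R) n : cabs ((F n).[z] - phi z ^+ n) <= e ->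
  cabs (phi z) ^+ n - e <= cabs (F n).[z].
Proof.
move=> h; have := cabs_lb (phi z ^+ n) (F n).[z].
by rewrite cabsX cabsBC => h2; have := le_trans h2 h; lra.
Qed.

(** On the boundary of [V] the modulus of phi^n is 1 by [phi_boundary]; the maximum principle with
    denominator 1 carries the bound into the complement of [V], which is bounded. *)
Lemma faber_inside (e : R) : 0 < e -> exists n0, forall n, (n0 <= n)%N ->
  forall z, ~ V z -> cabs (F n).[z] <= 1 + e.
Proof.
move=> e0; have [n0 hn0] := FE e0; exists n0 => n nn0 z nVz.
have bd y : closure V y -> ~ V y -> cabs (F n).[y] <= 1 + e.
  move=> Vy nVy; have := hn0 _ nn0 _ Vy.
  have := cabs_lb (F n).[y] (phi y ^+ n); rewrite cabsX phi_boundary // expr1n; lra.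
have [Vz|nclz] := pselect (closure V z); first exact: bd.
pose U := ~` closure V.
have oU : open U by apply: closed_openC; exact: closed_closure.
have bU : bounded_set U.
  have [r hr] := Vfar; apply/bounded_cplxP; exists r => y nVy.
  by rewrite leNgt; apply/negP => /hr /subset_closure.
have e1 : 0 <= 1 + e by lra.
have one y : (1%:P : {poly Cplx R}).[y] = 1 by rewrite hornerC.
have P0 y : closure U y -> (1%:P : {poly Cplx R}).[y] != 0.
  by move=> _; rewrite one oner_neq0.
have := max_principle oU bU e1 P0 (N := F n).
move=> /(_ _ z (subset_closure nclz)); rewrite one cabs1 mulr1; apply.
move=> y Uy nUy; rewrite one cabs1 mulr1.
have Vy : closure V y by apply: contrapT.
apply: (bd _ Vy) => Vy'.
have /closure_cplxP h := Uy.
have /nbhs_cplxP[d d0 hd] : nbhs y V by exact: (open_nbhs_nbhs (conj oV Vy')).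
have [w Uw wd] := h _ d0; apply: Uw; apply: subset_closure; exact: hd.
Qed.

Lemma faber_size_lead : exists n0, forall n, (n0 <= n)%N ->
  size (F n) = n.+1 /\ lead_coef (F n) = rc (a ^+ n).
Proof.
(* The successor makes [n] positive, so that an error of at most 1 is o(|z|^n). *)
have [n0 hn0] := FE ltr01; exists n0.+1 => n nn0.
apply: size_lead_infty => [|e e0].
  by rewrite -cabs_eq0 cabs_rc normr_eq0 expf_neq0 // gt_eqF.
have : (phi z / z) ^+ n @[z --> near_infty] --> rc a ^+ n.
  have cX : continuous (horner 'X^n : Cplx R -> Cplx R) := @continuous_horner R _.
  rewrite (_ : horner 'X^n = fun x : Cplx R => x ^+ n) in cX; last first.
    by apply/funext => x; rewrite hornerXn.
  exact: (cvg_comp _ _ phi_infty (cX (rc a))).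
have e2 : 0 < e / 2 by lra.
move=> /cvg_cplxP/(_ _ e2)/near_inftyP[r1 h1].
have [r2 hr2] := Vfar.
exists (`|r1| + `|r2| + 2 / e + 1) => z zr.
have r1p := normr_ge0 r1; have r2p := normr_ge0 r2.
have ep : 0 < 2 / e by rewrite divr_gt0.
have zp : 0 < cabs z by lra.
have z0 : z != 0 by rewrite -cabs_gt0.
have Vz : V z by apply: hr2; have := ler_norm r2; lra.
have h2 := hn0 n (ltnW nn0) _ (subset_closure Vz).
have {}h1 : cabs ((phi z / z) ^+ n - rc a ^+ n) < e / 2.
  by apply: h1; have := ler_norm r1; lra.
have -> : (F n).[z] - rc (a ^+ n) * z ^+ n =
    ((F n).[z] - phi z ^+ n) + ((phi z / z) ^+ n - rc a ^+ n) * z ^+ n.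
  have h : (phi z / z) ^+ n * z ^+ n = phi z ^+ n by rewrite -exprMn divfK.
  by rewrite rcX mulrBl h addrA subrK.
apply: le_trans (cabsD _ _) _; rewrite cabsM cabsX.
have zn : 0 <= cabs z ^+ n by rewrite exprn_ge0 // cabs_ge0.
have h3 : cabs ((phi z / z) ^+ n - rc a ^+ n) * cabs z ^+ n <= e / 2 * cabs z ^+ n.
  by apply: ler_wpM2r => //; exact: ltW.
have h4 : cabs z <= cabs z ^+ n.
  rewrite -[X in X <= _]expr1; apply: ler_weXn2l; first lra.
  exact: leq_ltn_trans nn0.
have h5 : e / 2 * (2 / e) <= e / 2 * cabs z ^+ n by apply: ler_wpM2l; lra.
have : e / 2 * (2 / e) = 1 by field; rewrite gt_eqF.
lra.
Qed.

End FaberPolynomials.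

(** * Orthonormal polynomials *)

Section BorelMeasures.
Context {R : realType}.

Lemma measurable_openC (U : set (Cplx R)) : open U -> measurable (U : set (borelC R)).
Proof. by move=> oU; apply: sub_sigma_algebra. Qed.

Lemma measurable_closedC (U : set (Cplx R)) : closed U -> measurable (U : set (borelC R)).
Proof.
move=> cU; rewrite -[U]setCK; apply: measurableC; apply: measurable_openC.
exact: closed_openC.
Qed.

Lemma continuous_measurableC (f : Cplx R -> R) : continuous f ->
  measurable_fun setT (f : borelC R -> R).
Proof.
move=> cf; apply: (measurability _ (RGenOpens.measurableE R)).
move=> _ [_ [a [b ->] <-]]; rewrite setTI; apply: measurable_openC.
by move/continuousP : cf; apply; exact: interval_open.
Qed.

Lemma closed_supp (mu : set (borelC R) -> \bar R) : closed (supp mu).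
Proof.
move=> z cz U oU Uz.
have [|w [sw Uw]] := cz U; first by apply: open_nbhs_nbhs.
exact: sw.
Qed.

(** Disks centred on the grid of mesh 1 / (n+1). The radius exceeds the distance from any point to
    the grid point below and to the left of it. The index type is countable, which makes the family
    usable through [pickle]. *)
Definition ratball (x : nat * int * int) : set (Cplx R) :=
  let: (n, p, q) := x in
  [set z | cabs (z - Complex (p%:~R / n.+1%:R) (q%:~R / n.+1%:R)) < 2 / n.+1%:R].

Lemma ratball_basis z (e : R) : 0 < e -> exists x, ratball x z /\
  forall w, ratball x w -> cabs (w - z) < e.
Proof.
(* This puts the diameter 4 / (n+1) below [e]. *)
move=> e0; pose n := Num.truncn (4 / e); pose N : R := n.+1%:R.
have N0 : 0 < N by rewrite ltr0n.
have hN : 4 / e < N by exact: truncnS_gt.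
pose p := Num.floor (cRe z * N); pose q := Num.floor (cIm z * N).
exists (n, p, q); rewrite /ratball -/N; set c := Complex _ _.
have zc : cabs (z - c) < 2 / N.
  apply: le_lt_trans (cabs_le _) _; rewrite cReB cImB.
  have -> : cRe c = p%:~R / N by [].
  have -> : cIm c = q%:~R / N by [].
  have h x : `|x - (Num.floor (x * N))%:~R / N| < 1 / N.
    have /andP[h1 h2] := floor_itv (x * N).
    rewrite ger0_norm ?subr_ge0 ?ler_pdivrMr //.
    rewrite ltrBlDr -mulrDl ltr_pdivlMr //.
    by move: h2; rewrite intrD; lra.
  by apply: lt_le_trans (ltrD (h _) (h _)) _; rewrite -mulrDl.
split => // w /= wc; have := cabs_triangle c w z; rewrite (cabsBC c).
have : 4 / N < e by rewrite ltr_pdivrMr // -ltr_pdivrMl // mulrC.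
have -> : 4 / N = 2 / N + 2 / N by rewrite -mulrDl -natrD.
move: wc zc; rewrite -/N -/c; move: (2 / N) => u; lra.
Qed.

(** Each point off the support lies in a null disk of the countable family [ratball]. *)
Lemma supp_negligible (mu : {measure set (borelC R) -> \bar R}) :
  mu.-negligible (~` supp mu).
Proof.
pose W k : set (borelC R) := if unpickle k is Some x then
  if mu (ratball x) == 0%E then ratball x else set0 else set0.
have : mu.-negligible (\bigcup_k W k).
  apply: negligible_bigcup => k; rewrite /W.
  case: unpickle => [[[n p] q]|]; last exact: negligible_set0.
  case: ifPn => [/eqP m0|_]; last exact: negligible_set0.
  by exists (ratball (n, p, q)); split => //; apply: measurable_openC; exact: open_cball.
apply: negligibleS => z /= nz.
have [U [oU Uz nU]] : exists U : set (Cplx R), [/\ open U, U z & ~ (0 < mu U)%E].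
  by move: nz; apply: contra_notP => /forallNP h U oU Uz;
    apply: contrapT => nU; apply: (h U).
have /nbhs_cplxP[e e0 he] : nbhs z U by apply: open_nbhs_nbhs.
have [x [xz hx]] := ratball_basis z e0.
exists (pickle x) => //; rewrite /W pickleK; case: ifPn => // /negP; case.
have mx : measurable (ratball x : set (borelC R)).
  by case: x xz {hx} => [[n p] q] _; apply: measurable_openC; exact: open_cball.
rewrite eq_le measure_ge0 andbT leNgt; apply/negP => h; apply: nU.
apply: lt_le_trans h _; apply: le_measure; rewrite ?inE //; first exact: measurable_openC.
by move=> w /hx; exact: he.
Qed.

Lemma ae_supp (mu : {measure set (borelC R) -> \bar R}) (P : set (Cplx R)) :
  supp mu `<=` P -> {ae mu, forall z : borelC R, setT z -> P z}.
Proof.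
move=> h; apply: negligibleS (supp_negligible mu) => z /= nP /h Pz.
by apply: nP.
Qed.

End BorelMeasures.

(** * Integration of continuous functions against a compactly supported measure *)

Section MeanFunctional.
Context {R : realType} (mu : {finite_measure set (borelC R) -> \bar R}).
Hypothesis cS : compact (supp mu).
Implicit Types (f g : Cplx R -> R).

Lemma integrable_continuous f : continuous f ->
  mu.-integrable setT (EFin \o f : borelC R -> \bar R).
Proof.
move=> cf; have mf := continuous_measurableC cf.
have [M hM] : exists M : R, forall z, supp mu z -> `|f z| <= M.
  have [->|/set0P S0] := eqVneq (supp mu) set0; first by exists 0.
  have cf' : continuous (fun z => `|f z|).
    by move=> z; exact: (continuous_comp (cf z) (@norm_continuous _ _ _)).
  have [c _ h] := compact_argmax S0 cS (continuous_subspaceT cf').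
  by exists (`|f c|).
apply/integrableP; split; first exact/measurable_EFinP.
pose M' := `|M|.
apply: (@le_lt_trans _ _ (\int[mu]_(x in setT) (M'%:E))%E).
  have mn : measurable_fun setT (fun x : borelC R => (`|(f x)%:E|)%E).
    by apply: measurableT_comp => //; exact/measurable_EFinP.
  apply: ae_ge0_le_integral => //.
  - by move=> x _; rewrite lee_fin normr_ge0.
  - apply: ae_supp => z /hM h; rewrite /= lee_fin.
    exact: le_trans h (ler_norm _).
rewrite integral_cst //; apply: lte_mul_pinfty => //.
  by rewrite lee_fin normr_ge0.
by rewrite ltey_eq fin_num_measure.
Qed.

Definition mean f : R := (\int[mu]_(z in setT) f z)%R.

Lemma meanD f g : continuous f -> continuous g ->
  mean (fun z => f z + g z) = mean f + mean g.
Proof. by move=> cf cg; apply: RintegralD => //; exact: integrable_continuous. Qed.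

Lemma meanZ (c : R) f : continuous f -> mean (fun z => c * f z) = c * mean f.
Proof. by move=> cf; apply: RintegralZl => //; exact: integrable_continuous. Qed.

Lemma mean_ge0 f : continuous f -> (forall z, supp mu z -> 0 <= f z) -> 0 <= mean f.
Proof.
move=> cf f0.
have cf' : continuous (fun z => `|f z|).
  by move=> z; exact: (continuous_comp (cf z) (@norm_continuous _ _ _)).
(* The sign of [f] is known only on the support, so [f] is replaced by its absolute value, equal to
   it almost everywhere. *)
rewrite /mean /Rintegral (ae_eq_integral (fun z : borelC R => (`|f z|)%:E)) //.
- by apply: fine_ge0; apply: integral_ge0 => z _; rewrite lee_fin.
- by apply/measurable_EFinP; exact: continuous_measurableC.
- by apply/measurable_EFinP; exact: continuous_measurableC.
- by apply: ae_supp => z /f0 fz /=; rewrite ger0_norm.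
Qed.

Lemma mean_le f g : continuous f -> continuous g ->
  (forall z, supp mu z -> f z <= g z) -> mean f <= mean g.
Proof.
move=> cf cg fg; rewrite -subr_ge0.
have cNf : continuous (fun z => -1 * f z).
  by move=> z; exact: (cvgM (cvg_cst _) (cf z)).
have -> : mean g - mean f = mean (fun z => g z + -1 * f z).
  by rewrite meanD // meanZ // mulN1r.
apply: mean_ge0 => [z|z /fg]; last lra.
exact: (cvgD (cg z) (cNf z)).
Qed.

End MeanFunctional.

(** * The inner product on polynomials *)

Section HermitianForm.
Context {R : realType} (mu : {finite_measure set (borelC R) -> \bar R}).
Hypothesis cS : compact (supp mu).
Implicit Types (f g : Cplx R -> Cplx R) (P Q : {poly Cplx R}).

Lemma continuous_conj : continuous (fun z : Cplx R => z^*).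
Proof.
move=> z; apply/(@cvg_cplxP _ _ (nbhs z)) => e e0; apply/nbhs_cplxP; exists e => // w.
by rewrite -rmorphB cabsJ.
Qed.

Lemma continuous_cReP f : continuous f -> continuous (fun z => cRe (f z)).
Proof. by move=> cf z; exact: (continuous_comp (cf z) (@continuous_cRe R _)). Qed.

Lemma continuous_cImP f : continuous f -> continuous (fun z => cIm (f z)).
Proof. by move=> cf z; exact: (continuous_comp (cf z) (@continuous_cIm R _)). Qed.

Lemma cRe_cintegral f : cRe (cintegral mu f) = mean mu (fun z => cRe (f z)).
Proof. by []. Qed.

Lemma cIm_cintegral f : cIm (cintegral mu f) = mean mu (fun z => cIm (f z)).
Proof. by []. Qed.

Lemma cintegralD f g : continuous f -> continuous g ->
  cintegral mu (fun z => f z + g z) = cintegral mu f + cintegral mu g.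
Proof.
move=> cf cg; have cfR := continuous_cReP cf; have cgR := continuous_cReP cg.
have cfI := continuous_cImP cf; have cgI := continuous_cImP cg.
apply: cplx_eqP.
  rewrite cReD !cRe_cintegral -(meanD cS cfR cgR).
  by congr mean; apply/funext => z; rewrite cReD.
rewrite cImD !cIm_cintegral -(meanD cS cfI cgI).
by congr mean; apply/funext => z; rewrite cImD.
Qed.

Lemma cintegralZ (c : Cplx R) f : continuous f ->
  cintegral mu (fun z => c * f z) = c * cintegral mu f.
Proof.
move=> cf; have cfR := continuous_cReP cf; have cfI := continuous_cImP cf.
have cZ (a : R) (h : Cplx R -> R) : continuous h -> continuous (fun z => a * h z).
  by move=> ch z; exact: (cvgM (cvg_cst _) (ch z)).
have c1 := cZ (cRe c) _ cfR; have c2 := cZ (- cIm c) _ cfI.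
have c3 := cZ (cRe c) _ cfI; have c4 := cZ (cIm c) _ cfR.
apply: cplx_eqP.
  rewrite cReM !cRe_cintegral cIm_cintegral.
  rewrite -mulNr -(meanZ cS (cRe c) cfR) -(meanZ cS (- cIm c) cfI).
  rewrite -(meanD cS c1 c2).
  by congr mean; apply/funext => z; rewrite cReM mulNr.
rewrite cImM !cIm_cintegral cRe_cintegral.
rewrite -(meanZ cS (cRe c) cfI) -(meanZ cS (cIm c) cfR).
rewrite -(meanD cS c3 c4).
by congr mean; apply/funext => z; rewrite cImM.
Qed.

Lemma cintegralJ f : continuous f ->
  cintegral mu (fun z => (f z)^*) = (cintegral mu f)^*.
Proof.
move=> cf; have cfI := continuous_cImP cf.
apply: cplx_eqP.
  by rewrite cReJ !cRe_cintegral; congr mean; apply/funext => z; rewrite cReJ.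
rewrite cImJ !cIm_cintegral -mulN1r -(meanZ cS (-1) cfI).
by congr mean; apply/funext => z; rewrite cImJ mulN1r.
Qed.

Definition ip P Q : Cplx R := cintegral mu (fun z => (P.[z])^* * Q.[z]).

Definition nrm2 P : R := mean mu (fun z => cabs P.[z] ^+ 2).

Definition nrm P : R := Num.sqrt (nrm2 P).

Lemma continuous_ip P Q : continuous (fun z : Cplx R => (P.[z])^* * Q.[z]).
Proof.
have cJ : continuous (fun z : Cplx R => (P.[z])^*).
  by move=> z; exact: (continuous_comp (@continuous_horner R P z) (@continuous_conj _)).
by move=> z; exact: (cvgM (cJ z) (@continuous_horner R Q z)).
Qed.

Lemma continuous_nrm2 P : continuous (fun z : Cplx R => cabs P.[z] ^+ 2).
Proof.
have h := @continuous_cabs_horner R P.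
by move=> z; exact: (cvgM (h z) (h z)).
Qed.

Lemma ipJ P Q : ip Q P = (ip P Q)^*.
Proof.
rewrite /ip -cintegralJ; last exact: continuous_ip.
by congr cintegral; apply/funext => z; rewrite rmorphM /= conjCK mulrC.
Qed.

Lemma ipDr P Q Q' : ip P (Q + Q') = ip P Q + ip P Q'.
Proof.
rewrite /ip -(cintegralD (@continuous_ip P Q) (@continuous_ip P Q')).
by congr cintegral; apply/funext => z; rewrite hornerD mulrDr.
Qed.

Lemma ipZr P (c : Cplx R) Q : ip P (c *: Q) = c * ip P Q.
Proof.
rewrite /ip -(cintegralZ c (@continuous_ip P Q)).
by congr cintegral; apply/funext => z; rewrite hornerZ mulrCA.
Qed.

Lemma ipNr P Q : ip P (- Q) = - ip P Q.
Proof. by rewrite -scaleN1r ipZr mulN1r. Qed.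

Lemma ipDl P P' Q : ip (P + P') Q = ip P Q + ip P' Q.
Proof. by rewrite ipJ ipDr rmorphD /= -!ipJ. Qed.

Lemma ipZl (c : Cplx R) P Q : ip (c *: P) Q = c^* * ip P Q.
Proof. by rewrite ipJ ipZr rmorphM /= -ipJ. Qed.

Lemma ipE P : ip P P = rc (nrm2 P).
Proof.
apply: cplx_eqP.
  rewrite cRe_cintegral cRe_rc; congr mean; apply/funext => z.
  by rewrite mulJc cRe_rc.
rewrite cIm_cintegral cIm_rc.
transitivity (mean mu (fun z : Cplx R => 0 * cRe z)).
  by congr mean; apply/funext => z; rewrite mulJc cIm_rc mul0r.
by rewrite (meanZ cS 0 (@continuous_cRe R)) mul0r.
Qed.

Lemma nrm2_ge0 P : 0 <= nrm2 P.
Proof. by apply: (mean_ge0 (@continuous_nrm2 P)) => z _; rewrite sqr_ge0. Qed.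

Lemma nrm_ge0 P : 0 <= nrm P.
Proof. exact: sqrtr_ge0. Qed.

Lemma nrm_sqr P : nrm P ^+ 2 = nrm2 P.
Proof. by rewrite sqr_sqrtr // nrm2_ge0. Qed.

Lemma nrm2D P Q : nrm2 (P + Q) = nrm2 P + nrm2 Q + 2 * cRe (ip P Q).
Proof.
rewrite -[LHS]cRe_rc -ipE ipDl !ipDr !cReD !ipE !cRe_rc (ipJ P Q) cReJ; ring.
Qed.

Lemma nrm2Z (c : Cplx R) P : nrm2 (c *: P) = cabs c ^+ 2 * nrm2 P.
Proof. by rewrite -[LHS]cRe_rc -ipE ipZl ipZr ipE mulrA mulJc -rcM cRe_rc. Qed.

Lemma nrmZ (c : Cplx R) P : nrm (c *: P) = cabs c * nrm P.
Proof. by rewrite /nrm nrm2Z sqrtrM ?sqr_ge0 // sqrtr_sqr ger0_norm // cabs_ge0. Qed.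

Lemma cauchy_schwarz P Q : cabs (ip P Q) <= nrm P * nrm Q.
Proof.
rewrite -(@ler_pXn2r _ 2) ?nnegrE ?mulr_ge0 ?cabs_ge0 ?nrm_ge0 //.
rewrite exprMn !nrm_sqr; set s := cabs _ ^+ 2.
have s0 : 0 <= s by rewrite sqr_ge0.
(* This is the squared norm of Q - t (P, Q) P. Taking t = 1 / |P|^2 gives the inequality; if |P| =
   0, a large t forces (P, Q) = 0. *)
have h t : 0 <= nrm2 Q - 2 * t * s + t ^+ 2 * s * nrm2 P.
  have := nrm2_ge0 (Q + (- rc t * ip P Q) *: P).
  rewrite nrm2D nrm2Z cabsM cabsN cabs_rc exprMn real_normK ?num_real // -/s.
  have -> : ip Q ((- rc t * ip P Q) *: P) = - rc (t * s).
    by rewrite ipZr (ipJ P Q) -mulrA [ip P Q * _]mulrC mulJc -/s mulNr -rcM.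
  by rewrite cReN cRe_rc; lra.
have := nrm2_ge0 P; rewrite le_eqVlt => /predU1P[P0|P0].
  rewrite -P0 mul0r leNgt; apply/negP => sp.
  have := h ((nrm2 Q + 1) / (2 * s)); rewrite -P0 mulr0 addr0.
  have -> : nrm2 Q - 2 * ((nrm2 Q + 1) / (2 * s)) * s = -1 by field; rewrite gt_eqF.
  lra.
have := h (nrm2 P)^-1.
have -> : nrm2 Q - 2 * (nrm2 P)^-1 * s + (nrm2 P)^-1 ^+ 2 * s * nrm2 P =
    (nrm2 P * nrm2 Q - s) / nrm2 P by field; rewrite gt_eqF.
by rewrite pmulr_lge0 ?invr_gt0 // subr_ge0.
Qed.

Lemma nrmD P Q : nrm (P + Q) <= nrm P + nrm Q.
Proof.
rewrite -(@ler_pXn2r _ 2) ?nnegrE ?addr_ge0 ?nrm_ge0 //.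
rewrite nrm_sqr nrm2D sqrrD !nrm_sqr.
have := le_trans (ler_norm _) (le_trans (cRe_le (ip P Q)) (cauchy_schwarz P Q)).
lra.
Qed.

Lemma nrm_le (c : R) P Q : 0 <= c ->
  (forall z, supp mu z -> cabs P.[z] <= c * cabs Q.[z]) -> nrm P <= c * nrm Q.
Proof.
move=> c0 h; rewrite -(@ler_pXn2r _ 2) ?nnegrE ?mulr_ge0 ?nrm_ge0 //.
rewrite exprMn !nrm_sqr -(meanZ cS _ (@continuous_nrm2 Q)).
have cZ : continuous (fun z : Cplx R => c ^+ 2 * cabs Q.[z] ^+ 2).
  by move=> z; exact: (cvgM (cvg_cst _) (@continuous_nrm2 Q z)).
apply: (mean_le cS (@continuous_nrm2 P) cZ) => z /h Pz.
by rewrite -exprMn; apply: lerXn2r; rewrite ?nnegrE ?mulr_ge0 ?cabs_ge0.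
Qed.

End HermitianForm.

(** * Extremal estimates for orthonormal polynomials *)

Section OrthonormalPolynomials.
Context {R : realType} (mu : {finite_measure set (borelC R) -> \bar R})
  (p : nat -> {poly Cplx R}).
Hypotheses (cS : compact (supp mu)) (p_ortho : orthonormal_polys mu p).
Implicit Types (P Q : {poly Cplx R}) (z w u : Cplx R).

Lemma size_orthonormal n : size (p n) = n.+1.
Proof. by have [hs hl ho] := p_ortho; exact: hs. Qed.

Definition kappa n : R := cRe (lead_coef (p n)).

Lemma lead_orthonormal n : lead_coef (p n) = rc (kappa n).
Proof.
have [_ /(_ n) h _] := p_ortho.
by apply: cplx_eqP => //; rewrite cIm_rc; exact: ger0_Im (ltW h).
Qed.

Lemma kappa_gt0 n : 0 < kappa n.
Proof. by rewrite -rc_lt -lead_orthonormal; have [hs hl ho] := p_ortho; exact: hl. Qed.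

Lemma coef_orthonormal n : (p n)`_n = rc (kappa n).
Proof. by rewrite -lead_orthonormal lead_coefE size_orthonormal. Qed.

Lemma ip_orthonormal n m : ip mu (p n) (p m) = (n == m)%:R.
Proof. by have [hs hl ho] := p_ortho; exact: ho. Qed.

Lemma nrm_orthonormal n : nrm mu (p n) = 1.
Proof.
by rewrite /nrm -[nrm2 _ _]cRe_rc -(ipE cS) ip_orthonormal eqxx sqrtr1.
Qed.

Lemma ip_low n m Q : (m <= n)%N -> (size Q <= m)%N -> ip mu (p n) Q = 0.
Proof.
elim: m Q => [|m IH] Q mn sQ.
  move: sQ; rewrite leqn0 size_poly_eq0 => /eqP ->.
  by rewrite -(scale0r 0) (ipZr cS) mul0r.
pose c := Q`_m / lead_coef (p m).
have -> : Q = (Q - c *: p m) + c *: p m by rewrite subrK.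
rewrite (ipDr cS) (ipZr cS) ip_orthonormal gtn_eqF // mulr0 addr0.
apply: IH; first exact: ltnW.
apply/leq_sizeP => j; rewrite leq_eqVlt coefB coefZ => /orP[/eqP<-|mj].
  rewrite coef_orthonormal /c lead_orthonormal divfK ?subrr //.
  by rewrite -cabs_eq0 cabs_rc normr_eq0 gt_eqF // kappa_gt0.
by rewrite !nth_default ?size_orthonormal // ?mulr0 ?subr0 // (leq_trans sQ).
Qed.

Lemma ip_lead n Q : (size Q <= n.+1)%N -> ip mu (p n) Q = Q`_n / rc (kappa n).
Proof.
move=> sQ; pose c := Q`_n / rc (kappa n).
have k0 : rc (kappa n) != 0.
  by rewrite -cabs_eq0 cabs_rc normr_eq0 gt_eqF // kappa_gt0.
have -> : ip mu (p n) Q = ip mu (p n) ((Q - c *: p n) + c *: p n) by rewrite subrK.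
rewrite (ipDr cS) (ipZr cS) ip_orthonormal eqxx mulr1 (@ip_low n n) ?add0r //.
apply/leq_sizeP => j; rewrite leq_eqVlt coefB coefZ => /orP[/eqP<-|nj].
  by rewrite coef_orthonormal /c divfK ?subrr.
by rewrite !nth_default ?size_orthonormal // ?mulr0 ?subr0 // (leq_trans sQ).
Qed.

(* [Q(z0) p_n - p_n(z0) Q = (w - z0) T] with [T] of degree less than [n], hence
   orthogonal to [p_n]; pairing with [T] bounds its norm by [|p_n(z0)| |Q| / d]. *)
Lemma eval_le n Q z0 u (d D : R) : (size Q <= n.+1)%N -> 0 < d -> 0 <= D ->
  cabs u = 1 -> (forall w, supp mu w -> d <= cRe (u * (w - z0))) ->
  (forall w, supp mu w -> cabs (w - z0) <= D) ->
  cabs Q.[z0] <= (1 + D / d) * nrm mu Q * cabs (p n).[z0].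
Proof.
move=> sQ d0 D0 u1 hd hD.
pose a := cabs (p n).[z0]; pose q := nrm mu Q.
have a0 : 0 <= a := cabs_ge0 _.
have q0 : 0 <= q := nrm_ge0 _ _.
pose W := Q.[z0] *: p n - (p n).[z0] *: Q.
have rW : root W z0.
  by rewrite /root /W hornerD hornerN !hornerZ [X in _ - X]mulrC subrr.
have [T WE] := factor_theorem _ _ rW.
have sW : (size W <= n.+1)%N.
  rewrite (leq_trans (size_polyD _ _)) // geq_max size_polyN.
  by rewrite !(leq_trans (size_scale_leq _ _)) // size_orthonormal.
have sT : (size T <= n)%N.
  have [->|T0] := eqVneq T 0; first by rewrite size_poly0.
  by move: sW; rewrite WE size_Mmonic ?monicXsubC // size_XsubC addn2.
have WzE z : W.[z] = T.[z] * (z - z0) by rewrite WE hornerM hornerXsubC.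
pose t := nrm mu T; have t0 : 0 <= t := nrm_ge0 _ _.
(* Pairing T with W = (w - z0) T gives the integral of (w - z0) |T|^2, and the half-plane condition
   bounds the real part of its product with [u] from below. *)
have h1 : d * t ^+ 2 <= cabs (ip mu T W).
  rewrite -[cabs (ip _ _ _)]mul1r -u1 -cabsM -(cintegralZ cS u (@continuous_ip R T W)).
  apply: le_trans (le_trans (ler_norm _) (cRe_le _)).
  rewrite cRe_cintegral nrm_sqr // -(meanZ cS d (@continuous_nrm2 R T)).
  apply: (mean_le cS).
  - by move=> z; exact: (cvgM (cvg_cst _) (@continuous_nrm2 R T z)).
  - apply: continuous_cReP => z.
    exact: (cvgM (cvg_cst _) (@continuous_ip R T W z)).
  move=> z /hd hz; rewrite WzE.
  have -> : u * (T.[z]^* * (T.[z] * (z - z0))) = rc (cabs T.[z] ^+ 2) * (u * (z - z0)).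
    by rewrite -mulJc; ring.
  by rewrite cReZ mulrC; apply: ler_wpM2l => //; rewrite sqr_ge0.
have h2 : ip mu T W = - ((p n).[z0] * ip mu T Q).
  rewrite /W (ipDr cS) (ipZr cS) (ipNr cS) (ipZr cS) (ipJ cS (p n) T).
  by rewrite (ip_low (leqnn n) sT) rmorph0 mulr0 add0r.
have h3 : d * t <= a * q.
  have [->|tn0] := eqVneq t 0; first by rewrite mulr0 mulr_ge0.
  have tp : 0 < t by rewrite lt_def tn0.
  rewrite -(ler_pM2r tp) -mulrA -expr2; apply: le_trans h1 _.
  rewrite h2 cabsN cabsM -mulrA; apply: ler_wpM2l => //.
  by rewrite mulrC; exact: cauchy_schwarz.
have h4 : nrm mu W <= D * t.
  apply: (nrm_le cS) => // z /hD hz; rewrite WzE cabsM mulrC.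
  by apply: ler_wpM2r => //; exact: cabs_ge0.
(* Since p_n has norm 1, the left side is |Q(z0)|, and the term |W| is at most D |T|. *)
have : nrm mu (Q.[z0] *: p n) <= nrm mu W + nrm mu ((p n).[z0] *: Q).
  by rewrite -[X in nrm mu X <= _](subrK ((p n).[z0] *: Q)); exact: nrmD.
rewrite !nrmZ // nrm_orthonormal mulr1 -/a -/q => h5.
have h6 : D * t <= D / d * (a * q).
  by rewrite -mulrA; apply: ler_wpM2l => //; rewrite ler_pdivlMl.
apply: le_trans h5 _; rewrite -/a -/q; lra.
Qed.

(** In the expanded square, the inner product of p_n with Q p_(n-j) sees only the leading
    coefficient a^j kappa_(n-j); the power of [a] is dropped because a >= 1. *)
Lemma shift_le j n Q (a e : R) : (j <= n)%N -> 1 <= a -> 0 <= e -> size Q = j.+1 ->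
  lead_coef Q = rc (a ^+ j) -> (forall w, supp mu w -> cabs Q.[w] <= 1 + e) ->
  nrm mu (Q * p (n - j) - p n) ^+ 2 <= (1 + e) ^+ 2 + 1 - 2 * (kappa (n - j) / kappa n).
Proof.
move=> jn a1 e0 sQ lQ bQ.
have pne k : p k != 0 by rewrite -size_poly_gt0 size_orthonormal.
have Q0 : Q != 0 by rewrite -size_poly_gt0 sQ.
have sQp : size (Q * p (n - j)%N) = n.+1.
  by rewrite size_mul // sQ size_orthonormal addSn /= addnS subnKC.
have h1 : nrm mu (Q * p (n - j)) ^+ 2 <= (1 + e) ^+ 2.
  apply: lerXn2r; rewrite ?nnegrE ?nrm_ge0 ?addr_ge0 //.
  have -> : 1 + e = (1 + e) * nrm mu (p (n - j)) by rewrite nrm_orthonormal mulr1.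
  apply: (nrm_le cS); first lra.
  move=> w /bQ h; rewrite hornerM cabsM; apply: ler_wpM2r => //; exact: cabs_ge0.
have h2 : ip mu (p n) (Q * p (n - j)) = rc (a ^+ j * (kappa (n - j) / kappa n)).
  have -> : ip mu (p n) (Q * p (n - j)%N) = lead_coef (Q * p (n - j)%N) / rc (kappa n).
    by rewrite ip_lead ?sQp // lead_coefE sQp.
  by rewrite lead_coefM lQ lead_orthonormal !rcM rcV mulrA.
rewrite nrm_sqr // nrm2D // -scaleN1r (nrm2Z cS) (ipZr cS) ipJ // h2.
rewrite cabsN cabs1 expr1n mul1r -!nrm_sqr // nrm_orthonormal expr1n.
rewrite cReM cReJ cImJ cRe_rc cIm_rc oppr0 mulr0 subr0 cReN (_ : cRe 1 = 1) //.
have h3 : 1 * (kappa (n - j) / kappa n) <= a ^+ j * (kappa (n - j) / kappa n).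
  by apply: ler_wpM2r; [rewrite divr_ge0 // ltW // kappa_gt0|exact: exprn_ege1].
lra.
Qed.

End OrthonormalPolynomials.

(** * Separation from the convex hull *)

Section Separation.
Context {R : realType}.
Implicit Types (A S : set (Cplx R)) (z w u : Cplx R).

Lemma sub_convex_hull A : A `<=` convex_hull A.
Proof. by move=> z Az B [_ AB]; exact: AB. Qed.

Lemma convex_hull_conv A x y (t : R) : 0 <= t -> t <= 1 ->
  convex_hull A x -> convex_hull A y -> convex_hull A (rc t * x + rc (1 - t) * y).
Proof.
move=> t0 t1 Ax Ay B [cB AB].
have h0 : 0 <= rc t by rewrite -rc0 rc_le.
have h1 : rc t <= 1 by rewrite -rc1 rc_le.
have := cB x y (Itv01 h0 h1) (mem_set (Ax B (conj cB AB))) (mem_set (Ay B (conj cB AB))).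
by move=> /set_mem; rewrite rcB.
Qed.

Lemma convex_hull3 A z w0 w1 w2 (l0 l1 l2 : R) : convex_hull A w0 ->
  convex_hull A w1 -> convex_hull A w2 -> 0 < l0 -> 0 <= l1 -> 0 <= l2 ->
  rc l0 * (w0 - z) + rc l1 * (w1 - z) + rc l2 * (w2 - z) = 0 -> convex_hull A z.
Proof.
move=> A0 A1 A2 p0 p1 p2 E.
have q1 : 0 < l0 + l1 by lra.
have q2 : 0 < l0 + l1 + l2 by lra.
have i1 : 0 <= l0 / (l0 + l1) by rewrite divr_ge0 // ltW.
have i2 : l0 / (l0 + l1) <= 1 by rewrite ler_pdivrMr // mul1r; lra.
have i3 : 0 <= (l0 + l1) / (l0 + l1 + l2) by rewrite divr_ge0 // ltW.
have i4 : (l0 + l1) / (l0 + l1 + l2) <= 1 by rewrite ler_pdivrMr // mul1r; lra.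
have := convex_hull_conv i3 i4 (convex_hull_conv i1 i2 A0 A1) A2.
congr (convex_hull A _).
have n1 : rc l0 + rc l1 != 0.
  by rewrite -rcD -cabs_eq0 cabs_rc normr_eq0 gt_eqF.
have n2 : rc l0 + rc l1 + rc l2 != 0.
  by rewrite -!rcD -cabs_eq0 cabs_rc normr_eq0 gt_eqF.
rewrite !rcB !rcM !rcV !rcD rc1.
apply: (mulfI n2).
have {}E : rc l0 * w0 + rc l1 * w1 + rc l2 * w2 = (rc l0 + rc l1 + rc l2) * z.
  by apply/eqP; rewrite -subr_eq0 -E; apply/eqP; ring.
by rewrite -E; field; rewrite n1 n2.
Qed.

(** In [far_pair] the numbers c, x, y are the inner products e1.e2, e1.e, e2.e of plane unit
    vectors, and the last equation is the vanishing of their Gram determinant. If D > 0, then D <= -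
    y (1 + c) forces y < 0, and squaring leads to (2c - 1)(c + 1) >= 0, impossible for -1 < c <=
    0. *)
Lemma far_pair_ineq (c x y D : R) : -1 < c -> c <= 0 -> c <= y -> x + y <= 0 ->
  D = x - c * y -> D ^+ 2 = (1 - y ^+ 2) * (1 - c ^+ 2) -> D <= 0.
Proof.
move=> c1 c0 cy xy DE D2; rewrite leNgt; apply/negP => D0.
have h1 : D <= - y * (1 + c) by rewrite DE; nra.
have [y0|y0] := lerP 0 y; first nra.
have h2 : D ^+ 2 <= (- y * (1 + c)) ^+ 2 by rewrite lerXn2r // nnegrE; nra.
have h3 : (1 + c) * ((1 - y ^+ 2) * (1 - c)) <= (1 + c) * (y ^+ 2 * (1 + c)).
  by move: h2; rewrite D2 !expr2; lra.
have h4 : (1 - y ^+ 2) * (1 - c) <= y ^+ 2 * (1 + c).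
  by move: h3; rewrite ler_pM2l //; lra.
have h5 : y ^+ 2 <= c ^+ 2 by rewrite !expr2; nra.
have h6 : 1 - c <= 2 * c ^+ 2 by lra.
move: h6; rewrite expr2; nra.
Qed.

(* If [e1, e2] is a pair of unit vectors of a set at maximal angle, then a
   third one [e] of the set with [e . (e1 + e2) <= 0] has [- e] in the cone of
   [e1, e2]. *)
Lemma far_pair (e1 e2 e : Cplx R) : cabs e1 = 1 -> cabs e2 = 1 -> cabs e = 1 ->
  e1 + e2 != 0 -> cRe (e1^* * e2) <= cRe (e1^* * e) ->
  cRe (e1^* * e2) <= cRe (e2^* * e) -> cRe ((e1 + e2)^* * e) <= 0 ->
  exists l0 l1 l2 : R, [/\ 0 < l0, 0 <= l1, 0 <= l2 &
    rc l0 * e + rc l1 * e1 + rc l2 * e2 = 0].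
Proof.
move=> u1 u2 u e12.
have n1 := cabs_sqr e1; have n2 := cabs_sqr e2; have n := cabs_sqr e.
rewrite u1 u2 u expr1n in n1 n2 n.
have := cabs_gt0 (e1 + e2); rewrite e12 => s0.
have : 0 < cabs (e1 + e2) ^+ 2 by rewrite exprn_gt0.
rewrite cabs_sqr rmorphD /= mulrDl cReD !cReM !cReD !cReJ !cImJ cImD.
move: n1 n2 n {s0}.
case: e1 u1 e12 => a1 b1 u1 e12; case: e2 u2 e12 => a2 b2 u2 e12; case: e u => a b u.
rewrite /cRe /cIm /= => n1 n2 n h0.
pose c := a1 * a2 + b1 * b2; pose x := a1 * a + b1 * b; pose y := a2 * a + b2 * b.
have cE : a1 * a2 - - b1 * b2 = c by rewrite /c; ring.
have xE : a1 * a - - b1 * b = x by rewrite /x; ring.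
have yE : a2 * a - - b2 * b = y by rewrite /y; ring.
rewrite cE xE yE => cx cy xy.
have c1 : -1 < c by move: h0 n1 n2; rewrite /c !expr2; lra.
have c0 : c <= 0 by lra.
have D1E : (x - c * y) ^+ 2 = (1 - y ^+ 2) * (1 - c ^+ 2).
  have : ((a2 ^+ 2 + b2 ^+ 2) * x - c * y) ^+ 2 =
     ((a2 ^+ 2 + b2 ^+ 2) * (a ^+ 2 + b ^+ 2) - y ^+ 2) *
     ((a1 ^+ 2 + b1 ^+ 2) * (a2 ^+ 2 + b2 ^+ 2) - c ^+ 2) by rewrite /x /y /c; ring.
  by rewrite -n1 -n2 -n !mul1r.
have D2E : (y - c * x) ^+ 2 = (1 - x ^+ 2) * (1 - c ^+ 2).
  have : ((a1 ^+ 2 + b1 ^+ 2) * y - c * x) ^+ 2 =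
     ((a1 ^+ 2 + b1 ^+ 2) * (a ^+ 2 + b ^+ 2) - x ^+ 2) *
     ((a1 ^+ 2 + b1 ^+ 2) * (a2 ^+ 2 + b2 ^+ 2) - c ^+ 2) by rewrite /x /y /c; ring.
  by rewrite -n1 -n2 -n !mul1r.
have D1 := far_pair_ineq c1 c0 cy xy (erefl _) D1E.
have D2 : y - c * x <= 0.
  by apply: (far_pair_ineq c1 c0 cx _ (erefl _) D2E); rewrite addrC.
have sp : 0 < 1 - c ^+ 2 by rewrite expr2; nra.
have sE : 1 - c ^+ 2 = (a1 * b2 - b1 * a2) ^+ 2.
  have : (a1 ^+ 2 + b1 ^+ 2) * (a2 ^+ 2 + b2 ^+ 2) - c ^+ 2 = (a1 * b2 - b1 * a2) ^+ 2.
    by rewrite /c; ring.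
  by rewrite -n1 -n2 !mul1r.
exists (1 - c ^+ 2), (- (x - c * y)), (- (y - c * x)); split=> //; [lra|lra|].
have A1 : (x - c * y) * a1 + (y - c * x) * a2 = (1 - c ^+ 2) * a.
  have : ((a2 ^+ 2 + b2 ^+ 2) * x - c * y) * a1 + ((a1 ^+ 2 + b1 ^+ 2) * y - c * x) * a2 =
     (a1 * b2 - b1 * a2) ^+ 2 * a by rewrite /x /y /c; ring.
  by rewrite -n1 -n2 !mul1r sE.
have B1 : (x - c * y) * b1 + (y - c * x) * b2 = (1 - c ^+ 2) * b.
  have : ((a2 ^+ 2 + b2 ^+ 2) * x - c * y) * b1 + ((a1 ^+ 2 + b1 ^+ 2) * y - c * x) * b2 =
     (a1 * b2 - b1 * a2) ^+ 2 * b by rewrite /x /y /c; ring.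
  by rewrite -n1 -n2 !mul1r sE.
apply: cplx_eqP.
  by rewrite !cReD !cReZ /cRe /= -A1; ring.
by rewrite !cImD !cImZ /cIm /= -B1; ring.
Qed.

(** The directions from [z] to [S] form a compact set of unit vectors. Take two of them at maximal
    angle: a direction making no acute angle with their sum would, by [far_pair], exhibit [z] as a
    convex combination of three points of [S]. So the normalized conjugate of the sum separates. *)
Lemma convex_hull_separation S z : compact S -> ~ convex_hull S z ->
  exists u, cabs u = 1 /\ exists2 d : R, 0 < d &
    forall w, S w -> d <= cRe (u * (w - z)).
Proof.
move=> cS nz; have [->|/set0P S0] := eqVneq S set0.
  by exists 1; split; [exact: cabs1|exists 1].
have wz w : S w -> 0 < cabs (w - z).
  move=> Sw; rewrite cabs_gt0 subr_eq0; apply: contra_notN nz => /eqP<-.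
  exact: sub_convex_hull.
pose dir w : Cplx R := (w - z) / rc (cabs (w - z)).
have cdist : continuous (fun w : Cplx R => w - z).
  by move=> w; exact: (cvgB cvg_id (cvg_cst _)).
have cden : continuous (fun w : Cplx R => rc (cabs (w - z))).
  have c1 : continuous (fun w : Cplx R => cabs (w - z)).
    by move=> w; exact: (continuous_comp (cdist w) (@continuous_cabs R _)).
  by move=> w; exact: (continuous_comp (c1 w) (@continuous_rc R _)).
have cdir : {within S, continuous dir}.
  apply: continuous_in_subspaceT => w /set_mem /wz h.
  have h' : rc (cabs (w - z)) != 0 by rewrite -cabs_eq0 cabs_rc normr_eq0 gt_eqF.
  exact: (cvgM (cdist w) (cvgV h' (cden w))).
have dirE w : S w -> rc (cabs (w - z)) * dir w = w - z.
  move=> /wz h; rewrite /dir mulrC divfK //.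
  by rewrite -cabs_eq0 cabs_rc normr_eq0 gt_eqF.
have dir1 w : S w -> cabs (dir w) = 1.
  move=> /wz h; rewrite /dir cabsM cabsV cabs_rc ger0_norm ?cabs_ge0 //.
  by rewrite divff // gt_eqF.
pose E := dir @` S.
have cE : compact E by exact: continuous_compact.
have cEE : compact (E `*` E) by exact: compact_setX.
have EE0 : E `*` E !=set0.
  by have [w Sw] := S0; exists (dir w, dir w); split; exists w.
pose f (q : Cplx R * Cplx R) : R := cRe (q.1^* * q.2).
have cf : continuous f.
  have c1 : continuous (fun q : Cplx R * Cplx R => q.1^*).
    move=> q; apply: (continuous_comp _ (@continuous_conj R _)); exact: cvg_fst.
  have c2 : continuous (fun q : Cplx R * Cplx R => q.1^* * q.2).
    by move=> q; exact: (cvgM (c1 q) cvg_snd).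
  by move=> q; exact: (continuous_comp (c2 q) (@continuous_cRe R _)).
have [[_ _] [/= [w1 Sw1 <-] [w2 Sw2 <-]] hmin] :=
  compact_argmin EE0 cEE (continuous_subspaceT cf).
have hc w w' : S w -> S w' ->
    cRe ((dir w1)^* * dir w2) <= cRe ((dir w)^* * dir w').
  by move=> Sw Sw'; apply: (hmin (dir w, dir w')); split; [exists w|exists w'].
have hull3 w l0 l1 l2 : S w -> 0 < l0 -> 0 <= l1 -> 0 <= l2 ->
    rc l0 * dir w + rc l1 * dir w1 + rc l2 * dir w2 = 0 -> False.
  move=> Sw p0 p1 p2 e0; apply: nz.
  have k v l : S v -> rc (l / cabs (v - z)) * (v - z) = rc l * dir v.
    move=> Sv; rewrite -{2}(dirE v Sv) mulrA -rcM divfK // gt_eqF //; exact: wz.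
  apply: (@convex_hull3 S z w w1 w2 (l0 / cabs (w - z)) (l1 / cabs (w1 - z))
    (l2 / cabs (w2 - z))); rewrite ?k //; try exact: sub_convex_hull.
  - by rewrite divr_gt0 // wz.
  - by rewrite divr_ge0 // cabs_ge0.
  - by rewrite divr_ge0 // cabs_ge0.
(* Opposite directions would put [z] between [w1] and [w2]; here [w1] is listed twice, with weights
   1 and 0. *)
have e12 : dir w1 + dir w2 != 0.
  apply/eqP => e0; apply: (@hull3 w1 1 0 1) => //.
  by rewrite rc0 rc1 mul0r addr0 !mul1r.
have pos w : S w -> 0 < cRe ((dir w1 + dir w2)^* * dir w).
  move=> Sw; rewrite ltNge; apply/negP => h.
  have [l0 [l1 [l2 [p0 p1 p2 e0]]]] := far_pair (dir1 _ Sw1) (dir1 _ Sw2) (dir1 _ Sw)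
    e12 (hc _ _ Sw1 Sw) (hc _ _ Sw2 Sw) h.
  exact: (@hull3 w l0 l1 l2).
pose m := cabs (dir w1 + dir w2).
have m0 : 0 < m by rewrite cabs_gt0.
pose u := rc m^-1 * (dir w1 + dir w2)^*.
exists u; split.
  by rewrite /u cabsM cabs_rc cabsJ -/m ger0_norm ?invr_ge0 ?ltW // mulVf // gt_eqF.
pose g w : R := cRe (u * (w - z)).
have cg : continuous g.
  have c1 : continuous (fun w : Cplx R => u * (w - z)).
    by move=> w; exact: (cvgM (cvg_cst _) (cdist w)).
  by move=> w; exact: (continuous_comp (c1 w) (@continuous_cRe R _)).
have [w Sw hw] := compact_argmin S0 cS (continuous_subspaceT cg).
exists (g w) => //.
rewrite /g -(dirE w Sw) mulrCA cReZ /u -mulrA cReZ.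
by rewrite mulr_gt0 ?wz // mulr_gt0 ?invr_gt0 ?pos.
Qed.

End Separation.

(** * Ratio asymptotics *)

Section Subsequences.

Lemma infinite_nat_ge (N : set nat) b : infinite_set N -> exists2 n, N n & (b <= n)%N.
Proof.
move=> Ninf; apply: contrapT => h; apply: Ninf.
apply: (sub_finite_set _ (finite_II b)) => n Nn /=.
by rewrite ltnNge; apply/negP => bn; apply: h; exists n.
Qed.

Lemma near_within_oo (N P : set nat) :
  (\forall n \near within N \oo, P n) <->
  exists n0, forall n, (n0 <= n)%N -> N n -> P n.
Proof.
split; first by move=> [n0 _ h]; exists n0 => n n0n; exact: h.
by move=> [n0 h]; exists n0 => // n /= n0n; exact: h.
Qed.

(** At level l the index [m l] achieves precision 1 / (l+1) for n beyond [B l]. The sequence is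
    [m (L n)], where [L n] is the highest level reached at n; least elements of [M] above increasing
    bounds make it monotone. *)
Lemma diagonal (R : realType) (E : nat -> nat -> R) (N M : set nat) :
  infinite_set N -> infinite_set M ->
  (forall d : R, 0 < d -> exists j0, forall j, M j -> (j0 <= j)%N ->
     exists n0, forall n, (n0 <= n)%N -> N n -> E j n <= d) ->
  exists k : nat -> nat,
    [/\ forall n, M (k n),
        forall m n, (m <= n)%N -> (k m <= k n)%N,
        forall B, exists n0, forall n, (n0 <= n)%N -> (B <= k n)%N,
        exists n0, forall n, (n0 <= n)%N -> (k n <= n)%N &
        forall d : R, 0 < d -> exists n0, forall n, (n0 <= n)%N -> N n -> E (k n) n <= d].
Proof.
move=> Ninf Minf hE.
have inv_gt0 (l : nat) : 0 < l.+1%:R^-1 :> R by rewrite invr_gt0.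
have /choice[J hJ] : forall l, exists j0, forall j, M j -> (j0 <= j)%N ->
     exists n0, forall n, (n0 <= n)%N -> N n -> E j n <= l.+1%:R^-1.
  by move=> l; exact: hE.
have /choice[least hleast] : forall b, exists m, [/\ M m, (b <= m)%N &
    forall m', M m' -> (b <= m')%N -> (m <= m')%N].
  move=> b; have ex : exists m, (fun m => `[< M m >] && (b <= m)%N) m.
    by have [m Mm bm] := infinite_nat_ge b Minf; exists m; rewrite bm andbT; apply/asboolP.
  exists (ex_minn ex); case: ex_minnP => m /andP[/asboolP Mm bm] hm; split => //.
  by move=> m' Mm' bm'; apply: hm; rewrite bm' andbT; apply/asboolP.
(* Summing makes the bound monotone in l, at least [J l] and, through the last term, unbounded. *)
pose b l := (\sum_(i < l.+1) J i + l)%N.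
have bS l : (b l <= b l.+1)%N.
  by rewrite /b [in leqRHS]big_ord_recr /= -addnA leq_add2l (leq_trans (leqnSn l)) // leq_addl.
have bmono l l' : (l <= l')%N -> (b l <= b l')%N.
  by move=> ll'; apply: (homo_leq (@leqnn) leq_trans) => //.
pose m l := least (b l).
have Mm l : M (m l) by case: (hleast (b l)).
have bm l : (b l <= m l)%N by case: (hleast (b l)).
have lm l : (l <= m l)%N by apply: leq_trans (bm l); rewrite /b leq_addl.
have mmono l l' : (l <= l')%N -> (m l <= m l')%N.
  move=> ll'; have [_ _ h] := hleast (b l); apply: h; first exact: Mm.
  exact: leq_trans (bmono _ _ ll') (bm l').
have Jm l : (J l <= m l)%N.
  apply: leq_trans (bm l); rewrite /b big_ord_recr /= -addnA.
  by rewrite (leq_trans _ (leq_addl _ _)) // leq_addr.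
have /choice[nu hnu] : forall l, exists n0, forall n, (n0 <= n)%N -> N n ->
    E (m l) n <= l.+1%:R^-1.
  by move=> l; apply: hJ.
(* The threshold dominates [nu l] for the precision, [m l] for k n <= n, and [l] so that only
   finitely many levels are reached at n. *)
pose B l := (\sum_(i < l.+1) (nu i + m i) + l)%N.
have lB l : (l <= B l)%N by rewrite /B leq_addl.
have nB l : (nu l + m l <= B l)%N.
  rewrite /B big_ord_recr /= -addnA.
  by rewrite (leq_trans _ (leq_addl _ _)) // leq_addr.
have /choice[L hL] : forall n, exists l, ((B l <= n)%N \/ l = 0%N) /\
    forall l', (B l' <= n)%N -> (l' <= l)%N.
  move=> n; pose P l := (B l <= n)%N || (l == 0%N).
  have exP : exists l, P l by exists 0%N; rewrite /P orbT.
  have ubP l : P l -> (l <= n)%N.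
    by move=> /orP[|/eqP ->//]; apply: leq_trans.
  case: (ex_maxnP exP ubP) => l Pl hl; exists l; split.
    by move: Pl => /orP[|/eqP]; [left|right].
  by move=> l' h; apply: hl; rewrite /P h.
have Lmono n n' : (n <= n')%N -> (L n <= L n')%N.
  move=> nn'; have [[h|->//] _] := hL n; have [_ h'] := hL n'.
  by apply: h'; exact: leq_trans nn'.
have LB n : (B 0 <= n)%N -> (B (L n) <= n)%N.
  by move=> h; have [[//|->] _] := hL n.
have geL l n : (B l <= n)%N -> (l <= L n)%N by have [_ h] := hL n; exact: h.
exists (m \o L); split => /=.
- by move=> n; exact: Mm.
- by move=> n n' nn'; apply: mmono; exact: Lmono.
- by move=> B'; exists (B B') => n /geL h; apply: leq_trans h (lm _).
- exists (B 0) => n /LB h; apply: leq_trans h.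
  by apply: leq_trans (nB (L n)); rewrite leq_addl.
move=> d d0; pose l := Num.truncn d^-1.
exists (B l + B 0)%N => n hn Nn.
have h0 : (B 0 <= n)%N by apply: leq_trans hn; rewrite leq_addl.
have hl : (l <= L n)%N by apply: geL; apply: leq_trans hn; rewrite leq_addr.
have nun : (nu (L n) <= n)%N.
  by apply: leq_trans (LB n h0); apply: leq_trans (nB _); rewrite leq_addr.
apply: le_trans (hnu _ _ nun Nn) _.
rewrite invf_ple ?posrE //; apply: ltW.
apply: lt_le_trans (truncnS_gt d^-1) _.
by rewrite ler_nat.
Qed.

End Subsequences.

Lemma leq_add3 n1 n2 n3 n : (n1 + n2 + n3 <= n)%N ->
  [/\ (n1 <= n)%N, (n2 <= n)%N & (n3 <= n)%N].
Proof. by move=> h; split; lia. Qed.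

Section SphereConvergence.
Context {R : realType}.

#[local] Instance near_infty_proper : ProperFilter (@near_infty R).
Proof.
apply: Build_ProperFilter_ex => A /near_inftyP[r hr].
exists (rc (`|r| + 1)); apply: hr; rewrite cabs_rc.
by rewrite ger0_norm ?addr_ge0 //; have := ler_norm r; lra.
Qed.

Lemma cvg_horner_infty (P : {poly Cplx R}) n : (size P <= n.+1)%N ->
  P.[z] / z ^+ n @[z --> near_infty] --> P`_n.
Proof.
move=> /(@horner_infty R P n)[A A0 hA]; apply/cvg_cplxP => e e0.
apply/near_inftyP; exists (1 + A / e) => z zr.
have Ae : 0 <= A / e by rewrite divr_ge0 // ltW.
have z1 : 1 <= cabs z by lra.
have z0 : 0 < cabs z by lra.
have zn : z != 0 by rewrite -cabs_gt0.
have zN : 0 < cabs z ^+ n by rewrite exprn_gt0.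
have := hA z z1; set D := P.[z] - _ => hD.
have -> : P.[z] / z ^+ n - P`_n = D / z ^+ n.
  by rewrite /D mulrBl mulfK // expf_neq0.
rewrite cabsM cabsV cabsX ltr_pdivrMr // -(ltr_pM2l z0).
apply: le_lt_trans hD _; rewrite mulrA ltr_pM2r //.
by rewrite -ltr_pdivrMr //; lra.
Qed.

Lemma lim_infty_le (f : Cplx R -> Cplx R) (l c : Cplx R) (e r : R) :
  f @ near_infty --> l -> (forall z, r < cabs z -> cabs (f z - c) <= e) ->
  cabs (lim (f @ near_infty) - c) <= e.
Proof.
move=> fl h; rewrite (cvg_lim _ fl) //; rewrite leNgt; apply/negP => el.
have d0 : 0 < cabs (l - c) - e by rewrite subr_gt0.
move/cvg_cplxP : fl => /(_ _ d0)/near_inftyP[r' h'].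
pose x := rc (`|r| + `|r'| + 1).
have xE : cabs x = `|r| + `|r'| + 1 by rewrite cabs_rc ger0_norm // !addr_ge0.
have xr : r < cabs x by rewrite xE; have := ler_norm r; have := normr_ge0 r'; lra.
have xr' : r' < cabs x by rewrite xE; have := ler_norm r'; have := normr_ge0 r; lra.
have := h _ xr; have := h' _ xr'; have := cabs_triangle (f x) l c.
rewrite (cabsBC l (f x)); lra.
Qed.

Lemma uniform_cplx (T : choiceType) (K : set T) I (A : set_system I) (FA : Filter A)
  (f : I -> T -> Cplx R) (l : Cplx R) :
  (forall e : R, 0 < e -> \forall i \near A, forall x, K x -> cabs (f i x - l) < e) ->
  {uniform K, f @ A --> (fun=> l)}.
Proof.
move=> h W /uniform_nbhs[E [entE EW]].
move: entE; rewrite -entourage_ballE => -[e /= e0 he].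
have eE : e = rc (cRe e).
  by apply: cplx_eqP => //; rewrite cIm_rc; exact: ger0_Im (ltW e0).
have e0' : 0 < cRe e by rewrite -rc_lt -eE.
apply: filterS (h _ e0') => i hi; apply: EW => x /hi hx; apply: he.
by rewrite -ball_normE /= eE normr_cabs rc_lt cabsBC.
Qed.

End SphereConvergence.

(** For a point s + i t of the unit circle the four alternatives are the real parts of its products
    with 1, i, -1 and -i, in this order. *)
Lemma quarter_arcs (R : realType) (s t : R) : 1 = s ^+ 2 + t ^+ 2 ->
  [\/ 1 / 2 <= s, 1 / 2 <= - t, 1 / 2 <= - s | 1 / 2 <= t].
Proof.
rewrite !expr2 => st.
have [h1|h1] := lerP (1 / 2) s; first by constructor 1.
have [h2|h2] := lerP s (- (1 / 2)); first by constructor 3; lra.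
have [h3|h3] := lerP (1 / 2) t; first by constructor 4.
have [h4|h4] := lerP t (- (1 / 2)); first by constructor 2; lra.
have : (1 / 2 - s) * (s + 1 / 2) > 0 by rewrite mulr_gt0 //; lra.
have : (1 / 2 - t) * (t + 1 / 2) > 0 by rewrite mulr_gt0 //; lra.
lra.
Qed.

Lemma ler_pM4 (R : realType) (x1 x2 x3 x4 y1 y2 y3 y4 : R) :
  0 <= x1 -> 0 <= x2 -> 0 <= x3 -> 0 <= x4 ->
  x1 <= y1 -> x2 <= y2 -> x3 <= y3 -> x4 <= y4 ->
  x1 * x2 * x3 * x4 <= y1 * y2 * y3 * y4.
Proof.
move=> p1 p2 p3 p4 h1 h2 h3 h4.
by apply: ler_pM => //; rewrite ?mulr_ge0 //; apply: ler_pM => //;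
  rewrite ?mulr_ge0 //; apply: ler_pM.
Qed.

(** * The ratio off the convex hull of the support *)

Section RatioLimit.
Context {R : realType} (G : set (Cplx R)) (phi : Cplx R -> Cplx R) (a : R)
  (F : nat -> {poly Cplx R}) (mu : {finite_measure set (borelC R) -> \bar R})
  (p : nat -> {poly Cplx R}) (N M : set nat).
Local Notation V := (outer G).
Hypotheses (cphi : {within closure V, continuous phi})
  (phi_inj : forall z w, V z -> V w -> phi z = phi w -> z = w)
  (phi_gt1 : forall z, V z -> 1 < cabs (phi z))
  (phi_onto : forall w, 1 < cabs w -> exists2 z, V z & phi z = w)
  (a1 : 1 <= a) (phi_infty : phi z / z @[z --> near_infty] --> rc a)
  (FE : forall e : R, 0 < e -> exists n0, forall n, (n0 <= n)%N ->
     forall z, closure V z -> cabs ((F n).[z] - phi z ^+ n) <= e)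
  (G_bd : bounded_set G).
Hypotheses (cS : compact (supp mu)) (mu_G : supp mu `<=` closure G)
  (p_ortho : orthonormal_polys mu p)
  (N_inf : infinite_set N) (M_inf : infinite_set M)
  (kappa_ratio : forall j, M j ->
     lead_coef (p n) / lead_coef (p (n - j)%N) @[n --> within N \oo] --> (1 : Cplx R)).

Let a0 : 0 < a. Proof. exact: lt_le_trans a1. Qed.

Lemma outer_near_infty : exists r : R, forall z, r < cabs z -> V z.
Proof. by have [r hr] := bounded_closure G_bd; exists r; exact: outer_far. Qed.

Lemma faber_closureG (e : R) : 0 < e -> exists n0, forall n, (n0 <= n)%N ->
  forall z, closure G z -> cabs (F n).[z] <= 1 + e.
Proof.
move=> e0.
have [n0 h] := faber_inside (@open_outer R G) cphi outer_near_infty phi_inj phi_gt1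
  phi_onto FE e0.
by exists n0 => n n0n z Gz; apply: h => // /outer_not_closure.
Qed.

Lemma shift_near (d : R) : 0 < d -> exists j0, forall j, M j -> (j0 <= j)%N ->
  exists n0, forall n, (n0 <= n)%N -> N n -> (j <= n)%N /\
    nrm mu (F j * p (n - j) - p n) <= d.
Proof.
(* With kappa_(n-j) / kappa_n >= 1 - e the bound of [shift_le] is at most 4e + e^2, hence at most
   5e. *)
move=> d0; pose e := Num.min 1 (d ^+ 2 / 5).
have e0 : 0 < e by rewrite lt_min ltr01 divr_gt0 ?exprn_gt0.
have e1 : e <= 1 by rewrite ge_min lexx.
have e2 : e * 5 <= d ^+ 2 by rewrite -ler_pdivlMr // ge_min lexx orbT.
have [j1 h1] := faber_closureG e0.
have [j2 h2] := faber_size_lead outer_near_infty a0 phi_infty FE.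
exists (j1 + j2)%N => j Mj j0j.
have [sF lF] := h2 j (leq_trans (leq_addl _ _) j0j).
have bF := h1 j (leq_trans (leq_addr _ _) j0j).
have /cvg_cplxP/(_ _ e0)/near_within_oo[n1 hn1] := kappa_ratio Mj.
exists (n1 + j)%N => n hn Nn.
have jn : (j <= n)%N := leq_trans (leq_addl _ _) hn.
split => //.
have := hn1 n (leq_trans (leq_addr _ _) hn) Nn.
rewrite !(lead_orthonormal p_ortho) -rcV -rcM -rc1 -rcB cabs_rc => hk.
have := shift_le cS p_ortho jn a1 (ltW e0) sF lF (fun w Sw => bF w (mu_G Sw)).
have k1 := kappa_gt0 p_ortho n; have k2 := kappa_gt0 p_ortho (n - j).
set x := kappa p n in hk k1 *; set y := kappa p (n - j) in hk k2 *.
move=> h3.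
have h4 : 1 - e <= y / x.
  rewrite ler_pdivlMr //.
  have h5 : x / y < 1 + e by move: hk; rewrite ltr_norml; lra.
  have h6 : x < (1 + e) * y by rewrite -ltr_pdivrMr.
  have h7 : (1 - e) * x <= (1 - e) * ((1 + e) * y) by apply: ler_wpM2l; lra.
  have : 0 <= e * e * y by rewrite !mulr_ge0 // ltW.
  lra.
rewrite -(@ler_pXn2r _ 2) ?nnegrE ?nrm_ge0 //; last exact: ltW.
apply: le_trans h3 (le_trans _ e2).
have : e * e <= e by rewrite ler_piMr // ltW.
rewrite expr2; lra.
Qed.

(** Three uses of [eval_le], for the polynomials 1, F_j p_(n-j) - p_n and p_(n-j). The first one
    shows that p_n does not vanish at [z]. *)
Lemma eval_shift j n z u (g D d : R) : (j <= n)%N -> size (F j) = j.+1 ->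
  nrm mu (F j * p (n - j) - p n) <= d -> 0 < g -> 0 <= D -> cabs u = 1 ->
  (forall w, supp mu w -> g <= cRe (u * (w - z))) ->
  (forall w, supp mu w -> cabs (w - z) <= D) ->
  [/\ (p n).[z] != 0,
      cabs ((F j).[z] * (p (n - j)%N).[z] - (p n).[z]) <= (1 + D / g) * d * cabs (p n).[z] &
      cabs (p (n - j)%N).[z] <= (1 + D / g) * cabs (p n).[z]].
Proof.
move=> jn sF hd g0 D0 u1 hg hD.
have K0 : 0 <= 1 + D / g by rewrite addr_ge0 // divr_ge0 // ltW.
have pn0 k : p k != 0 by rewrite -size_poly_gt0 (size_orthonormal p_ortho).
split.
- have : cabs (1%:P : {poly Cplx R}).[z] <= (1 + D / g) * nrm mu 1%:P * cabs (p n).[z].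
    by apply: (eval_le cS p_ortho _ g0 D0 u1 hg hD); rewrite size_polyC (leq_trans (leq_b1 _)).
  rewrite hornerC cabs1 -cabs_eq0; apply: contraTneq => ->.
  by rewrite mulr0 -ltNge.
- rewrite -hornerM -hornerN -hornerD.
  apply: le_trans (eval_le cS p_ortho (n := n) _ g0 D0 u1 hg hD) _.
    rewrite (leq_trans (size_polyD _ _)) // geq_max size_polyN (size_orthonormal p_ortho) leqnn andbT.
    have F0 : F j != 0 by rewrite -size_poly_gt0 sF.
    by rewrite size_mul // sF (size_orthonormal p_ortho) addSn /= addnS subnKC.
  apply: ler_wpM2r; first exact: cabs_ge0.
  exact: ler_wpM2l.
- apply: le_trans (eval_le cS p_ortho (n := n) _ g0 D0 u1 hg hD) _.
    by rewrite (size_orthonormal p_ortho) ltnS leq_subr.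
  by rewrite (nrm_orthonormal cS p_ortho) mulr1.
Qed.

(** The ray from [z] in the direction [- u^*] stays in the half-plane opposite to the one containing
    the closure of [G]. *)
Lemma outer_half_plane z u : cabs u = 1 -> (forall y, closure G y -> 0 < cRe (u * (y - z))) ->
  V z.
Proof.
move=> u1 h; apply: (@outer_ray R G z (- u^*)).
  by rewrite oppr_eq0 -cabs_eq0 cabsJ u1 oner_neq0.
move=> t t0 /h; rewrite addrAC subrr add0r mulrN mulrN cReN mulrCA cReZ.
rewrite [u * _]mulrC mulJc cRe_rc u1 expr1n mulr1; lra.
Qed.

(* Suppose not, and let [y0] be a point of the closure of [G] farthest in the
   direction [- u].  By [eval_shift] the polynomials [F_j] are bounded below on a
   disk around [y0], while they grow exponentially on an arc of its boundary.
   The product of four rotations of [F_j] then violates the minimum principle. *)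
Lemma half_plane_closureG z u (d : R) : cabs u = 1 -> 0 < d ->
  (forall w, supp mu w -> d <= cRe (u * (w - z))) ->
  forall y, closure G y -> 0 < cRe (u * (y - z)).
Proof.
move=> u1 d0 hd y1 Gy1.
have [r hr] := bounded_closure G_bd.
have cG : compact (closure G) by apply: (compact_cplx (@closed_closure _ _) hr).
pose h y : R := cRe (u * (y - z)).
have ch : continuous h.
  have c1 : continuous (fun y : Cplx R => u * (y - z)).
    have c0 : continuous (fun y : Cplx R => y - z).
      by move=> y; exact: (cvgB cvg_id (cvg_cst _)).
    by move=> y; exact: (cvgM (cvg_cst _) (c0 y)).
  by move=> y; exact: (continuous_comp (c1 y) (@continuous_cRe R _)).
have clG0 : closure G !=set0 by exists y1.
have [y0 Gy0 hy0] := compact_argmin clG0 cG (continuous_subspaceT ch).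
apply: lt_le_trans (hy0 _ Gy1); rewrite ltNge; apply/negP => hle.
have hD x w : h (x + w) = h x + cRe (u * w).
  by rewrite /h -cReD -mulrDr addrAC.
(* Since [h y0 <= 0], every point of the disk of radius t around [y0] still has the support at
   distance at least t in the direction [u]. *)
pose t := d / 2; have t0 : 0 < t by rewrite /t; lra.
pose v : Cplx R := - u^*.
have v1 : cabs v = 1 by rewrite /v cabsN cabsJ.
have uv : u * v = - 1 by rewrite /v mulrN [u * _]mulrC mulJc u1 expr1n.
pose pt (zeta : Cplx R) : Cplx R := y0 + rc t * (v * zeta).
have hpt zeta : h (pt zeta) = h y0 - t * cRe zeta.
  rewrite /pt hD mulrCA cReZ mulrA uv mulN1r cReN; ring.
have Vpt zeta : 0 < cRe zeta -> V (pt zeta).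
  move=> hz; apply: (@outer_half_plane _ u) => // y /hy0 hy.
  have -> : cRe (u * (y - pt zeta)) = h y - h (pt zeta).
    by rewrite /h -cReB -mulrBr opprB addrA subrK.
  rewrite hpt; have : 0 < t * cRe zeta by rewrite mulr_gt0.
  rewrite /h in hy *; lra.
(* The arc lies strictly beyond the supporting line of the closure of [G] at [y0], hence in the
   exterior domain, and by compactness |phi| stays above some q > 1 on it. *)
pose A := pt @` [set zeta | cabs zeta = 1 /\ 1 / 2 <= cRe zeta].
have AV : A `<=` V by move=> _ [zeta [_ hz] <-]; apply: Vpt; lra.
have cA : compact A.
  apply: continuous_compact.
    apply: continuous_subspaceT.
    have c1 : continuous (fun x : Cplx R => v * x) by exact: mulrl_continuous.
    have c2 : continuous (fun x : Cplx R => rc t * (v * x)).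
      by move=> x; exact: (cvgM (cvg_cst _) (c1 x)).
    by move=> x; exact: (cvgD (cvg_cst _) (c2 x)).
  apply: (@compact_cplx R _ 1); last by move=> x [-> _].
  apply: (closedI (A := [set x : Cplx R | cabs x = 1]) (B := [set x : Cplx R | 1 / 2 <= cRe x])).
    by apply: closed_comp (@closed_eq R 1) => x _; exact: continuous_cabs.
  by apply: closed_comp (@closed_ge R (1 / 2)) => x _; exact: continuous_cRe.
have A0 : A !=set0.
  exists (pt 1); exists 1 => //; split; first exact: cabs1.
  have -> : cRe (1 : Cplx R) = 1 by [].
  lra.
have cphiA : {within A, continuous (fun x => cabs (phi x))}.
  have hA := continuous_subspaceW (subset_trans AV (@subset_closure _ V)) cphi.
  by move=> x; exact: (continuous_comp (hA x) (@continuous_cabs R _)).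
have [x0 Ax0 hx0] := compact_argmin A0 cA cphiA.
pose q := cabs (phi x0); have q1 : 1 < q by exact: phi_gt1 (AV _ Ax0).
pose D := r + cabs y0 + t.
have D0 : 0 <= D.
  rewrite /D; have := hr _ Gy0; have := cabs_ge0 y0; lra.
pose K := 1 + D / t.
have K1 : 1 <= K by rewrite /K lerDl divr_ge0 // ltW.
(* With this error [eval_shift] makes |F_j p_(n-j)| at least |p_n| / 2, while |p_(n-j)| <= K |p_n|;
   so |F_j| >= 1 / (2 K) on the disk. *)
have dK : 0 < 1 / (2 * K) by rewrite divr_gt0 // mulr_gt0 //; lra.
have [j1 hj1] := shift_near dK.
have [j2 hj2] := faber_size_lead outer_near_infty a0 phi_infty FE.
have [j3 hj3] := FE ltr01.
have [j4 hj4] := faber_closureG ltr01.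
pose c := 1 / (2 * K).
have c1 : c <= 1 by rewrite /c ler_pdivrMr ?mul1r ?mulr_gt0 //; lra.
(* At [y0] the product of four rotations is at most 2^4 = 16, while on the circle it is at least c^3
   (q^j - 1). *)
have [j5 hj5] := expr_unbounded (1 + 16 / c ^+ 3) q1.
have [j Mj jj] := infinite_nat_ge (j1 + j2 + j3 + j4 + j5) M_inf.
have [j1j j2j j3j j4j j5j] :
    [/\ (j1 <= j)%N, (j2 <= j)%N, (j3 <= j)%N, (j4 <= j)%N & (j5 <= j)%N].
  by split; lia.
have [sF _] := hj2 _ j2j.
have [n0 hn0] := hj1 _ Mj j1j.
have [n Nn n0n] := infinite_nat_ge n0 N_inf.
have [jn nrmd] := hn0 _ n0n Nn.
have lowF x : cabs (x - y0) <= t -> c <= cabs (F j).[x].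
  move=> xt.
  have hg w : supp mu w -> t <= cRe (u * (w - x)).
    move=> /hd hw; have -> : cRe (u * (w - x)) = h w - h x.
      by rewrite /h -cReB -mulrBr opprB addrA subrK.
    have : h x = h y0 + cRe (u * (x - y0)) by rewrite -hD addrC subrK.
    have := le_trans (ler_norm _) (cRe_le (u * (x - y0))).
    rewrite cabsM u1 mul1r /h in hle *; rewrite /t in xt *; lra.
  have hDw w : supp mu w -> cabs (w - x) <= D.
    move=> /mu_G /hr hw; have := cabs_triangle y0 w x.
    rewrite (cabsBC y0 x); have := cabsB w y0; rewrite /D; lra.
  have [pn0 h1 h2] := eval_shift jn sF nrmd t0 D0 u1 hg hDw.
  rewrite -/K in h1 h2.
  have P0 : 0 < cabs (p n).[x] by rewrite cabs_gt0.
  have h3 : K * (1 / (2 * K)) = 1 / 2 by field; lra.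
  rewrite h3 in h1.
  have := cabs_lb (p n).[x] ((F j).[x] * (p (n - j)%N).[x]); rewrite cabsBC cabsM => h4.
  have h5 : cabs (F j).[x] * cabs (p (n - j)%N).[x] <= cabs (F j).[x] * (K * cabs (p n).[x]).
    by apply: ler_wpM2l => //; exact: cabs_ge0.
  have h6 : 1 / 2 * cabs (p n).[x] <= cabs (F j).[x] * K * cabs (p n).[x].
    rewrite -mulrA; lra.
  rewrite ler_pM2r // in h6.
  by rewrite /c ler_pdivrMr ?mulr_gt0 //; lra.
have bigF zeta : cabs zeta = 1 -> 1 / 2 <= cRe zeta -> q ^+ j - 1 <= cabs (F j).[pt zeta].
  move=> z1 z2; have Apt : A (pt zeta) by exists zeta.
  have := faber_lower (hj3 _ j3j _ (subset_closure (AV _ Apt))).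
  apply: le_trans; rewrite lerD2r; apply: lerXn2r; rewrite ?nnegrE ?cabs_ge0 //.
  exact: hx0.
(* Rotating F_j about [y0] by quarter turns makes at least one of the four factors large at every
   point of the circle; the others are at least c. *)
pose rot k : {poly Cplx R} := F j \Po ('i ^+ k *: ('X - y0%:P) + y0%:P).
have rotE k x : (rot k).[x] = (F j).[y0 + 'i ^+ k * (x - y0)].
  by rewrite /rot horner_comp hornerD hornerZ hornerXsubC hornerC addrC.
have i1 k : cabs ('i ^+ k : Cplx R) = 1.
  have : cabs ('i : Cplx R) = 1 by apply: rc_inj; rewrite -normr_cabs normCi.
  by rewrite cabsX => ->; rewrite expr1n.
have low_rot k x : cabs (x - y0) <= t -> c <= cabs (rot k).[x].
  move=> xt; rewrite rotE; apply: lowF.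
  by rewrite addrAC subrr add0r cabsM i1 mul1r.
pose H := rot 0 * rot 1 * rot 2 * rot 3.
have HE x : cabs H.[x] = cabs (rot 0).[x] * cabs (rot 1).[x] * cabs (rot 2).[x] * cabs (rot 3).[x].
  by rewrite /H !hornerM !cabsM.
have cp : 0 < c by [].
pose B := 1 / (c ^+ 3 * (q ^+ j - 1)).
have qj : 16 / c ^+ 3 < q ^+ j - 1 by have := hj5 j j5j; lra.
have qj0 : 0 < q ^+ j - 1 by apply: lt_trans qj; rewrite divr_gt0 // exprn_gt0.
have c30 : 0 < c ^+ 3 by rewrite exprn_gt0.
have BE x : B * x = x / (c ^+ 3 * (q ^+ j - 1)) by rewrite /B mul1r mulrC.
pose U : set (Cplx R) := [set x | cabs (x - y0) < t].
have clU x : closure U x -> cabs (x - y0) <= t.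
  have hU : U `<=` [set x | cabs (x - y0) <= t] by move=> w /ltW.
  by move=> /(closureS hU); rewrite -(proj1 (closure_id _) (@closed_cball R y0 t)).
have bU : bounded_set U.
  apply/bounded_cplxP; exists (t + cabs y0) => x; rewrite /U /=.
  have := cabs_lb x y0; lra.
have B0 : 0 <= B by rewrite divr_ge0 // mulr_ge0 // ltW.
have H0 x : closure U x -> H.[x] != 0.
  move=> /clU xt; rewrite -cabs_gt0 HE.
  by rewrite !mulr_gt0 // (lt_le_trans cp) // low_rot.
have bdry x : closure U x -> ~ U x -> cabs (1%:P : {poly Cplx R}).[x] <= B * cabs H.[x].
  move=> /clU xt nU; rewrite hornerC cabs1.
  have xE : cabs (x - y0) = t.
    by apply/eqP; rewrite eq_le xt leNgt; apply/negP.
  pose zeta : Cplx R := (x - y0) / (rc t * v).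
  have tv : rc t * v != 0.
    by rewrite -cabs_eq0 cabsM v1 mulr1 cabs_rc normr_eq0 gt_eqF.
  have z1 : cabs zeta = 1.
    by rewrite /zeta cabsM cabsV cabsM v1 mulr1 cabs_rc gtr0_norm // xE divff // gt_eqF.
  have rotz k : (rot k).[x] = (F j).[pt ('i ^+ k * zeta)].
    rewrite rotE /pt; congr (F j).[_ + _].
    by rewrite mulrA [_ * ('i ^+ k * _)]mulrCA /zeta [rc t * v * _]mulrC divfK.
  have big k : 1 / 2 <= cRe ('i ^+ k * zeta) -> q ^+ j - 1 <= cabs (rot k).[x].
    by move=> hk; rewrite rotz; apply: bigF => //; rewrite cabsM i1 mul1r.
  have l0 := low_rot 0%N _ xt; have l1 := low_rot 1%N _ xt.
  have l2 := low_rot 2%N _ xt; have l3 := low_rot 3%N _ xt.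
  have ex : [\/ 1 / 2 <= cRe ('i ^+ 0 * zeta), 1 / 2 <= cRe ('i ^+ 1 * zeta),
     1 / 2 <= cRe ('i ^+ 2 * zeta) | 1 / 2 <= cRe ('i ^+ 3 * zeta)].
    have := cabs_sqr zeta; rewrite z1 expr1n.
    have iR : cRe ('i : Cplx R) = 0 by rewrite -complexiE.
    have iI : cIm ('i : Cplx R) = 1 by rewrite -complexiE.
    set s := cRe zeta; set s' := cIm zeta => ss.
    have e0 : cRe ('i ^+ 0 * zeta) = s by rewrite expr0 mul1r.
    have e1 : cRe ('i ^+ 1 * zeta) = - s' by rewrite expr1 cReM iR iI -/s -/s'; ring.
    have e2 : cRe ('i ^+ 2 * zeta) = - s.
      by rewrite expr2 cReM cReM cImM iR iI -/s -/s'; ring.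
    have e3 : cRe ('i ^+ 3 * zeta) = s'.
      by rewrite exprS sqrCi mulrN1 mulNr cReN cReM iR iI -/s -/s'; ring.
    rewrite e0 e1 e2 e3.
    exact: quarter_arcs.
  have cq0 := mulr_gt0 c30 qj0.
  rewrite BE (ler_pdivlMr _ _ cq0) mul1r HE.
  have cge0 : 0 <= c := ltW cp; have qge0 : 0 <= q ^+ j - 1 := ltW qj0.
  case: ex => /big hb.
  - have -> : c ^+ 3 * (q ^+ j - 1) = (q ^+ j - 1) * c * c * c by rewrite !exprS expr0; ring.
    exact: ler_pM4.
  - have -> : c ^+ 3 * (q ^+ j - 1) = c * (q ^+ j - 1) * c * c by rewrite !exprS expr0; ring.
    exact: ler_pM4.
  - have -> : c ^+ 3 * (q ^+ j - 1) = c * c * (q ^+ j - 1) * c by rewrite !exprS expr0; ring.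
    exact: ler_pM4.
  - have -> : c ^+ 3 * (q ^+ j - 1) = c * c * c * (q ^+ j - 1) by rewrite !exprS expr0; ring.
    exact: ler_pM4.
have Uy0 : closure U y0 by apply: subset_closure; rewrite /U /= subrr cabs0.
(* The minimum principle for H appears as the maximum principle for the quotient 1 / H. *)
have := max_principle (@open_cball R y0 t) bU B0 H0 bdry Uy0.
rewrite hornerC cabs1 HE.
have rot0 k : cabs (rot k).[y0] <= 2.
  rewrite rotE subrr mulr0 addr0; apply: le_trans (hj4 _ j4j _ Gy0) _; lra.
have r16 : cabs (rot 0).[y0] * cabs (rot 1).[y0] * cabs (rot 2).[y0] * cabs (rot 3).[y0]
    <= 2 * 2 * 2 * 2.
  by apply: ler_pM4; rewrite ?cabs_ge0.
move=> hB.
have : 1 <= B * 16.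
  apply: le_trans hB _; apply: ler_wpM2l => //; apply: le_trans r16 _; lra.
rewrite BE (ler_pdivlMr _ _ (mulr_gt0 c30 qj0)) mul1r.
apply/negP; rewrite -ltNge.
by move: qj; rewrite ltr_pdivrMr // mulrC.
Qed.

Let ratio (k : nat -> nat) n (z : Cplx R) := phi z ^+ k n * (p (n - k n)%N).[z] / (p n).[z].

(** The threshold in n depends on [z] only through the bound [K] of 1 + D / g. This yields
    uniformity near each point of the sphere off the hull, infinity included. *)
Lemma ratio_core (k : nat -> nat) :
  (forall B, exists n0, forall n, (n0 <= n)%N -> (B <= k n)%N) ->
  (exists n0, forall n, (n0 <= n)%N -> (k n <= n)%N) ->
  (forall d : R, 0 < d -> exists n0, forall n, (n0 <= n)%N -> N n ->
     nrm mu (F (k n) * p (n - k n) - p n) <= d) ->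
  forall K e : R, 1 <= K -> 0 < e -> exists n0, forall n, (n0 <= n)%N -> N n ->
    forall z u (g D : R), V z -> 0 < g -> 0 <= D -> cabs u = 1 ->
      (forall w, supp mu w -> g <= cRe (u * (w - z))) ->
      (forall w, supp mu w -> cabs (w - z) <= D) -> 1 + D / g <= K ->
      cabs (ratio k n z - 1) < e.
Proof.
move=> kB kn kE K e K1 e0.
pose e1 := Num.min 1 (e / 4).
have e10 : 0 < e1 by rewrite lt_min ltr01 divr_gt0.
have e11 : e1 <= 1 by rewrite ge_min lexx.
have e12 : e1 <= e / 4 by rewrite ge_min lexx orbT.
pose e2 := Num.min (1 / 2) (e / 16).
have e20 : 0 < e2 by rewrite lt_min !divr_gt0.
have e21 : e2 <= 1 / 2 by rewrite ge_min lexx.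
have e22 : e2 <= e / 16 by rewrite ge_min lexx orbT.
have [j1 hj1] := faber_size_lead outer_near_infty a0 phi_infty FE.
have [j2 hj2] := FE e20.
have [n1 hn1] := kB (j1 + j2)%N; have [n2 hn2] := kn.
have K0 : 0 < K by lra.
have [n3 hn3] := kE (e1 / K) (divr_gt0 e10 K0).
exists (n1 + n2 + n3)%N => n /leq_add3[l1 l2 l3] Nn z u g D Vz g0 D0 u1 hg hD hK.
have kj := hn1 n l1.
have [sF _] := hj1 (k n) (leq_trans (leq_addr _ _) kj).
have hF := hj2 (k n) (leq_trans (leq_addl _ _) kj) z (subset_closure Vz).
have hk := hn2 n l2.
have hE : nrm mu (F (k n) * p (n - k n) - p n) <= e1 / K by apply: hn3.
have [pn0 h1 _] := eval_shift hk sF hE g0 D0 u1 hg hD.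
have P0 : 0 < cabs (p n).[z] by rewrite cabs_gt0.
pose X := (p (n - k n)%N).[z] / (p n).[z].
have rE : ratio k n z = phi z ^+ k n * X by rewrite /ratio /X mulrA.
have h2 : cabs ((F (k n)).[z] * X - 1) <= e1.
  have -> : (F (k n)).[z] * X - 1 =
      ((F (k n)).[z] * (p (n - k n)%N).[z] - (p n).[z]) / (p n).[z].
    by rewrite mulrBl divff // /X mulrA.
  rewrite cabsM cabsV ler_pdivrMr //; apply: le_trans h1 _.
  apply: ler_wpM2r; first exact: ltW.
  have : e1 / K * K = e1 by rewrite divfK // gt_eqF.
  have eK : 0 <= e1 / K by rewrite divr_ge0 // ltW.
  move=> E; rewrite -[leRHS]E mulrC; exact: ler_wpM2l.
have phi1 : 1 <= cabs (phi z) ^+ k n by apply: exprn_ege1; exact: ltW (phi_gt1 Vz).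
have h3 := faber_lower hF.
have X0 := cabs_ge0 X.
have h4 : cabs (F (k n)).[z] * cabs X <= 2.
  rewrite -cabsM; have := cabs_lb ((F (k n)).[z] * X) 1; rewrite cabs1; lra.
have h5 : 1 / 2 * cabs X <= cabs (F (k n)).[z] * cabs X by apply: ler_wpM2r => //; lra.
have h6 : cabs ((phi z ^+ k n - (F (k n)).[z]) * X) <= e2 * 4.
  rewrite cabsM cabsBC; apply: ler_pM => //; [exact: cabs_ge0|lra].
(* The estimates |F| >= 1/2 and |F X| <= 2 give |X| <= 4, so each summand is at most e / 4; this is
   the origin of the constants in [e1] and [e2]. *)
have -> : ratio k n z - 1 =
    (phi z ^+ k n - (F (k n)).[z]) * X + ((F (k n)).[z] * X - 1).
  by rewrite rE mulrBl addrA subrK.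
apply: le_lt_trans (cabsD _ _) _; lra.
Qed.

Lemma ratio_limit :
  exists k : nat -> nat,
    let ratio n := ext_sphere (fun z : Cplx R =>
      phi z ^+ k n * (p (n - k n)%N).[z] / (p n).[z]) in
    [/\ forall n, N n -> M (k n),
        forall m n, N m -> N n -> (m <= n)%N -> (k m <= k n)%N,
        forall B, exists2 n, N n & (B <= k n)%N &
        \forall n \near within N \oo, (k n <= n)%N] /\
    (forall x : sphere R, ~ (fin @` ch mu) x ->
       ratio n x @[n --> within N \oo] --> (1 : Cplx R)) /\
    (forall K : set (sphere R), compact K -> K `<=` ~` (fin @` ch mu) ->
       {uniform K, ratio @ within N \oo --> (fun=> 1 : Cplx R)}).
Proof.
have hE (d : R) : 0 < d -> exists j0, forall j, M j -> (j0 <= j)%N ->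
    exists n0, forall n, (n0 <= n)%N -> N n -> nrm mu (F j * p (n - j) - p n) <= d.
  move=> /shift_near[j0 h]; exists j0 => j Mj /(h _ Mj)[n0 h'].
  by exists n0 => n n0n Nn; have [] := h' n n0n Nn.
have [k [kM kmono kB kn kE]] := diagonal N_inf M_inf hE.
have core := ratio_core kB kn kE.
have [rS hrS] := compact_bounded_cplx cS.
pose r := `|rS|.
have r0 : 0 <= r := normr_ge0 _.
have hr w : supp mu w -> cabs w <= r by move=> /hrS h; apply: le_trans h (ler_norm _).
have [rV hrV] := outer_near_infty.
(* Far out, [u] points from [z] to the origin: the gap is |z| - r and the distances are at most |z|
   + r. As |z| > 2r, the quotient is at most 3, hence K = 4. *)
have far (e : R) : 0 < e -> exists n0, forall n, (n0 <= n)%N -> N n -> forall z,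
    `|rV| + 2 * r + 1 < cabs z -> cabs (ratio k n z - 1) < e.
  move=> e0; have [|n0 hn0] := core 4 e _ e0; first lra.
  exists n0 => n n0n Nn z hz.
  have rV0 := normr_ge0 rV; have rV1 := ler_norm rV.
  have z0 : 0 < cabs z by lra.
  have g0 : 0 < cabs z - r by lra.
  apply: (hn0 n n0n Nn z (- (rc (cabs z)^-1 * z^*)) (cabs z - r) (cabs z + r)) => //.
  - apply: hrV; lra.
  - lra.
  - rewrite cabsN cabsM cabs_rc cabsJ ger0_norm ?invr_ge0 ?cabs_ge0 //.
    by rewrite mulVf // gt_eqF.
  - move=> w /hr hw.
    have -> : - (rc (cabs z)^-1 * z^*) * (w - z) = rc (cabs z)^-1 * (z^* * z - z^* * w).
      by ring.
    rewrite cReZ cReB mulJc cRe_rc -ler_pdivrMl ?invr_gt0 // invrK.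
    have := le_trans (ler_norm _) (cRe_le (z^* * w)); rewrite cabsM cabsJ.
    have : cabs z * cabs w <= cabs z * r by apply: ler_wpM2l => //; exact: ltW.
    rewrite expr2; lra.
  - move=> w /hr hw; have := cabsB w z; lra.
  - have : (cabs z + r) / (cabs z - r) <= 3 by rewrite ler_pdivrMr //; lra.
    lra.
(* The value at infinity is a limit, which exists because the powers of z cancel when k n <= n. The
   bound from [far] passes to it in weak form, which is why e / 2 is used. *)
have inf_le (e : R) : 0 < e -> exists n0, forall n, (n0 <= n)%N -> N n ->
    cabs (ext_sphere (ratio k n) infty - 1) < e.
  move=> e0; have [|n0 hn0] := far (e / 2); first lra.
  have [n1 hn1] := kn.
  exists (n0 + n1)%N => n hn Nn.
  have hkn := hn1 n (leq_trans (leq_addl _ _) hn).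
  have {}hn := leq_trans (leq_addr _ _) hn.
  have cl : ratio k n @ near_infty -->
      rc a ^+ k n * (p (n - k n)%N)`_(n - k n) / (p n)`_n.
    have pn0 : (p n)`_n != 0.
      rewrite (coef_orthonormal p_ortho) -cabs_eq0 cabs_rc normr_eq0 gt_eqF //.
      exact: (kappa_gt0 p_ortho n).
    have c1 : (phi z / z) ^+ k n @[z --> near_infty] --> rc a ^+ k n.
      have cX : continuous (horner 'X^(k n) : Cplx R -> Cplx R) := @continuous_horner R _.
      rewrite (_ : horner 'X^(k n) = fun x : Cplx R => x ^+ k n) in cX; last first.
        by apply/funext => x; rewrite hornerXn.
      exact: (cvg_comp _ _ phi_infty (cX (rc a))).
    have c2 : (p (n - k n)%N).[z] / z ^+ (n - k n) @[z --> near_infty] -->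
        (p (n - k n)%N)`_(n - k n).
      by apply: cvg_horner_infty; rewrite (size_orthonormal p_ortho).
    have c3 : (p n).[z] / z ^+ n @[z --> near_infty] --> (p n)`_n.
      by apply: cvg_horner_infty; rewrite (size_orthonormal p_ortho).
    have c4 := cvgM (cvgM c1 c2) (cvgV pn0 c3).
    have FF := near_infty_filter R; move: (c4 FF FF FF) => {}c4.
    apply/cvg_cplxP => d d0; move/cvg_cplxP : c4 => /(_ _ d0)/near_inftyP[r1 h1].
    apply/near_inftyP; exists `|r1| => z hz.
    have z0 : z != 0 by rewrite -cabs_gt0 (le_lt_trans _ hz).
    have -> : ratio k n z = (phi z / z) ^+ k n *
        ((p (n - k n)%N).[z] / z ^+ (n - k n)) * ((p n).[z] / z ^+ n)^-1.
      rewrite /ratio -[in z ^+ n](subnKC hkn) exprD expr_div_n.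
      (* At a zero of p_n both sides are 0 by the convention for the inverse of 0. *)
      have [->|pz] := eqVneq (p n).[z] 0; first by rewrite mul0r !invr0 !mulr0.
      by field; rewrite pz !expf_neq0.
    by apply: h1; apply: le_lt_trans (ler_norm _) hz.
  rewrite /ext_sphere /infty.
  have := lim_infty_le cl (fun z hz => ltW (hn0 n hn Nn z hz)).
  by move=> h; apply: le_lt_trans h _; lra.
(* An estimate near x and for large n at once serves both the pointwise limit and, through near
   coverings, uniformity on compact sets. *)
have loc (x : sphere R) (e : R) : ~ (fin @` ch mu) x -> 0 < e ->
    \forall x' \near x & n \near within N \oo, cabs (ext_sphere (ratio k n) x' - 1) < e.
  move=> nx e0; case: x nx => [z|] nx; last first.
    have [n0 h0] := far _ e0; have [n1 h1] := inf_le _ e0.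
    exists ([set x' | x' = infty \/ exists2 z, x' = fin z & `|rV| + 2 * r + 1 < cabs z],
            [set n | (n0 + n1 <= n)%N /\ N n]).
      split; first by apply/nbhs_inftyP; split; [left|exists (`|rV| + 2 * r + 1) => z hz; right; exists z].
      by apply/near_within_oo; exists (n0 + n1)%N.
    move=> [x' n] [/= [->|[z -> hz]] [hn Nn]].
      exact: h1 (leq_trans (leq_addl _ _) hn) Nn.
    exact: h0 (leq_trans (leq_addr _ _) hn) Nn _ hz.
  have nz : ~ convex_hull (supp mu) z by move=> h; apply: nx; exists z.
  have [u [u1 [d d0 hd]]] := convex_hull_separation cS nz.
  pose K := 1 + (r + cabs z + d / 2) / (d / 2).
  have d2 : 0 < d / 2 by lra.
  have Dp : 0 <= r + cabs z + d / 2 by have := cabs_ge0 z; lra.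
  have K1 : 1 <= K by rewrite /K lerDl divr_ge0 // ltW.
  have [n0 h0] := core K e K1 e0.
  exists ([set x' | exists2 z', x' = fin z' & cabs (z' - z) < d / 2],
          [set n | (n0 <= n)%N /\ N n]).
    split; first by apply/nbhs_finP; exists (d / 2) => // z' hz'; exists z'.
    by apply/near_within_oo; exists n0.
  move=> [x' n] [/= [z' -> hz'] [hn Nn]].
  have gap w : cRe (u * (w - z')) >= cRe (u * (w - z)) - d / 2.
    have -> : w - z' = (w - z) - (z' - z) by rewrite opprB addrA subrK.
    rewrite [u * (w - z - _)]mulrBr cReB.
    have := le_trans (ler_norm _) (cRe_le (u * (z' - z))).
    rewrite cabsM u1 mul1r; lra.
  have hd' w : supp mu w -> d / 2 <= cRe (u * (w - z')).
    by move=> /hd; have := gap w; lra.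
  apply: (h0 n hn Nn z' u (d / 2) (r + cabs z + d / 2)) => //.
    (* The half-plane that separates z' from the support also separates it from the closure of [G];
       thus z' lies in the exterior domain. *)
    by apply: (outer_half_plane u1); exact: half_plane_closureG hd'.
  move=> w /hr hw; have := cabs_triangle z w z'; have := cabsB w z.
  rewrite (cabsBC z z'); lra.
exists k; split; last split.
- split.
  + by move=> n _; exact: kM.
  + by move=> m n _ _; exact: kmono.
  + move=> B; have [n0 h] := kB B; have [n Nn hn] := infinite_nat_ge n0 N_inf.
    by exists n => //; exact: h.
  + by have [n0 h] := kn; apply/near_within_oo; exists n0 => n /h.
- move=> x nx; apply/cvg_cplxP => e e0.
  have [[A B] [/= Ax BN] h] := loc x e nx e0.
  apply: filterS BN => n Bn; apply: (h (x, n)); split => //.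
  exact: (nbhs_singleton Ax).
- move=> K /compact_near_coveringP cK KC; apply: uniform_cplx => e e0.
  have := cK _ (within N \oo) (fun n x => cabs (ext_sphere (ratio k n) x - 1) < e) _.
  by apply => x Kx; exact: loc (KC _ Kx) e0.
Qed.

End RatioLimit.

(** * Energy of a measure carried by short segments *)

Section IntegralBounds.
Context d (T : measurableType d) (R : realType) (m : {measure set T -> \bar R}).
Local Open Scope ereal_scope.

(* Measurability is not needed: the integral of a nonnegative function is a
   supremum over the simple functions below it. *)
Lemma le_integralT (f g : T -> \bar R) : (forall x, f x <= g x) ->
  \int[m]_x f x <= \int[m]_x g x.
Proof.
move=> fg; rewrite /integral !patch_setT; apply: leeB; apply: ereal_sup_le.
  move=> _ [h hf <-]; exists h => // x; apply: le_trans (hf x) _.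
  by rewrite !funeposE ge_max !le_max fg lexx orbT.
move=> _ [h hf <-]; exists h => // x; apply: le_trans (hf x) _.
by rewrite !funenegE ge_max !le_max leeN2 fg lexx orbT.
Qed.

(** Meant for the logarithmic kernel, which is unbounded below: [g] minorizes its positive part, [h]
    majorizes its negative part. *)
Lemma integral_lower (f g h : T -> \bar R) :
  (forall x, g x <= maxe (f x) 0) -> (forall x, maxe (- f x) 0 <= h x) ->
  \int[m]_x g x - \int[m]_x h x <= \int[m]_x f x.
Proof.
move=> gf fh; rewrite [leRHS]integralE.
by apply: leeB; apply: le_integralT => x; rewrite ?funeposE ?funenegE.
Qed.

Lemma integral_indicZ (A : set T) (k : \bar R) : measurable A -> 0 <= k ->
  \int[m]_x (k * (\1_A x)%:E) = k * m A.
Proof.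
move=> mA k0.
have mf : measurable_fun setT (fun x => (\1_A x)%:E : \bar R).
  exact/measurable_EFinP/measurable_indic.
have f0 (x : T) : setT x -> 0 <= (\1_A x)%:E :> \bar R by rewrite lee_fin.
by rewrite (ge0_integralZl m measurableT mf f0 k0) integral_indic // setIT.
Qed.

Lemma measurable_indicZ (A : set T) (k : \bar R) : measurable A ->
  measurable_fun setT (fun x => k * (\1_A x)%:E).
Proof.
move=> mA; apply: emeasurable_funM; first exact: measurable_cst.
exact/measurable_EFinP/measurable_indic.
Qed.

End IntegralBounds.

Section SegmentMeasure.
Context {R : realType}.
Local Notation I01 := ([set` `[(0 : R), (1 : R)]%R] : set R).
Context (n : nat) (z : nat -> Cplx R) (r : R).
Hypotheses (r0 : 0 < r) (sep : forall i j, (i <= n)%N -> (j <= n)%N -> i != j ->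
  r < cabs (z i - z j)).

Definition seg_path j (t : R) : Cplx R := z j + rc t * rc r.

Lemma continuous_seg_path j : continuous (seg_path j).
Proof. exact: continuous_line. Qed.

Lemma measurable_seg_path j :
  measurable_fun setT (seg_path j : measurableTypeR R -> borelC R).
Proof.
have := @measurability _ _ (measurableTypeR R) (borelC R) setT (seg_path j) (@open (Cplx R)) (erefl _).
apply => _ [U oU <-].
rewrite setTI; apply: open_measurable.
by have /continuousP := @continuous_seg_path j; apply.
Qed.

Definition unit_lebesgue : {measure set (measurableTypeR R) -> \bar R} :=
  mrestr (@lebesgue_measure R) (measurable_itv (`[(0 : R), (1 : R)]%R : interval R)).

Definition seg_measure j : {measure set (borelC R) -> \bar R} :=
  measure_function_pushforward__canonical__measure_function_Measure
    unit_lebesgue (measurable_seg_path j).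

(** The normalized counting measure of the points [z j], each mass being spread evenly over a
    horizontal segment of length [r]. *)
Definition segs_measure : {measure set (borelC R) -> \bar R} :=
  mscale ((n.+1%:R : R)^-1)%:nng (msum seg_measure n.+1).

Lemma segs_measureE (A : set (borelC R)) :
  segs_measure A = ((n.+1%:R^-1)%:E * \sum_(j < n.+1)
    lebesgue_measure ((seg_path j @^-1` A) `&` I01))%E.
Proof. by []. Qed.

Definition seg j : set (Cplx R) := seg_path j @` I01.

Lemma closed_seg j : closed (seg j).
Proof.
have cs : compact (seg j).
  apply: continuous_compact; last exact: segment_compact.
  exact/continuous_subspaceT/continuous_seg_path.
exact: (compact_closed (@norm_hausdorff _ _) cs).
Qed.

Lemma seg_path_sub j (s t : R) : seg_path j s - seg_path j t = rc ((s - t) * r).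
Proof. by rewrite rcM rcB /seg_path; ring. Qed.

Lemma seg_dist j (t : R) w : t \in `[0, 1]%R -> seg j w -> cabs (w - seg_path j t) <= r.
Proof.
rewrite in_itv /= => /andP[t0 t1] [s]; rewrite /= in_itv /= => /andP[s0 s1] <-.
rewrite seg_path_sub cabs_rc normrM (gtr0_norm r0); apply: ler_piMl; first exact: ltW.
rewrite ler_norml; lra.
Qed.

Lemma seg_disjoint i j (t : R) : (i <= n)%N -> (j <= n)%N -> i != j -> t \in `[0, 1]%R ->
  ~ seg j (seg_path i t).
Proof.
move=> iN jN ij t01 sj.
have := sep iN jN ij.
move: t01 sj; rewrite in_itv /= => /andP[t0 t1] [s]; rewrite /= in_itv /= => /andP[s0 s1].
rewrite /seg_path => E.
have -> : z i - z j = rc ((s - t) * r).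
  rewrite (_ : z i = z j + rc s * rc r - rc t * rc r); last by rewrite E addrK.
  by rewrite rcM rcB; ring.
rewrite cabs_rc normrM (gtr0_norm r0) => h.
have : `|s - t| <= 1 by rewrite ler_norml; lra.
by move=> h1; have := ler_piMl (ltW r0) h1; rewrite leNgt h.
Qed.

Lemma lebesgue_I01 : lebesgue_measure I01 = 1%E.
Proof. by rewrite lebesgue_measure_itv /= lte_fin ltr01 oppr0 adde0. Qed.

Lemma seg_path_preimage i j (A : set (Cplx R)) : (i <= n)%N -> (j <= n)%N -> i != j ->
  A `<=` seg j -> (seg_path i @^-1` A) `&` I01 = set0.
Proof.
move=> iN jN ij Aj; apply/seteqP; split => t //= [/Aj + t01].
exact: seg_disjoint.
Qed.

Lemma segs_measure_sub j (A : set (borelC R)) : (j <= n)%N -> A `<=` seg j ->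
  segs_measure A = ((n.+1%:R^-1)%:E * lebesgue_measure ((seg_path j @^-1` A) `&` I01))%E.
Proof.
move=> jN Aj; rewrite segs_measureE (bigD1 (Ordinal (jN : (j < n.+1)%N))) //=.
rewrite big1 ?adde0 // => i ij.
by rewrite (seg_path_preimage _ jN _ Aj) ?measure0 // -ltnS.
Qed.

Lemma segs_measure_seg j : (j <= n)%N -> segs_measure (seg j) = (n.+1%:R^-1)%:E.
Proof.
move=> jN; rewrite (segs_measure_sub jN) //.
rewrite (_ : _ `&` _ = I01) ?lebesgue_I01 ?mule1 //.
by apply/seteqP; split => [t []//|t t01]; split => //; exists t.
Qed.

Definition segs : set (Cplx R) := \bigcup_(j in `I_n.+1) seg j.

Lemma segs_measure_out : segs_measure (~` segs) = 0%E.
Proof.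
rewrite segs_measureE big1 ?mule0 // => j _.
rewrite (_ : _ `&` _ = set0) ?measure0 //.
by apply/seteqP; split => t //= [h t01]; apply: h; exists j => //=; exists t.
Qed.

Lemma segs_measureT : segs_measure setT = 1%E.
Proof.
rewrite segs_measureE (eq_bigr (fun=> (1 : R)%:E)) => [|j _]; last first.
  by rewrite preimage_setT setTI lebesgue_I01.
by rewrite sumEFin sumr_const card_ord -EFinM mulVf // pnatr_eq0.
Qed.

Definition seg_ball j (t rho : R) : set (Cplx R) :=
  seg j `&` [set w | cabs (w - seg_path j t) <= r * rho].

Lemma closed_seg_ball j t rho : closed (seg_ball j t rho).
Proof. by apply: closedI; [exact: closed_seg|exact: closed_cball]. Qed.

Lemma segs_measure_ball j (t rho : R) : (j <= n)%N -> t \in `[0, 1]%R -> 0 <= rho ->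
  (segs_measure (seg_ball j t rho) <= (n.+1%:R^-1)%:E * (2 * rho)%:E)%E.
Proof.
move=> jN t01 rho0; rewrite (segs_measure_sub jN); last exact: subIsetl.
apply: lee_wpmul2l; first by rewrite lee_fin invr_ge0.
have -> : (2 * rho)%:E = lebesgue_measure [set` `[t - rho, t + rho]%R].
  rewrite lebesgue_measure_itv /= lte_fin.
  case: ifPn => h; first by rewrite -EFinD; congr EFin; ring.
  by congr EFin; lra.
apply: le_measure; rewrite ?inE.
- apply: measurableI; last exact: measurable_itv.
  rewrite -[X in measurable X]setTI; apply: measurable_seg_path => //.
  by apply: measurable_closedC; exact: closed_seg_ball.
- exact: measurable_itv.
- move=> s [[_ h] _]; move: h.
  rewrite /= seg_path_sub cabs_rc normrM (gtr0_norm r0) mulrC ler_pM2l //.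
  rewrite in_itv /= ler_norml; lra.
Qed.

End SegmentMeasure.

Section DyadicLog.
Context {R : realType}.
Local Open Scope ereal_scope.

Lemma nneseries_le (f : nat -> \bar R) (C : \bar R) : (forall k, 0 <= f k) ->
  (forall m, \sum_(0 <= k < m) f k <= C) -> \sum_(0 <= k <oo) f k <= C.
Proof.
move=> f0 h; apply: lime_le; first by apply: is_cvg_nneseries => k _ _.
by apply: nearW => m; exact: h.
Qed.

(** If 2^-(m+1) < u <= 2^-m, then b_0, ..., b_m are 1 and the sum is at least (m+1) ln 2. With
    indicators of shrinking disks for [b], the logarithmic singularity is dominated by a series that
    integrates termwise. *)
Lemma dyadic_log (u : R) (b : nat -> \bar R) : (0 <= u)%R -> (u <= 1)%R ->
  (forall k, 0 <= b k) -> (forall k, (u <= 2 ^- k)%R -> b k = 1) ->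
  - lne u%:E <= \sum_(0 <= k <oo) (ln 2 : R)%:E * b k.
Proof.
move=> u0 u1 b0 bE.
have ln2 : (0 < ln 2 :> R)%R by rewrite ln_gt0 // ltr1n.
have t0 k : 0 <= (ln 2 : R)%:E * b k by rewrite mule_ge0 // lee_fin ltW.
have part m : (u <= 2 ^- m)%R ->
    (m.+1%:R * ln 2)%:E <= \sum_(0 <= k <oo) (ln 2 : R)%:E * b k.
  move=> um; apply: le_trans (nneseries_lim_ge m.+1 _) => //.
  rewrite big_mkord (eq_bigr (fun=> (ln 2 : R)%:E)) => [|k _].
    by rewrite sumEFin sumr_const card_ord mulr_natl.
  rewrite bE ?mule1 //; apply: le_trans um _.
  by rewrite lef_pV2 ?posrE ?exprn_gt0 // ler_weXn2l // ?ler1n // -ltnS.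
have [uE|un0] := eqVneq u 0%R.
  rewrite [leRHS](_ : _ = +oo) ?leey //.
  apply/eqyP => A A0.
  pose m := Num.truncn (A / ln 2).
  have um : (0 <= 2 ^- m :> R)%R by rewrite invr_ge0 exprn_ge0.
  apply: le_trans (_ : (m.+1%:R * ln 2)%:E <= _); last first.
    by apply: part; rewrite uE.
  by rewrite lee_fin -ler_pdivrMr //; apply: ltW; exact: truncnS_gt.
have up : (0 < u)%R by rewrite lt_def un0.
have exP : exists m, (2 ^- m.+1 < u)%R.
  have [m hm] := @expr_unbounded R 2 u^-1 (ltr1n _ 2).
  exists m; rewrite -[ltRHS]invrK ltf_pV2 ?posrE ?exprn_gt0 ?invr_gt0 //.
  by apply: hm.
case: (ex_minnP exP) => m hm mmin.
have um : (u <= 2 ^- m)%R.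
  case: m hm mmin => [|m] hm mmin; first by rewrite expr0 invr1.
  by rewrite leNgt; apply/negP => /mmin; rewrite ltnn.
apply: le_trans (part m um); rewrite lne_EFin // -EFinN lee_fin.
have := ler_ln (x := 2 ^- m.+1) (y := u).
rewrite !posrE invr_gt0 exprn_gt0 // => /(_ isT up).
rewrite (ltW hm) => /idP h.
have : (ln (2 ^- m.+1) <= ln u)%R by rewrite h.
by rewrite lnV ?posrE ?exprn_gt0 // lnXn // mulr_natl; lra.
Qed.

End DyadicLog.

Section SegmentEnergy.
Context {R : realType} (n : nat) (z : nat -> Cplx R) (r : R).
Hypotheses (r0 : 0 < r) (r1 : r <= 1)
  (sep : forall i j, (i <= n)%N -> (j <= n)%N -> i != j ->
    2 * n.+1%:R * r <= cabs (z i - z j)).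

Local Notation path := (seg_path z r).
Local Notation sg := (seg z r).
Local Notation nu := (segs_measure n z r).

Let N0 : 0 < n.+1%:R :> R. Proof. by rewrite ltr0n. Qed.

Let N1 : 1 <= n.+1%:R :> R. Proof. by rewrite ler1n. Qed.

Let sep' i j : (i <= n)%N -> (j <= n)%N -> i != j -> r < cabs (z i - z j).
Proof.
move=> iN jN ij; apply: lt_le_trans (sep iN jN ij).
have : 1 * r <= n.+1%:R * r by rewrite ler_pM2r.
have := r0; rewrite -mulrA; move: (n.+1%:R * r) => x; lra.
Qed.

(** For distinct indices this bounds from below the logarithm of the distance between points of the
    two segments: the correction factor absorbs the length r, since |z_i - z_j| >= 2 (n+1) r. The
    diagonal entry is the scale of the self-interaction. *)
Definition log_gap i j : R :=
  if j == i then ln r else ln (cabs (z i - z j) * (1 - (2 * n.+1%:R)^-1)).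

Let q0 : 0 < 1 - (2 * n.+1%:R)^-1 :> R.
Proof.
by rewrite subr_gt0 invf_lt1 ?mulr_gt0 //; move: N1; lra.
Qed.

Let gap_pos i j : (i <= n)%N -> (j <= n)%N -> j != i -> 0 < cabs (z i - z j).
Proof. by move=> iN jN ji; apply: lt_trans r0 (sep' iN jN _); rewrite eq_sym. Qed.

Let far_bound i j (t : R) w : (i <= n)%N -> (j <= n)%N -> j != i -> t \in `[0, 1]%R ->
  sg j w -> cabs (z i - z j) * (1 - (2 * n.+1%:R)^-1) <= cabs (path i t - w).
Proof.
move=> iN jN ji t01 [s s01 <-].
have -> : path i t - path j s = (z i - z j) - rc ((s - t) * r).
  by rewrite /seg_path rcM rcB; ring.
apply: le_trans (cabs_lb _ _); rewrite mulrBr mulr1 lerD2l lerN2.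
rewrite cabs_rc normrM (gtr0_norm r0).
have st : `|s - t| <= 1.
  move: t01 s01; rewrite /= !in_itv /= => /andP[t0 t1] /andP[s0 s1].
  rewrite ler_norml; lra.
apply: le_trans (ler_piMl (ltW r0) st) _.
rewrite ler_pdivlMr ?mulr_gt0 // mulrC; apply: sep => //; by rewrite eq_sym.
Qed.

Let indic_seg j i w : (j <= n)%N -> (i <= n)%N -> sg j w -> \1_(sg i) w = (i == j)%:R :> R.
Proof.
move=> jN iN jw; rewrite indicE; have [->|ij] := eqVneq i j; first by rewrite mem_set.
rewrite memNset // => iw; case: iw => t t01 tE.
by apply: (seg_disjoint r0 sep' iN jN ij t01); rewrite tE.
Qed.

Local Open Scope ereal_scope.

Let sum_indic (c : nat -> R) j w : (j <= n)%N -> sg j w ->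
  \sum_(i < n.+1) (c i)%:E * (\1_(sg i) w)%:E = (c j)%:E.
Proof.
move=> jN jw; rewrite (bigD1 (Ordinal (jN : (j < n.+1)%N))) //= big1 ?adde0.
  by rewrite (indic_seg jN jN jw) eqxx mule1.
move=> i ij; have iN : (i <= n)%N by rewrite -ltnS.
rewrite (indic_seg jN iN jw) (_ : (i == j :> nat) = false) ?mule0 //.
exact: negbTE.
Qed.

Let sum_indic0 (c : nat -> R) w : ~ segs n z r w ->
  \sum_(i < n.+1) (c i)%:E * (\1_(sg i) w)%:E = 0.
Proof.
move=> nw; apply: big1 => i _; rewrite indicE memNset ?mule0 // => iw.
by apply: nw; exists i => /=.
Qed.

Let measurable_seg j : measurable (sg j : set (borelC R)).
Proof. by apply: measurable_closedC; exact: closed_seg. Qed.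

Let integral_sum_indic (c : nat -> R) : (forall i, (0 <= c i)%R) ->
  \int[nu]_w (\sum_(i < n.+1) (c i)%:E * (\1_(sg i) w)%:E) =
  ((\sum_(i < n.+1) c i) / n.+1%:R)%:E.
Proof.
move=> c0; rewrite ge0_integral_sum //.
- transitivity (\sum_(i < n.+1) (c i * n.+1%:R^-1)%:E).
    apply: eq_bigr => i _; rewrite integral_indicZ ?lee_fin //.
    by rewrite (segs_measure_seg r0 sep') // -ltnS.
  by rewrite sumEFin mulr_suml.
- by move=> i; apply: measurable_indicZ.
- by move=> i w _; rewrite mule_ge0 // lee_fin.
Qed.

Let geom4 m : (\sum_(0 <= k < m) (2 * 2 ^- k) <= 4 :> R)%R.
Proof.
suff -> : (\sum_(0 <= k < m) (2 * 2 ^- k) = 4 - 4 * 2 ^- m :> R)%R.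
  have : (0 <= 2 ^- m :> R)%R by rewrite invr_ge0 exprn_ge0.
  lra.
elim: m => [|m IH]; first by rewrite big_nil expr0 invr1; ring.
rewrite big_nat_recr //= IH exprS invfM; lra.
Qed.

(** On its own segment the kernel is ln r + ln u with u the distance divided by r. By [dyadic_log]
    the negative part of ln u is at most the sum of ln 2 over the disks of radius 2^-k r containing
    the point. Their masses are at most 2 2^-k / (n+1), with total 4 / (n+1). *)
Lemma segs_potential_ge i (t : R) : (i <= n)%N -> t \in `[0, 1]%R ->
  ((\sum_(j < n.+1) log_gap i j - 4 * ln 2) / n.+1%:R)%:E <=
  \int[nu]_w lne (cabs (path i t - (w : Cplx R)))%:E.
Proof.
move=> iN t01.
pose cp j := Num.max (log_gap i j) 0%R; pose cn j := Num.max (- log_gap i j)%R 0%R.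
have cp0 j : (0 <= cp j)%R by rewrite le_max lexx orbT.
have cn0 j : (0 <= cn j)%R by rewrite le_max lexx orbT.
pose B k : set (borelC R) := seg_ball z r i t (2 ^- k).
have mB k : measurable (B k) by apply: measurable_closedC; exact: closed_seg_ball.
pose U : set (borelC R) := ~` segs n z r.
have mU : measurable U.
  apply: measurableC; apply: bigcup_measurable => j _; exact: measurable_seg.
(* [g] collects the positive gaps and [h1] the negative ones; [h2] is the dyadic correction for
   segment i; [h3] is +oo off the segments, a null set. *)
pose g (w : borelC R) := \sum_(j < n.+1) (cp j)%:E * (\1_(sg j) w)%:E.
pose h1 (w : borelC R) := \sum_(j < n.+1) (cn j)%:E * (\1_(sg j) w)%:E.
pose h2 (w : borelC R) := \sum_(0 <= k <oo) (ln 2 : R)%:E * (\1_(B k) w)%:E.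
pose h3 (w : borelC R) : \bar R := +oo * (\1_U w)%:E.
have ln2 : (0 < ln 2 :> R)%R by rewrite ln_gt0 // ltr1n.
have i0 (A : set (borelC R)) w : 0 <= (\1_A w)%:E :> \bar R by rewrite lee_fin.
have h1p w : 0 <= h1 w.
  by apply: sume_ge0 => j _; apply: mule_ge0; rewrite ?lee_fin.
have h2t k w : 0 <= (ln 2 : R)%:E * (\1_(B k) w)%:E.
  by apply: mule_ge0; rewrite ?lee_fin // ltW.
have h2p w : 0 <= h2 w by apply: nneseries_ge0.
have h3p w : 0 <= h3 w by apply: mule_ge0.
have mh1 : measurable_fun setT h1.
  by apply: emeasurable_sum => j; apply: measurable_indicZ.
have mh2 : measurable_fun setT h2.
  by apply: ge0_emeasurable_sum => // k _; apply: measurable_indicZ.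
have mh3 : measurable_fun setT h3 by apply: measurable_indicZ.
have Ih : \int[nu]_w (h1 w + h2 w + h3 w) <=
    ((\sum_(j < n.+1) cn j) / n.+1%:R + ln 2 * 4 / n.+1%:R)%:E.
  have h12p w : setT w -> 0 <= h1 w + h2 w by move=> _; rewrite adde_ge0.
  have mh12 : measurable_fun setT (fun w => h1 w + h2 w) by apply: emeasurable_funD.
  rewrite ge0_integralD // ge0_integralD //.
  rewrite integral_sum_indic // integral_indicZ // segs_measure_out mule0 adde0.
  rewrite EFinD leeD2l // integral_nneseries //; last first.
    by move=> k; apply: measurable_indicZ.
  apply: nneseries_le => [k|m]; first by apply: integral_ge0.
  apply: le_trans (_ : \sum_(0 <= k < m) (ln 2 * (n.+1%:R^-1 * (2 * 2 ^- k)))%:E <= _).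
    have ln20 : 0 <= (ln 2 : R)%:E by rewrite lee_fin ltW.
    apply: lee_sum => k _; rewrite integral_indicZ //.
    rewrite EFinM; apply: lee_wpmul2l; first by rewrite lee_fin ltW.
    have p2 : (0 <= 2 ^- k :> R)%R by rewrite invr_ge0 exprn_ge0.
    rewrite EFinM; exact: (segs_measure_ball r0 sep' iN t01 p2).
  rewrite sumEFin lee_fin -mulr_sumr -mulr_sumr.
  rewrite -mulrA ler_pM2l // mulrC ler_pM2r ?invr_gt0 //; exact: geom4.
apply: le_trans (_ : \int[nu]_w g w - \int[nu]_w (h1 w + h2 w + h3 w) <= _).
  rewrite integral_sum_indic //.
  apply: le_trans (leeB (lexx _) Ih); rewrite -EFinB lee_fin.
  have -> : (\sum_(j < n.+1) log_gap i j = \sum_(j < n.+1) cp j - \sum_(j < n.+1) cn j)%R.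
    rewrite -sumrB; apply: eq_bigr => j _; rewrite /cp /cn.
    by have [h|h] := leP (log_gap i j) 0%R; have [h'|h'] := leP (- log_gap i j)%R 0%R; lra.
  by rewrite !mulrBl opprD addrA [(ln 2 * 4)%R]mulrC.
apply: integral_lower => w; cbv beta.
  have [[j jN jw]|nw] := pselect (segs n z r w); last first.
    by rewrite /g sum_indic0 // le_max lexx orbT.
  rewrite /= ltnS in jN; rewrite /g (sum_indic cp jN jw) /cp.
  have [ji|ji] := eqVneq j i.
    have -> : log_gap i j = ln r by rewrite /log_gap ji eqxx.
    rewrite (_ : Num.max _ _ = 0%R) ?le_max ?lexx ?orbT //.
    by apply/max_idPr; rewrite ln_le0.
  have fb := far_bound iN jN ji t01 jw.
  have gp : (0 < cabs (z i - z j) * (1 - (2 * n.+1%:R)^-1))%R.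
    by rewrite mulr_gt0 // (gap_pos iN jN ji).
  have wp := lt_le_trans gp fb.
  rewrite lne_EFin // /log_gap (negbTE ji) -EFin_max lee_fin.
  by rewrite ge_max !le_max lexx orbT andbT ler_ln // fb.
have [[j jN jw]|nw] := pselect (segs n z r w); last first.
  rewrite [leRHS](_ : _ = +oo) ?leey // /h3 indicE mem_set // mule1 addey //.
  by rewrite gt_eqF // (lt_le_trans _ (adde_ge0 (h1p w) (h2p w))) // ltNye.
rewrite /= ltnS in jN.
apply: le_trans (_ : h1 w + h2 w <= _); last by rewrite leeDl.
rewrite {1}/h1 (sum_indic cn jN jw) /cn.
have [ji|ji] := eqVneq j i; last first.
  apply: le_trans (_ : (Num.max (- log_gap i j)%R 0%R)%:E <= _); last by rewrite leeDl.
  have fb := far_bound iN jN ji t01 jw.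
  have gp : (0 < cabs (z i - z j) * (1 - (2 * n.+1%:R)^-1))%R.
    by rewrite mulr_gt0 // (gap_pos iN jN ji).
  have wp := lt_le_trans gp fb.
  rewrite lne_EFin // /log_gap (negbTE ji) -EFinN -EFin_max lee_fin.
  by rewrite ge_max !le_max lexx orbT andbT lerN2 ler_ln // fb.
rewrite {}ji in jw jN *; rewrite {jN}.
have wE : (cabs (path i t - w) <= r)%R by rewrite cabsBC; exact: seg_dist.
pose u := (cabs (path i t - w) / r)%R.
have u0 : (0 <= u)%R by rewrite divr_ge0 ?cabs_ge0 // ltW.
have u1 : (u <= 1)%R by rewrite ler_pdivrMr // mul1r.
have uE : cabs (path i t - w) = (r * u)%R by rewrite /u mulrC divfK // gt_eqF.
have lgE : log_gap i i = ln r by rewrite /log_gap eqxx.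
have lr0 : (ln r <= 0)%R by rewrite ln_le0.
have -> : Num.max (- log_gap i i)%R 0%R = (- ln r)%R.
  by rewrite lgE; apply/max_idPl; rewrite oppr_ge0.
have bE k : (u <= 2 ^- k)%R -> (\1_(B k) w)%:E = 1 :> \bar R.
  move=> uk; rewrite indicE mem_set //; split => //=.
  by rewrite cabsBC uE ler_pM2l.
have := @dyadic_log R u (fun k => (\1_(B k) w)%:E) u0 u1 (fun k => i0 _ _) bE.
rewrite -/(h2 w) => hu.
rewrite ge_max; apply/andP; split; last by rewrite adde_ge0 // lee_fin oppr_ge0.
have [uz|un] := eqVneq u 0%R.
  have hoo : h2 w = +oo.
    by apply/eqP; rewrite -leye_eq; apply: le_trans hu; rewrite uz le0_lneNy.
  by rewrite hoo addey // leey.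
have up : (0 < u)%R by rewrite lt_def un.
have lnE : ln (r * u)%R = (ln r + ln u)%R by rewrite lnM ?posrE.
have ru : (0 < r * u)%R by rewrite mulr_gt0.
rewrite uE (lne_EFin ru) lnE EFinD oppeD //.
by rewrite -EFinN leeD2l //; move: hu; rewrite lne_EFin.
Qed.

End SegmentEnergy.

(** * Unit capacity and products of distances *)

Section CapacityPoints.
Context {R : realType}.

Lemma finite_lower_bound n (s : nat -> R) : (forall i, (i <= n)%N -> 0 < s i) ->
  exists2 c, 0 < c & forall i, (i <= n)%N -> c <= s i.
Proof.
elim: n => [|n IH] h.
  by exists (s 0%N) => [|i]; [exact: h|rewrite leqn0 => /eqP ->].
have [|c c0 hc] := IH; first by move=> i iN; apply: h; exact: leqW.
exists (Num.min c (s n.+1)); first by rewrite lt_min c0 h.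
move=> i; rewrite leq_eqVlt => /predU1P[->|iN]; first by rewrite ge_min lexx orbT.
by rewrite ge_min hc.
Qed.

Lemma closed_segs n (z : nat -> Cplx R) (r : R) : closed (segs n z r).
Proof.
rewrite /segs bigcup_mkord; apply: (@compact_closed _ _ (@norm_hausdorff _ _)).
apply: bigsetU_compact => j _.
apply: continuous_compact; last exact: segment_compact.
exact/continuous_subspaceT/continuous_seg_path.
Qed.

Lemma compact_segs n (z : nat -> Cplx R) (r : R) : compact (segs n z r).
Proof.
rewrite /segs bigcup_mkord; apply: bigsetU_compact => j _.
apply: continuous_compact; last exact: segment_compact.
exact/continuous_subspaceT/continuous_seg_path.
Qed.

Definition segs_prob n (z : nat -> Cplx R) (r : R) : set (borelC R) -> \bar R :=
  segs_measure n z r.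

HB.instance Definition _ n (z : nat -> Cplx R) (r : R) :=
  Measure.on (segs_prob n z r).

HB.instance Definition _ n (z : nat -> Cplx R) (r : R) :=
  Measure_isProbability.Build _ _ _ (segs_prob n z r) (segs_measureT n z r).

Lemma supp_segs_measure n (z : nat -> Cplx R) (r : R) :
  supp (segs_measure n z r) `<=` segs n z r.
Proof.
move=> w sw; apply: contrapT => nw.
have := sw (~` segs n z r) (closed_openC (@closed_segs n z r)) nw.
by rewrite segs_measure_out ltxx.
Qed.

Lemma segs_measure_segs n (z : nat -> Cplx R) (r : R) :
  segs_measure n z r (segs n z r) = 1%E.
Proof.
pose S : set (borelC R) := segs n z r.
have mS : measurable S by apply: measurable_closedC; exact: closed_segs.
have O : segs_measure n z r (~` S) = 0%E := segs_measure_out n z r.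
have E : segs_measure n z r (S `|` ~` S) =
    (segs_measure n z r S + segs_measure n z r (~` S))%E.
  exact: (measureU (segs_measure n z r) mS (measurableC mS) (setICr S)).
by rewrite O adde0 setUv in E; rewrite -[LHS]E; exact: segs_measureT.
Qed.

Lemma energy_ge n (z : nat -> Cplx R) (r c : R) : 0 < c ->
  (forall w, segs n z r w ->
    (c%:E <= \int[segs_measure n z r]_v lne (cabs (w - (v : Cplx R)))%:E)%E) ->
  (c%:E <= energy (segs_measure n z r))%E.
Proof.
move=> c0 h; set nu := segs_measure n z r; pose S : set (borelC R) := segs n z r.
have mS : measurable S by apply: measurable_closedC; exact: closed_segs.
(* Off the segments the potential has no lower bound; an infinite majorant of its negative part
   costs nothing on this null set. *)
apply: le_trans (@integral_lower _ _ _ nu _ (fun w => c%:E * (\1_S w)%:E)%E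
  (fun w => +oo * (\1_(~` S) w)%:E)%E _ _).
- rewrite !integral_indicZ ?lee_fin ?(ltW c0) //; last exact: measurableC.
  by rewrite segs_measure_segs segs_measure_out mule0 sube0 mule1.
- move=> w; have [Sw|nSw] := pselect (S w).
    by rewrite indicE mem_set // mule1 le_max h.
  by rewrite indicE memNset // mule0 le_max lexx orbT.
- move=> w; have [Sw|nSw] := pselect (S w).
    rewrite indicE memNset ?mule0; last by move=> /(_ Sw).
    rewrite ge_max lexx andbT oppe_le0; apply: le_trans (h w Sw).
    by rewrite lee_fin ltW.
  by rewrite indicE mem_set // mule1 leey.
Qed.

(** If all products exceeded 32 / r, the potential of the smeared points would be positive on every
    segment, the energy would be positive and the capacity larger than 1. The constant is 2^4 from
    the self-interaction term 4 ln 2, times 2 for the gap corrections. *)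
Lemma capacity_points (G : set (Cplx R)) n (z : nat -> Cplx R) (r : R) :
  log_capacity G = 1%E -> 0 < r -> r <= 1 ->
  (forall i j, (i <= n)%N -> (j <= n)%N -> i != j ->
    2 * n.+1%:R * r <= cabs (z i - z j)) ->
  segs n z r `<=` G ->
  exists2 k, (k <= n)%N & \prod_(j < n.+1 | j != k :> nat) cabs (z k - z j) <= 32 / r.
Proof.
move=> cap r0 r1 sep sG; apply: contrapT => hno.
have big k : (k <= n)%N -> 32 / r < \prod_(j < n.+1 | j != k :> nat) cabs (z k - z j).
  by move=> kn; rewrite ltNge; apply/negP => h; apply: hno; exists k.
have N0 : 0 < n.+1%:R :> R by rewrite ltr0n.
have ln20 : 0 < ln 2 :> R by rewrite ln_gt0 // ltr1n.
pose q : R := 1 - (2 * n.+1%:R)^-1.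
have q0 : 0 < q.
  rewrite /q subr_gt0 invf_lt1 ?mulr_gt0 //.
  have : 1 <= n.+1%:R :> R by rewrite ler1n.
  lra.
(* The n off-diagonal corrections cost at most a factor 2 together. *)
have qn : 1 / 2 <= q ^+ n.
  have b m : 1 - m%:R * (2 * n.+1%:R)^-1 <= q ^+ m.
    elim: m => [|m IH]; first by rewrite mul0r subr0 expr0.
    rewrite exprS; apply: le_trans (_ : q * (1 - m%:R * (2 * n.+1%:R)^-1) <= _).
      rewrite /q -natr1; set x := _^-1.
      have : 0 <= x * (m%:R * x) by rewrite !mulr_ge0 // invr_ge0 mulr_ge0.
      lra.
    by apply: ler_wpM2l => //; exact: ltW.
  apply: le_trans (b n).
  have : n%:R * (2 * n.+1%:R)^-1 <= 1 / 2 :> R.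
    rewrite ler_pdivrMr ?mulr_gt0 // mulrA divfK ?pnatr_eq0 // mul1r ler_nat.
    exact: leqnSn.
  by move: (n%:R / _) => x; lra.
have s0 i : (i <= n)%N -> 0 < (\sum_(j < n.+1) log_gap n z r i j - 4 * ln 2) / n.+1%:R.
  move=> iN; rewrite divr_gt0 // subr_gt0.
  rewrite (bigD1 (Ordinal (iN : (i < n.+1)%N))) //= {1}/log_gap eqxx.
  pose P := \prod_(j < n.+1 | j != i :> nat) cabs (z i - z j).
  have gp (j : 'I_n.+1) : j != i :> nat -> 0 < cabs (z i - z j).
    move=> ji; have := sep i j iN; rewrite -ltnS => /(_ (ltn_ord j)).
    rewrite eq_sym => /(_ ji); apply: lt_le_trans.
    by rewrite !mulr_gt0.
  have P0 : 0 < P by apply: prodr_gt0 => j; exact: gp.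
  have sumE : \sum_(j < n.+1 | j != Ordinal (iN : (i < n.+1)%N)) log_gap n z r i j =
      ln (q ^+ n * P).
    have -> : q ^+ n * P =
        \prod_(j < n.+1 | j != Ordinal (iN : (i < n.+1)%N)) (cabs (z i - z j) * q).
      rewrite big_split /= prodr_const mulrC; congr (_ * q ^+ _).
      by rewrite cardC1 card_ord.
    have : forall s : seq 'I_n.+1, 0 < \prod_(j <- s | j != Ordinal (iN : (i < n.+1)%N))
        (cabs (z i - z j) * q) /\
        \sum_(j <- s | j != Ordinal (iN : (i < n.+1)%N)) log_gap n z r i j =
        ln (\prod_(j <- s | j != Ordinal (iN : (i < n.+1)%N)) (cabs (z i - z j) * q)).
      elim=> [|j s [IH1 IH2]]; first by rewrite !big_nil ln1.
      rewrite !big_cons; case: ifPn => // ji.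
      have p0 : 0 < cabs (z i - z j) * q by rewrite mulr_gt0 ?gp.
      split; first by rewrite mulr_gt0.
      have ji' : (j == i :> nat) = false by exact: negbTE.
      by rewrite IH2 lnM ?posrE // /log_gap ji'.
    by move=> /(_ (index_enum _))[].
  have qn0 : 0 < q ^+ n by rewrite exprn_gt0.
  have qP : 0 < q ^+ n * P by rewrite mulr_gt0.
  rewrite sumE -lnM ?posrE // mulr_natl -lnXn // ltr_ln ?posrE ?mulr_gt0 //.
  have h1 : 32 < P * r by rewrite -ltr_pdivrMr //; exact: big.
  have h2 : 1 / 2 * P <= q ^+ n * P by apply: ler_wpM2r => //; exact: ltW.
  have h3 : r * (1 / 2 * P) <= r * (q ^+ n * P) by apply: ler_wpM2l => //; exact: ltW.
  apply: lt_le_trans h3; rewrite !exprS expr0; lra.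

(* A common positive bound over the finitely many segments gives strict positivity of the energy. *)
have [c c0 hc] := finite_lower_bound s0.
have en : (c%:E <= energy (segs_measure n z r))%E.
  apply: energy_ge => // w [j jn [t t01 <-]].
  rewrite /= ltnS in jn.
  apply: le_trans (segs_potential_ge r0 r1 sep jn t01).
  by rewrite lee_fin; exact: hc.
have : (expeR (energy (segs_measure n z r)) <= log_capacity G)%E.
  apply: ereal_sup_ubound; exists (segs_prob n z r : probability _ _) => //.
  split; last exact: subset_trans (@supp_segs_measure n z r) sG.
  by apply: (subclosed_compact _ (@compact_segs n z r)); [exact: closed_supp|exact: supp_segs_measure].
rewrite cap leNgt => /negP; apply.
apply: lt_le_trans (_ : expeR c%:E <= _)%E; last by rewrite lee_expeR.
by rewrite /= lte_fin expR_gt1.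
Qed.

End CapacityPoints.

(** * Continua and nets in the region *)

Section Skeleton.
Context {R : realType} (G : set (Cplx R)).
Hypotheses (oG : open G) (cG : connected G).

Lemma open_cplx_ball z : G z -> exists2 e : R, 0 < e & forall w, cabs (w - z) < e -> G w.
Proof. by move=> Gz; apply/nbhs_cplxP; exact: (open_nbhs_nbhs (conj oG Gz)). Qed.

(** The points that a continuum in [G] joins to [p] form a set that is open and relatively closed in
    [G]: segments inside small disks extend continua. *)
Lemma open_connected_continuum p q : G p -> G q ->
  exists K : set (Cplx R), [/\ compact K, connected K, K `<=` G, K p & K q].
Proof.
move=> Gp.
pose S : set (Cplx R) :=
  [set y | exists K : set (Cplx R), [/\ compact K, connected K, K `<=` G, K p & K y]].
have SG y : S y -> G y by case=> K [_ _ KG _ Ky]; exact: KG.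
have step y w e : (forall u, cabs (u - y) < e -> G u) -> cabs (w - y) < e -> S y -> S w.
  move=> he wy [K [cK coK KG Kp Ky]]; exists (K `|` segment y w); split.
  - by apply: compactU => //; exact: compact_seg.
  - apply: connectedU => //; last exact: connected_seg.
    by exists y; split => //; exact: segment_l.
  - by move=> u [/KG//|/segment_ball uy]; apply: he; exact: le_lt_trans wy.
  - by left.
  - by right; exact: segment_r.
have oS : open S.
  rewrite openE => y Sy; have [e e0 he] := open_cplx_ball (SG _ Sy).
  apply/nbhs_cplxP; exists e => // w wy; exact: step he wy Sy.
have oT : open (G `\` S).
  rewrite openE => y [Gy nSy]; have [e e0 he] := open_cplx_ball Gy.
  apply/nbhs_cplxP; exists (e / 2); first lra.
  move=> w wy; split; first by apply: he; lra.
  move=> Sw; apply: nSy; apply: (step w y (e / 2)) Sw; last by rewrite cabsBC.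
  by move=> u uw; apply: he; have := cabs_triangle w u y; lra.
have SE : S = G.
  apply: cG.
  - exists p; exists [set p]; split => //; first exact: compact_set1.
      exact: connected1.
    by move=> _ ->.
  - by exists S => //; apply/esym/setIidr => y; exact: SG.
  - exists (~` (G `\` S)); first exact: open_closedC.
    apply/seteqP; split => [y Sy|y [Gy h]]; first by split; [exact: SG|case].
    by apply: contrapT => nSy; apply: h.
by rewrite -{1}SE.
Qed.

(** Disks of radius [eta] centred in [G] cover the compact closure; finitely many of the centres are
    joined to [p] by continua, whose union is K. *)
Lemma open_connected_skeleton p q (eta : R) : compact (closure G) -> G p -> G q -> 0 < eta ->
  exists K : set (Cplx R), [/\ compact K, connected K, K `<=` G, K p & K q] /\
    forall z, closure G z -> exists2 y, K y & cabs (y - z) < eta.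
Proof.
move=> cclG Gp Gq eta0.
have fin (s : seq (Cplx R)) : (forall y, y \in s -> G y) ->
    exists K : set (Cplx R), [/\ compact K, connected K, K `<=` G, K p & K q] /\
    forall y, y \in s -> K y.
  elim: s => [_|x s IH sG].
    by have [K] := open_connected_continuum Gp Gq; exists K.
  have [|K [[cK coK KG Kp Kq] Ks]] := IH; first by move=> y ys; apply: sG; rewrite inE ys orbT.
  have [|K' [cK' coK' KG' Kp' Kx]] := @open_connected_continuum p x Gp.
    by apply: sG; exact: mem_head.
  exists (K `|` K'); split.
    split; [exact: compactU| |by move=> y []; [exact: KG|exact: KG']|by left|by left].
    by apply: connectedU => //; exists p.
  by move=> y; rewrite inE => /predU1P[->|/Ks]; [right|left].
have cov : cover_compact (closure G) by rewrite -compact_cover.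
move: cov => /(_ _ G (fun c => [set y : Cplx R | cabs (y - c) < eta])).
case=> [c _|z /closure_cplxP/(_ _ eta0)[c Gc cz]|D DG Dcov]; first exact: open_cball.
  by exists c => //=; rewrite cabsBC.
have [|K [KK Ks]] := fin (finmap.enum_fset D); first by move=> y /DG /set_mem.
by exists K; split => // z /Dcov[c /= cD cz]; exists c; [exact: Ks|rewrite cabsBC].
Qed.

Lemma compact_open_margin (K : set (Cplx R)) : compact K -> K `<=` G ->
  exists2 d : R, 0 < d & forall y w, K y -> cabs (w - y) < d -> G w.
Proof.
move=> cK KG.
pose D := [set ce : Cplx R * R | 0 < ce.2 /\ forall w, cabs (w - ce.1) < 2 * ce.2 -> G w].
have cov : cover_compact K by rewrite -compact_cover.
move: cov => /(_ _ D (fun ce => [set y | cabs (y - ce.1) < ce.2])).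
case=> [ce _|y Ky|E ED Ecov]; first exact: open_cball.
  have [e e0 he] := open_cplx_ball (KG _ Ky); exists (y, e / 2).
    by split=> /= [|w wy]; [lra|apply: he; lra].
  by rewrite /= subrr cabs0; lra.
have [d d0 hd] : exists2 d : R, 0 < d & forall ce, ce \in finmap.enum_fset E -> d <= ce.2.
  have : forall ce, ce \in finmap.enum_fset E -> 0 < ce.2 by move=> ce /ED/set_mem[].
  elim: (finmap.enum_fset E) => [_|c s IH h]; first by exists 1.
  have [|d d0 hd] := IH; first by move=> ce cs; apply: h; rewrite inE cs orbT.
  exists (Num.min d c.2); first by rewrite lt_min d0 h ?mem_head.
  move=> ce; rewrite inE => /predU1P[->|/hd h2]; first by rewrite ge_min lexx orbT.
  by rewrite ge_min h2.
exists d => // y w Ky wy; have [ce /= cE yc] := Ecov _ Ky.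
have [_ h] := set_mem (ED _ cE); apply: h.
have := hd _ cE; have := cabs_triangle y w ce.1; move: wy yc.
by move: (cabs _) (cabs _) (cabs _) (ce.2) => *; lra.
Qed.

End Skeleton.

Section Nets.
Context {R : realType}.

Lemma continuum_distance (K : set (Cplx R)) (z u v : Cplx R) (t : R) : connected K ->
  K u -> K v -> cabs (u - z) <= t <= cabs (v - z) -> exists2 x, K x & cabs (x - z) = t.
Proof.
move=> cK Ku Kv tuv.
have cf : continuous (fun x : Cplx R => cabs (x - z)).
  apply: continuous_lip1 => x y; rewrite ler_norml.
  have := cabs_triangle y x z; have := cabs_triangle x y z; rewrite (cabsBC y x).
  by move: (cabs _) (cabs _) (cabs _) => *; lra.
have : is_interval ((fun x => cabs (x - z)) @` K).
  apply/connected_intervalP/connected_continuous_connected => //.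
  exact: continuous_subspaceT.
move=> /(_ _ _ _ _ t tuv)[||x Kx xt]; [by exists u|by exists v|].
by exists x.
Qed.

(** Greedy selection from a finite net of mesh h: a discarded point is within h of a kept one, hence
    the distance 2h. *)
Lemma separated_net (K : set (Cplx R)) (h : R) : compact K -> 0 < h ->
  exists X : seq (Cplx R), [/\ forall x, x \in X -> K x,
    {in X &, forall x y, x != y -> h <= cabs (x - y)}, uniq X &
    forall y, K y -> exists2 x, x \in X & cabs (x - y) <= 2 * h].
Proof.
move=> cK h0; have cov : cover_compact K by rewrite -compact_cover.
move: cov => /(_ _ K (fun c => [set y : Cplx R | cabs (y - c) < h])).
case=> [c _|y Ky|D DK Dcov]; first exact: open_cball.
  by exists y => //=; rewrite subrr cabs0.
have [X [X1 X2 X3 X4]] : exists X : seq (Cplx R),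
    [/\ forall x, x \in X -> K x, {in X &, forall x y, x != y -> h <= cabs (x - y)}, uniq X &
    forall c, c \in finmap.enum_fset D -> exists2 x, x \in X & cabs (x - c) < h].
  have : forall c, c \in finmap.enum_fset D -> K c by move=> c /DK/set_mem.
  elim: (finmap.enum_fset D) => [_|c s IH sK]; first by exists [::].
  have [|X [X1 X2 X3 X4]] := IH; first by move=> y ys; apply: sK; rewrite inE ys orbT.
  have [[x xX xc]|nx] := pselect (exists2 x, x \in X & cabs (x - c) < h).
    exists X; split => // y; rewrite inE => /predU1P[->|/X4//]; by exists x.
  have far x : x \in X -> h <= cabs (x - c).
    by move=> xX; rewrite leNgt; apply/negP => xc; apply: nx; exists x.
  exists (c :: X); split.
  - by move=> x; rewrite inE => /predU1P[->|/X1//]; apply: sK; exact: mem_head.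
  - move=> x y; rewrite !inE => /predU1P[->|xX] /predU1P[->|yX].
    + by rewrite eqxx.
    + by rewrite cabsBC far.
    + by rewrite far.
    + exact: X2.
  - rewrite /= X3 andbT; apply/negP => /far.
    by rewrite subrr cabs0 leNgt h0.
  - move=> y; rewrite inE => /predU1P[->|/X4[x xX xy]].
      by exists c; rewrite ?mem_head // subrr cabs0.
    by exists x => //; rewrite inE xX orbT.
exists X; split => // y /Dcov[c /= cD yc]; have [x xX xc] := X4 _ cD.
exists x => //; have := cabs_triangle c x y; rewrite (cabsBC c).
by move: (cabs _) (cabs _) (cabs _) yc xc => *; lra.
Qed.

End Nets.

(** * Fekete points and Lagrange interpolation *)

Section Fekete.
Context {R : realType}.

(* A maximizer of the product of all mutual distances; removing one of its
   points leaves the zeros of a polynomial that is largest, on [X], at the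
   removed point. *)
Lemma fekete_points (X : seq (Cplx R)) n : uniq X -> (n < size X)%N ->
  exists z : nat -> Cplx R, [/\ forall i, (i <= n)%N -> z i \in X,
    forall i j, (i <= n)%N -> (j <= n)%N -> i != j -> z i != z j &
    forall k x, (k <= n)%N -> x \in X ->
      \prod_(j < n.+1 | j != k :> nat) cabs (x - z j) <=
      \prod_(j < n.+1 | j != k :> nat) cabs (z k - z j)].
Proof.
move=> uX nX; pose T := 'I_(size X); pose pt (t : T) := nth 0 X t.
pose P (f : {ffun 'I_n.+1 -> T}) (k : 'I_n.+1) y := \prod_(j | j != k) cabs (y - pt (f j)).
pose Phi f := \prod_k P f k (pt (f k)).
pose rest (f : {ffun 'I_n.+1 -> T}) (k : 'I_n.+1) := \prod_(i | i != k)
  \prod_(j | (j != i) && (j != k)) cabs (pt (f i) - pt (f j)).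
(* [Phi] runs over ordered pairs, so the distances from the k-th point occur twice, and [rest f k]
   does not involve that point. *)
have PhiE f k : Phi f = P f k (pt (f k)) ^+ 2 * rest f k.
  rewrite /Phi (bigD1 k) //= expr2 -mulrA; congr (_ * _).
  rewrite -big_split /=; apply: eq_bigr => i ik.
  by rewrite /P (bigD1 k) 1?eq_sym //= cabsBC.
pose f0 : {ffun 'I_n.+1 -> T} := [ffun i => widen_ord nX i].
have pt_inj : injective pt.
  by move=> s t /eqP; rewrite /pt nth_uniq // => /eqP; exact: val_inj.
(* There are enough points for a distinct choice, so the maximum is positive and the maximizer has
   distinct entries. *)
have Phi0 : 0 < Phi f0.
  apply: prodr_gt0 => i _; apply: prodr_gt0 => j ji.
  rewrite cabs_gt0 subr_eq0 !ffunE (inj_eq pt_inj) -val_eqE /= eq_sym.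
  by rewrite val_eqE.
have [f _ fmax] := @arg_maxP _ _ _ f0 predT Phi isT.
have Phif : 0 < Phi f by apply: lt_le_trans Phi0 (fmax f0 isT).
have P0 k y : 0 <= P f k y by apply: prodr_ge0 => j _; exact: cabs_ge0.
have r0 k : 0 <= rest f k.
  by apply: prodr_ge0 => i _; apply: prodr_ge0 => j _; exact: cabs_ge0.
have Pf k : 0 < P f k (pt (f k)).
  rewrite lt_def P0 andbT; apply/eqP => h; move: Phif.
  by rewrite (PhiE f k) h expr0n mul0r ltxx.
have rf k : 0 < rest f k.
  rewrite lt_def r0 andbT; apply/eqP => h; move: Phif.
  by rewrite (PhiE f k) h mulr0 ltxx.
have Pmax k t : P f k (pt t) <= P f k (pt (f k)).
  pose f' : {ffun 'I_n.+1 -> T} := [ffun j => if j == k then t else f j].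
  have : Phi f' <= Phi f := fmax f' isT.
  rewrite (PhiE f k) (PhiE f' k).
  have -> : rest f' k = rest f k.
    apply: eq_bigr => i /negbTE ik; apply: eq_bigr => j /andP[_ /negbTE jk].
    by rewrite !ffunE ik jk.
  have -> : P f' k (pt (f' k)) = P f k (pt t).
    rewrite {2}/f' ffunE eqxx; apply: eq_bigr => j /negbTE jk.
    by rewrite ffunE jk.
  by rewrite ler_pM2r // ler_pXn2r ?nnegrE.
have f_inj i j : i != j -> pt (f i) != pt (f j).
  move=> ij; rewrite -subr_eq0 -cabs_gt0 lt_def cabs_ge0 andbT; apply/eqP => h.
  by have := Pf i; rewrite /P (bigD1 j) 1?eq_sym //= h mul0r ltxx.
exists (fun i => pt (f (inord i))); split=> [i _|i j iN jN ij|k x kN xX].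
- by rewrite mem_nth.
- by apply: f_inj; rewrite -val_eqE /= !inordK.
- have E y : \prod_(j < n.+1 | j != k :> nat) cabs (y - pt (f (inord j))) =
      P f (inord k) y.
    apply: eq_big => j; first by rewrite -val_eqE /= inordK.
    by rewrite inord_val.
  have xt : (index x X < size X)%N by rewrite index_mem.
  have -> : x = pt (Ordinal xt) by rewrite /pt nth_index.
  by rewrite !E.
Qed.

(** The segments of [capacity_points] start at the Fekete points and have length r = h / (2 (n+1)),
    the largest that its separation condition guarantees; then 32 / r is the stated bound. *)
Lemma fekete_polynomial (G : set (Cplx R)) (X : seq (Cplx R)) n (h : R) :
  log_capacity G = 1%E -> 0 < h -> h <= 2 * n.+1%:R -> uniq X -> (n < size X)%N ->
  {in X &, forall x y, x != y -> h <= cabs (x - y)} ->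
  (forall x w, x \in X -> cabs (w - x) <= h / (2 * n.+1%:R) -> G w) ->
  exists Q : {poly Cplx R}, [/\ Q \is monic, size Q = n.+1 &
    forall x, x \in X -> cabs Q.[x] <= 64 * n.+1%:R / h].
Proof.
move=> cap h0 hn uX nX sep XG; have [z [zX zne zmax]] := fekete_points uX nX.
have N0 : 0 < n.+1%:R :> R by rewrite ltr0n.
pose r := h / (2 * n.+1%:R).
have r0 : 0 < r by rewrite divr_gt0 // mulr_gt0.
have r1 : r <= 1 by rewrite ler_pdivrMr ?mulr_gt0 // mul1r.
have rE : 2 * n.+1%:R * r = h by rewrite /r; field; rewrite gt_eqF.
have [k kn hk] : exists2 k, (k <= n)%N &
    \prod_(j < n.+1 | j != k :> nat) cabs (z k - z j) <= 32 / r.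
  apply: (capacity_points cap r0 r1) => [i j iN jN ij|w].
    by rewrite rE; apply: sep; [exact: zX|exact: zX|exact: zne].
  move=> [j /= jn [t]]; rewrite /= in_itv /= => /andP[t0 t1] <-.
  apply: (XG (z j)); first exact: zX.
  have tr0 := mulr_ge0 t0 (ltW r0).
  rewrite /seg_path addrAC subrr add0r -rcM cabs_rc (ger0_norm tr0).
  by apply: ler_piMl t1; exact: ltW.
pose Q : {poly Cplx R} := \prod_(j < n.+1 | j != k :> nat) ('X - (z j)%:P).
exists Q; split.
- by apply: monic_prod => j _; exact: monicXsubC.
- rewrite size_prod => [|j _]; last by rewrite polyXsubC_eq0.
  rewrite (eq_bigr (fun=> (2 * 1)%N)) => [|j _]; last by rewrite size_XsubC.
  rewrite -big_distrr /= sum1_card.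
  rewrite (eq_card (B := predC1 (inord k : 'I_n.+1))) => [|j]; last first.
    by rewrite !inE -val_eqE /= inordK.
  by rewrite cardC1 card_ord /= mul2n -addnn -addSn addnK.
- move=> x xX; rewrite horner_prod cabs_prod.
  rewrite (eq_bigr (fun j : 'I_n.+1 => cabs (x - z j))) => [|j _]; last by rewrite hornerXsubC.
  apply: le_trans (zmax k x kn xX) _; apply: le_trans hk _.
  by rewrite le_eqVlt; apply/orP; left; apply/eqP; rewrite /r; field; rewrite !gt_eqF.
Qed.

Lemma lagrange_bound (Q : {poly Cplx R}) n (x : nat -> Cplx R) (B : R) y :
  (size Q <= n.+1)%N ->
  (forall i j, (i <= n)%N -> (j <= n)%N -> i != j -> x i != x j) ->
  (forall i, (i <= n)%N -> cabs Q.[x i] <= B) ->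
  cabs Q.[y] <= \sum_(i < n.+1) B * \prod_(k < n.+1 | k != i) (cabs (y - x k) / cabs (x i - x k)).
Proof.
move=> sQ xne QB.
pose l (i : 'I_n.+1) : {poly Cplx R} := \prod_(k < n.+1 | k != i) ((x i - x k)^-1 *: ('X - (x k)%:P)).
have lE i u : (l i).[u] = \prod_(k < n.+1 | k != i) ((x i - x k)^-1 * (u - x k)).
  by rewrite horner_prod; apply: eq_bigr => k _; rewrite hornerZ hornerXsubC.
have lii i : (l i).[x i] = 1.
  rewrite lE big1 // => k ki; apply: mulVf; rewrite subr_eq0.
  by apply: xne; rewrite ?leq_ord // eq_sym.
have lij i j : j != i -> (l i).[x j] = 0.
  by move=> ji; rewrite lE (bigD1 j) //= subrr mulr0 mul0r.
pose L := \sum_(i < n.+1) Q.[x i] *: l i.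
have sl i : (size (l i) <= n.+1)%N.
  apply: leq_trans (size_prod_leq _ _) _ => /=.
  rewrite (@leq_trans ((\sum_(k < n.+1 | k != i) 2).+1 - #|[pred k | k != i]|)%N) //.
    apply: leq_sub2r; rewrite ltnS; apply: leq_sum => k _.
    by apply: leq_trans (size_scale_leq _ _) _; rewrite size_XsubC.
  by rewrite sum_nat_const cardC1 card_ord /= muln2 -addnn -addSn addnK.
have sL : (size L <= n.+1)%N.
  apply: leq_trans (size_sum _ _ _) _; apply/bigmax_leqP => i _.
  exact: leq_trans (size_scale_leq _ _) _.
have QL : Q = L.
  apply/eqP; rewrite -subr_eq0; apply/negPn/negP => nz.
  have := @max_poly_roots _ (Q - L) [seq x (i : 'I_n.+1) | i <- enum 'I_n.+1] nz.
  rewrite size_map size_enum_ord => /(_ _ _) h.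
  have : (n.+1 < size (Q - L)%R)%N.
    apply: h.
      apply/allP => _ /mapP[j _ ->]; apply/rootP; rewrite hornerD hornerN.
      rewrite /L horner_sum (bigD1 j) //= big1 => [|i ij]; last first.
        by rewrite hornerZ lij 1?eq_sym // mulr0.
      by rewrite hornerZ lii mulr1 addr0 subrr.
    rewrite map_inj_in_uniq ?enum_uniq // => i j _ _ xij.
    apply/eqP; apply: contraT => ij; have := xne i j (leq_ord i) (leq_ord j).
    by rewrite val_eqE ij xij eqxx => /(_ isT).
  by rewrite ltnNge (leq_trans (size_polyD _ _)) // size_polyN geq_max sQ sL.
rewrite {1}QL /L horner_sum; apply: le_trans (cabs_sum _ _ _) _.
apply: ler_sum => i _; rewrite hornerZ cabsM lE cabs_prod.
rewrite [X in _ * X](eq_bigr (fun k : 'I_n.+1 => cabs (y - x k) / cabs (x i - x k))); last first.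
  by move=> k _; rewrite cabsM cabsV mulrC.
apply: ler_wpM2r; last exact: QB (leq_ord i).
by apply: prodr_ge0 => k _; rewrite divr_ge0 ?cabs_ge0.
Qed.

End Fekete.

(** * Products over quadratically spaced nodes *)

Section NodeProducts.

(** Each factor splits as (i+1-k)(i+1+k), and both runs are quotients of factorials. *)
Lemma prod_sqr_lt_fact i j : (j <= i.+1)%N ->
  ((\prod_(k < j) (i.+1 ^ 2 - k ^ 2)) * (i.+1 - j)`! * i`! = i.+1`! * (i + j)`!)%N.
Proof.
elim: j => [|j IH] ji; first by rewrite big_ord0 mul1n subn0 addn0.
rewrite big_ord_recr /= subSS addnS (factS (i + j)) [RHS]mulnCA -(IH (ltnW ji)).
rewrite subSn // factS.
have -> : (i.+1 ^ 2 - j ^ 2 = (i - j).+1 * (i + j).+1)%N by nia.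
by move: (\prod_(_ < _) _)%N => p; ring.
Qed.

(** This is |k^2 - i^2| in truncated subtraction, with the value 1 on the diagonal so that products
    may range over all k. *)
Definition sqr_gap i k : nat := if k == i then 1%N else ((k ^ 2 - i ^ 2) + (i ^ 2 - k ^ 2))%N.
Arguments sqr_gap : simpl never.

(** With I = i+1 and n = I + d, this is the classical node product (n - I)! (n + I)! / 2. For I = 0
    the value is n!^2, treated apart in [prod_sqr_gap_ge]. *)
Lemma prod_sqr_gap i d : (2 * \prod_(k < (i.+1 + d).+1) sqr_gap i.+1 k = d`! * (i.+1 + d + i.+1)`!)%N.
Proof.
elim: d => [|d IH].
  rewrite addn0 big_ord_recr /= /sqr_gap eqxx muln1 fact0 mul1n.
  rewrite (eq_bigr (fun k : 'I_i.+1 => (i.+1 ^ 2 - k ^ 2)%N)) => [|k _]; last first.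
    rewrite ltn_eqF //; have -> : (k ^ 2 - i.+1 ^ 2 = 0)%N by apply/eqP; rewrite subn_eq0 leq_sqr ltnW.
    by rewrite add0n.
  have := prod_sqr_lt_fact (leqnn i.+1); rewrite subnn fact0 muln1 => h.
  apply/eqP; rewrite -(eqn_pmul2r (fact_gt0 i)) -mulnA h addSn (factS i) (factS (i + _)).
  by apply/eqP; move: (i`!) ((i + _)`!) => u v; nia.
have [N NE] : exists N, N = (i.+1 + d)%N by exists (i.+1 + d)%N.
rewrite -NE in IH; rewrite (addnS i.+1 d) -NE.
rewrite big_ord_recr /= [LHS]mulnA IH /sqr_gap gtn_eqF; last by rewrite NE; lia.
have -> : (N.+1 ^ 2 - i.+1 ^ 2 + (i.+1 ^ 2 - N.+1 ^ 2) = d.+1 * (N + i.+1).+1)%N by nia.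
by rewrite addSn !factS; ring.
Qed.

Lemma fact_sqr_le n i : (i <= n)%N -> (n`! ^ 2 <= (n - i)`! * (n + i)`!)%N.
Proof.
elim: i => [|i IH] ni; first by rewrite subn0 addn0 expnS expn1.
apply: leq_trans (IH (ltnW ni)) _.
rewrite addnS (factS (n + i)) -(subnSK ni) factS [leqRHS]mulnCA -[leqLHS]mulnA.
by rewrite leq_mul // ltnS; lia.
Qed.

Lemma prod_sqr_gap_ge n i : (i <= n)%N -> (n`! ^ 2 <= 2 * \prod_(k < n.+1) sqr_gap i k)%N.
Proof.
case: i => [_|i ni].
  suff -> : (\prod_(k < n.+1) sqr_gap 0 k = n`! ^ 2)%N by rewrite leq_pmull.
  elim: n => [|n IH]; first by rewrite big_ord_recr big_ord0.
  rewrite big_ord_recr /= IH /sqr_gap /= subn0 sub0n addn0 factS expnMn mulnC //.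
apply: leq_trans (fact_sqr_le ni) _.
by move: (n - i.+1)%N (subnKC ni) => d <-; rewrite prod_sqr_gap.
Qed.

Lemma prod_sqr_sum_le n m : ((\prod_(k < n.+1) (k ^ 2 + m ^ 2)) * m`! ^ 2 <= m ^ 2 * (n + m)`! ^ 2)%N.
Proof.
elim: n => [|n IH]; first by rewrite big_ord_recr big_ord0 /= mul1n add0n.
rewrite big_ord_recr /= addSn factS expnMn mulnAC mulnCA [leqRHS]mulnC [leqRHS]mulnC.
rewrite mulnC; apply: leq_mul => //.
by nia.
Qed.

(** Bounding k^2 + m^2 by (k + m)^2 and the denominators from below by n!^2 / 2, the factorials
    combine to the square of (n + m)! / (m! n!). *)
Lemma node_product_bound {R : realType} n m i : (i <= n)%N -> (0 < m)%N ->
  \prod_(k < n.+1 | k != i :> nat) ((k ^ 2 + m ^ 2)%:R / (sqr_gap i k)%:R) <=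
  2 * m%:R ^+ 2 * 'C(n + m, m)%:R ^+ 2 :> R.
Proof.
move=> iN m0.
have g0 k : (0 < sqr_gap i k)%N.
  by rewrite /sqr_gap; case: (ltngtP k i) => // h; nia.
rewrite big_split /= -natr_prod.
have -> : \prod_(k < n.+1 | k != i :> nat) ((sqr_gap i k)%:R^-1 : R) =
    ((\prod_(k < n.+1) sqr_gap i k)%:R)^-1.
  rewrite prodfV -natr_prod; congr (_%:R^-1).
  rewrite [RHS](bigD1 (Ordinal (iN : (i < n.+1)%N))) //= {2}/sqr_gap eqxx mul1n.
  by apply: eq_bigl => k; rewrite -val_eqE.
have G0 : (0 < \prod_(k < n.+1) sqr_gap i k)%N by rewrite prodn_gt0.
have h1 : (\prod_(k < n.+1 | k != i :> nat) (k ^ 2 + m ^ 2) <= \prod_(k < n.+1) (k ^ 2 + m ^ 2))%N.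
  rewrite [leqRHS](bigID (fun k : 'I_n.+1 => k != i :> nat)) /=.
  by rewrite leq_pmulr // prodn_gt0 // => k; nia.
have h2 := prod_sqr_sum_le n m.
have h3 := prod_sqr_gap_ge iN.
have h4 : ('C(n + m, m) * (m`! * n`!) = (n + m)`!)%N by rewrite -(@bin_fact (n + m) m) ?leq_addl // addnK.
rewrite ler_pdivrMr ?ltr0n // -!natrX -!natrM ler_nat.
apply: leq_trans h1 _.
have f0 : (0 < m`! ^ 2)%N by rewrite expn_gt0 fact_gt0.
rewrite -(leq_pmul2r f0); apply: leq_trans h2 _.
move: h3; rewrite -h4 !expnMn; move: (\prod_(_ < _) _)%N ('C(_, _) ^ 2)%N (m`! ^ 2)%N (n`! ^ 2)%N (m ^ 2)%N.
move=> r b u v w h3.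
rewrite (_ : 2 * w * b * r * u = w * (b * (u * (2 * r))))%N; last by ring.
by rewrite !leq_mul.
Qed.

End NodeProducts.

Section NodeQuotients.
Context {R : realType}.

Lemma natr_sqr_gap i k : k != i -> (sqr_gap i k)%:R = `|(k ^ 2)%:R - (i ^ 2)%:R| :> R.
Proof.
move=> /negbTE ki; rewrite /sqr_gap ki natrD; case: (leqP k i) => h.
  have hs : (k ^ 2 <= i ^ 2)%N by rewrite leq_sqr.
  by rewrite (eqP hs) add0r natrB // distrC ger0_norm // subr_ge0 ler_nat.
have hs : (i ^ 2 <= k ^ 2)%N by rewrite leq_sqr ltnW.
by rewrite (eqP hs) addr0 natrB // ger0_norm // subr_ge0 ler_nat.
Qed.

(** Since (1 + e)(1 - 3e) <= 1 - 2e, the quotient is at most 1 / (1 - 3e), and (1 - 3e)^n >= 1 - 3 n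
    e >= 1/4. *)
Lemma perturbation_exp (e : R) n : e = (4 * n.+1%:R)^-1 ->
  ((1 + e) / (1 - 2 * e)) ^+ n <= 4.
Proof.
move=> eE; have N1 : 1 <= n.+1%:R :> R by rewrite ler1n.
have N0 : 0 < n.+1%:R :> R by rewrite ltr0n.
have e0 : 0 < e by rewrite eE invr_gt0 mulr_gt0.
have eN : e * n.+1%:R = 1 / 4 by rewrite eE; field; rewrite gt_eqF.
have e4 : e <= 1 / 4.
  by rewrite -eN -[X in X <= _]mulr1; apply: ler_wpM2l => //; exact: ltW.
have c0 : 0 <= (1 + e) / (1 - 2 * e) by rewrite divr_ge0 //; lra.
have h k : 1 - k%:R * (3 * e) <= (1 - 3 * e) ^+ k.
  elim: k => [|k IH]; first by rewrite mul0r subr0 expr0.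
  rewrite exprS; apply: le_trans (_ : (1 - 3 * e) * (1 - k%:R * (3 * e)) <= _).
    rewrite -natr1; have : 0 <= 3 * e * (k%:R * (3 * e)) by rewrite !mulr_ge0 // ltW.
    lra.
  by apply: ler_wpM2l => //; lra.
have h4 : 1 / 4 <= (1 - 3 * e) ^+ n.
  apply: le_trans (h n); move: eN; rewrite -natr1 => eN.
  have -> : n%:R * (3 * e) = 3 * (e * (n%:R + 1)) - 3 * e by ring.
  rewrite eN; lra.
have h5 : ((1 + e) / (1 - 2 * e)) * (1 - 3 * e) <= 1.
  rewrite mulrAC ler_pdivrMr; last lra.
  rewrite mul1r; have : 0 <= e * e by rewrite mulr_ge0 // ltW.
  have := ltW e0; move=> e00; lra.
have h6 : ((1 + e) / (1 - 2 * e)) ^+ n * (1 - 3 * e) ^+ n <= 1.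
  rewrite -exprMn; apply: exprn_ile1 => //; rewrite mulr_ge0 //; lra.
have h7 := ler_wpM2l (exprn_ge0 n c0) h4.
have h8 := le_trans h7 h6; lra.
Qed.

(** The nodes may lie in any directions from y: distances between them are bounded below by
    differences of distances to y. As k^2 + m^2 and |k^2 - i^2| are at least 1, the error changes
    each quotient by a factor of at most (1 + e) / (1 - 2e), and [perturbation_exp] bounds the
    accumulated factor by 4. *)
Lemma node_quotient_bound n m (s : R) (x : nat -> Cplx R) y i :
  0 < s -> (0 < m)%N ->
  (forall k, (k <= n)%N ->
    `|cabs (x k - y) - s * (k ^ 2 + m ^ 2)%:R| <= s * (4 * n.+1%:R)^-1) ->
  (i <= n)%N ->
  (forall k, (k <= n)%N -> k != i -> x i != x k) /\
  \prod_(k < n.+1 | k != i :> nat) (cabs (y - x k) / cabs (x i - x k)) <=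
  8 * m%:R ^+ 2 * 'C(n + m, m)%:R ^+ 2.
Proof.
move=> s0 m0 hx iN.
have cn := @perturbation_exp _ n erefl.
have e0 : 0 < (4 * n.+1%:R)^-1 :> R by rewrite invr_gt0 mulr_gt0 // ltr0n.
have e4 : (4 * n.+1%:R)^-1 <= 1 / 4 :> R.
  rewrite mul1r lef_pV2 ?posrE ?mulr_gt0 ?ltr0n //.
  have : 1 <= n.+1%:R :> R by rewrite ler1n.
  lra.
move: ((4 * n.+1%:R)^-1 : R) e0 e4 cn hx => e e0 e4 cn hx.
have q1 k : 1 <= (k ^ 2 + m ^ 2)%:R :> R by rewrite ler1n addn_gt0 orbC expn_gt0 m0.
have g1 k : k != i -> 1 <= (sqr_gap i k)%:R :> R.
  by rewrite ler1n /sqr_gap => /negbTE ki; rewrite ki; case: (ltngtP k i) ki => // h _; nia.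
have den k : (k <= n)%N -> k != i -> s * (1 - 2 * e) * (sqr_gap i k)%:R <= cabs (x i - x k).
  move=> kN ki; have h1 := hx k kN; have h2 := hx i iN.
  have := cabs_triangle (x k) (x i) y; have := cabs_triangle (x i) (x k) y.
  have gE := natr_sqr_gap ki; have := g1 k ki; rewrite gE.
  move: h1 h2; rewrite (cabsBC (x k) (x i)) !natrD.
  move: (cabs (x i - x k)) (cabs (x k - y)) (cabs (x i - y)) => A B C.
  move: ((k ^ 2)%:R : R) ((i ^ 2)%:R : R) ((m ^ 2)%:R : R) => k2 i2 m2.
  rewrite !ler_distl => /andP[h1 h2] /andP[h3 h4] g t1 t2.
  have h5 : s * e * 1 <= s * e * `|k2 - i2| by apply: ler_wpM2l => //; rewrite mulr_ge0 ?ltW.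
  have h6 : s * `|k2 - i2| <= A + 2 * (s * e).
    case: (ltrP (k2 - i2) 0) => h; [rewrite ltr0_norm //|rewrite ger0_norm //]; lra.
  lra.
have num k : (k <= n)%N -> cabs (y - x k) <= s * (1 + e) * (k ^ 2 + m ^ 2)%:R.
  move=> kN; have := hx k kN; rewrite (cabsBC y) ler_distl => /andP[_ h].
  have : s * e * 1 <= s * e * (k ^ 2 + m ^ 2)%:R.
    by apply: ler_wpM2l => //; rewrite mulr_ge0 ?ltW.
  by move: (_%:R : R) (cabs _) h => q A h1 h2; lra.
have den0 k : (k <= n)%N -> k != i -> 0 < cabs (x i - x k).
  move=> kN ki; apply: lt_le_trans (den k kN ki).
  by rewrite !mulr_gt0 //; [lra|exact: lt_le_trans (g1 k ki)].
split=> [k kN ki|].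
  by have := den0 k kN ki; rewrite cabs_gt0 subr_eq0.
pose c := (1 + e) / (1 - 2 * e).
have c0 : 0 <= c by rewrite divr_ge0 //; lra.
apply: le_trans (_ : \prod_(k < n.+1 | k != i :> nat)
   ((k ^ 2 + m ^ 2)%:R / (sqr_gap i k)%:R * c) <= _).
  apply: ler_prod => k ki; rewrite divr_ge0 ?cabs_ge0 //=.
  have kN := leq_ord k; rewrite ler_pdivrMr ?den0 //.
  apply: le_trans (num k kN) _.
  apply: le_trans (_ : (k ^ 2 + m ^ 2)%:R / (sqr_gap i k)%:R * c *
    (s * (1 - 2 * e) * (sqr_gap i k)%:R) <= _); last first.
    apply: ler_wpM2l (den k kN ki).
    exact: mulr_ge0 (divr_ge0 (ler0n _ _) (ler0n _ _)) c0.
  have gne : (sqr_gap i k)%:R != 0 :> R by rewrite gt_eqF // (lt_le_trans _ (g1 k ki)).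
  have ene : 1 - 2 * e != 0 by rewrite gt_eqF //; lra.
  rewrite /c; move: gne; move: (_%:R : R) (_%:R : R) => q g gne.
  by rewrite le_eqVlt; apply/orP; left; apply/eqP; field; rewrite gne ene.
rewrite big_split /= prodr_const.
rewrite (eq_card (B := predC1 (Ordinal (iN : (i < n.+1)%N)))) => [|k]; last first.
  by rewrite !inE -val_eqE.
rewrite cardC1 card_ord /=.
have h1 := @node_product_bound R n m i iN m0.
have cn0 := exprn_ge0 n c0.
apply: le_trans (ler_wpM2r cn0 h1) _.
move: (c ^+ n) cn => {}c' c4; rewrite -[8]/(_%:R) (natrM _ 2 4).
have h2 : 0 <= 2 * m%:R ^+ 2 * 'C(n + m, m)%:R ^+ 2 :> R by rewrite !mulr_ge0 ?exprn_ge0.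
apply: le_trans (ler_wpM2l h2 c4) _.
by rewrite le_eqVlt; apply/orP; left; apply/eqP; ring.
Qed.

End NodeQuotients.

Section Asymptotics.
Context {R : realType}.

Lemma binomial_le_exp (x : R) n m : 0 < x -> 'C(n + m, m)%:R * x ^+ m <= (1 + x) ^+ (n + m).
Proof.
move=> x0; have mN : (m < (n + m).+1)%N by rewrite ltnS leq_addl.
rewrite exprDn (bigD1 (Ordinal mN)) //= expr1n mul1r mulr_natl lerDl.
by apply: sumr_ge0 => i _; rewrite mulrn_wge0 // expr1n mul1r exprn_ge0 // ltW.
Qed.

Lemma natr_le_exp2 m : m%:R <= 2 ^+ m :> R.
Proof. by rewrite -natrX ler_nat ltnW // ltn_expl. Qed.

(** The binomial is at most (1 + x)^(2 L m) / x^m, so its square times a^(L m) is at most (b^L /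
    x^2)^m with b < 1. [L] makes this at most 256^-m; the polynomial factor takes 128^m = (2^m)^7,
    and the remaining 2^-m absorbs the constants. *)
Lemma geometric_beats_binomial (a C : R) : 0 < a -> a < 1 ->
  exists2 L, (0 < L)%N & exists m0, forall m, (m0 <= m)%N -> (0 < m)%N ->
    C * (L * m).+1%:R ^+ 7 * 'C(L * m + m, m)%:R ^+ 2 * a ^+ (L * m) < 1.
Proof.
(* With this x, (1 + x)^4 <= 1 + 15 x and 16 x = 1 - a, whence b <= 1 - x. *)
move=> a0 a1; pose x := (1 - a) / 16.
have x0 : 0 < x by rewrite /x; lra.
have x1 : x < 1 by rewrite /x; lra.
pose b := a * (1 + x) ^+ 4.
have b0 : 0 < b by rewrite mulr_gt0 // exprn_gt0 //; lra.
have b1 : b < 1.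
  have h : (1 + x) ^+ 4 <= 1 + 15 * x.
    have -> : (1 + x) ^+ 4 = 1 + 4 * x + 6 * x ^+ 2 + 4 * x ^+ 3 + x ^+ 4 by ring.
    have hx k : (0 < k)%N -> x ^+ k <= x by move=> k0; apply: ler_iXnr => //; exact: ltW.
    by have := hx 2 isT; have := hx 3 isT; have := hx 4 isT; lra.
  apply: le_lt_trans (ler_wpM2l (ltW a0) h) _.
  have ax : a * x <= x by rewrite ler_piMl // ltW.
  have xE : 16 * x = 1 - a by rewrite /x; field.
  have : a * (1 + 15 * x) = a + 15 * (a * x) by ring.
  lra.
have [L0 hL] : exists n0, forall n, (n0 <= n)%N -> 256 / x ^+ 2 < b^-1 ^+ n.
  by apply: expr_unbounded; rewrite invf_gt1.
have := hL _ (leqnSn L0); set L := L0.+1 => {}hL.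
have th : b ^+ L / x ^+ 2 < 1 / 256.
  have x20 : 0 < x ^+ 2 by rewrite exprn_gt0.
  have bL : 0 < b ^+ L by rewrite exprn_gt0.
  rewrite exprVn ltr_pdivrMr // in hL.
  have : b ^+ L * 256 < b ^+ L * ((b ^+ L)^-1 * x ^+ 2) by rewrite ltr_pM2l.
  rewrite mulrA divff ?gt_eqF // mul1r => h.
  by rewrite ltr_pdivrMr //; lra.
exists L => //.
have [m0 hm0] : exists n0, forall n, (n0 <= n)%N -> `|C| * L.+1%:R ^+ 7 < 2 ^+ n :> R.
  by apply: expr_unbounded; rewrite ltr1n.
exists m0 => m mm m1; have {}hm0 := hm0 m mm.
have th0 : 0 < b ^+ L / x ^+ 2 by rewrite divr_gt0 // exprn_gt0.
have mL : (m <= L * m)%N by rewrite leq_pmull.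
have h1 : 'C(L * m + m, m)%:R ^+ 2 * a ^+ (L * m) <= (1 / 256) ^+ m :> R.
  have y1 : 1 <= 1 + x by lra.
  have y0 : 0 <= 1 + x by lra.
  have hb : 'C(L * m + m, m)%:R * x ^+ m <= (1 + x) ^+ (2 * (L * m)).
    apply: le_trans (binomial_le_exp _ _ x0) _; apply: ler_weXn2l => //.
    by rewrite mul2n -addnn leq_add2l.
  have hb2 : ('C(L * m + m, m)%:R * x ^+ m) ^+ 2 <= ((1 + x) ^+ (2 * (L * m))) ^+ 2.
    by rewrite ler_pXn2r ?nnegrE ?mulr_ge0 ?exprn_ge0 // ltW.
  have xm : 0 < x ^+ m ^+ 2 by rewrite !exprn_gt0.
  apply: le_trans (_ : (b ^+ L / x ^+ 2) ^+ m <= _); last first.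
    apply: lerXn2r; rewrite ?nnegrE; [exact: ltW th0| |exact: ltW th].
    exact: divr_ge0 ler01 (ler0n _ _).
  rewrite expr_div_n -exprM -exprM [in X in _ / X]mulnC (exprM x m 2) ler_pdivlMr //.
  rewrite [leLHS]mulrAC -[X in X * _]exprMn; apply: le_trans (ler_wpM2r _ hb2) _; first by rewrite exprn_ge0 // ltW.
  rewrite /b exprMn [a ^+ _ * _]mulrC -!exprM.
  have -> : (2 * (L * m) * 2 = 4 * (L * m))%N by rewrite mulnAC.
  exact: lexx.
have h2 : (L * m).+1%:R ^+ 7 <= L.+1%:R ^+ 7 * 128 ^+ m :> R.
  have -> : 128 ^+ m = (2 ^+ m) ^+ 7 :> R.
    by rewrite -exprM mulnC exprM; congr (_ ^+ m); ring.
  rewrite -exprMn; apply: lerXn2r; rewrite ?nnegrE ?mulr_ge0 ?exprn_ge0 //.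
  apply: le_trans (_ : L.+1%:R * m%:R <= _); last by rewrite ler_wpM2l // natr_le_exp2.
  by rewrite -natrM ler_nat mulSn -addn1 addnC leq_add2r.
rewrite -mulrA; apply: le_lt_trans (ler_wpM2r _ (ler_wpM2r _ (ler_norm C))) _.
- by rewrite mulr_ge0 ?exprn_ge0 // ltW.
- by rewrite exprn_ge0.
apply: le_lt_trans (_ : `|C| * (L.+1%:R ^+ 7 * 128 ^+ m) * (1 / 256) ^+ m < _).
  apply: ler_pM => //; rewrite ?mulr_ge0 ?exprn_ge0 //; first by rewrite ltW.
  by rewrite ler_wpM2l.
rewrite mulrA -mulrA -exprMn; have -> : 128 * (1 / 256) = 2^-1 :> R by field.
by rewrite exprVn ltr_pdivrMr ?exprn_gt0 // mul1r.
Qed.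

End Asymptotics.

(** * The derivative of the exterior map at infinity *)

Section CapacityComparison.
Context {R : realType}.

(* The nodes have distances close to [s * (i ^ 2 + m ^ 2)], [i <= n], from the
   evaluation point; this quadratic spacing keeps all Lagrange coefficients
   below a polynomial in [n] times a power of ['C(n + m, m)]. *)
Lemma continuum_polynomial (G K : set (Cplx R)) p q (d : R) L m :
  log_capacity G = 1%E -> compact K -> connected K -> K p -> K q -> p != q ->
  (forall y w, K y -> cabs (w - y) < d -> G w) ->
  let n := (L * m)%N in let r := cabs (p - q) / 2 in let s := r / (2 * n%:R ^+ 2) in
  (0 < L)%N -> (0 < m)%N ->
  (forall y, closure G y -> exists2 z, K z & cabs (z - y) < s * m%:R ^+ 2) ->
  s <= 1 -> s < d ->
  exists Q : {poly Cplx R}, [/\ Q \is monic, size Q = n.+1 &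
    forall y, closure G y ->
      cabs Q.[y] <= 8192 / r * n.+1%:R ^+ 7 * 'C(n + m, m)%:R ^+ 2].
Proof.
move=> cap cK coK Kp Kq pq margin n r s L0 m0 near s1 sd.
have n0 : (0 < n)%N by rewrite muln_gt0 L0.
have mn : (m <= n)%N by rewrite leq_pmull.
have nR : 0 < n%:R :> R by rewrite ltr0n.
have NR : 0 < n.+1%:R :> R by rewrite ltr0n.
have N1 : 1 <= n.+1%:R :> R by rewrite ler1n.
have r0 : 0 < r by rewrite divr_gt0 // cabs_gt0 subr_eq0.
have n20 : 0 < 2 * n%:R ^+ 2 :> R by rewrite mulr_gt0 // exprn_gt0.
have s0 : 0 < s by rewrite divr_gt0.
have sE : s * (2 * n%:R ^+ 2) = r by rewrite divfK // gt_eqF.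
(* The covering radius 2h of the net is exactly the tolerance s / (4 (n+1)) of
   [node_quotient_bound]. *)
pose h := s / (8 * n.+1%:R).
have h0 : 0 < h by rewrite divr_gt0 // mulr_gt0.
have hs : h <= s.
  by rewrite ler_pdivrMr ?mulr_gt0 // ler_peMr ?(ltW s0) //; lra.
have hE : 2 * (2 * h) = s * (4 * n.+1%:R)^-1 * 2.
  by rewrite /h; field; rewrite gt_eqF.
have [X [XK Xsep Xuniq Xnet]] := separated_net cK h0.
have nodes y : closure G y -> exists x : nat -> Cplx R, forall k, (k <= n)%N ->
    x k \in X /\ `|cabs (x k - y) - s * (k ^ 2 + m ^ 2)%:R| <= s * (4 * n.+1%:R)^-1.
  move=> Gy; suff : forall k, exists x : Cplx R, (k <= n)%N ->
      x \in X /\ `|cabs (x - y) - s * (k ^ 2 + m ^ 2)%:R| <= s * (4 * n.+1%:R)^-1.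
    by move=> /choice[x hx]; exists x.
  move=> k; have [kn|nk] := leqP k n; last by exists 0.
  have [u Ku uy] := near y Gy.
  (* As |p - q| = 2r, one of p and q is at distance at least r from y; the distances on K therefore
     cover all prescribed values, the largest being at most 2 s n^2 = r. *)
  have [v Kv vy] : exists2 v, K v & r <= cabs (v - y).
    have [h1|h1] := leP r (cabs (p - y)); first by exists p.
    exists q => //; have := cabs_triangle y p q; rewrite (cabsBC y q).
    have : cabs (p - q) = 2 * r by rewrite /r; field.
    by move: (cabs _) (cabs _) (cabs _) h1 => A B C *; lra.
  have tr : s * (k ^ 2 + m ^ 2)%:R <= r.
    rewrite -sE -natrX -natrM ler_wpM2l ?(ltW s0) // ler_nat mul2n -addnn.
    by rewrite leq_add // leq_sqr.
  have tl : s * m%:R ^+ 2 <= s * (k ^ 2 + m ^ 2)%:R.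
    by rewrite -natrX ler_wpM2l ?(ltW s0) // ler_nat leq_addl.
  have [|w Kw wE] := @continuum_distance _ K y u v (s * (k ^ 2 + m ^ 2)%:R) coK Ku Kv.
    by rewrite (le_trans (ltW uy) tl) (le_trans tr vy).
  have [x xX xw] := Xnet w Kw; exists x => _; split => //.
  rewrite -wE ler_distl.
  have := cabs_triangle w x y; have := cabs_triangle x w y; rewrite (cabsBC w x).
  move: hE; move: xw; move: (s * (4 * _)^-1) (cabs _) (cabs _) (cabs _) => e A B C.
  by move=> *; apply/andP; split; lra.
(* The nodes belonging to the evaluation point p are n+1 distinct elements of the net. *)
have nX : (n < size X)%N.
  have [|x hx] := nodes p.
    apply: subset_closure; apply: (margin p p Kp); rewrite subrr cabs0.
    exact: lt_trans s0 sd.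
  rewrite -[X in (X <= _)%N](size_iota 0) -(size_map x); apply: uniq_leq_size; last first.
    by move=> _ /mapP[k + ->]; rewrite mem_iota add0n ltnS => kn; exact: (hx k kn).1.
  rewrite map_inj_in_uniq ?iota_uniq // => i k; rewrite !mem_iota !add0n !ltnS => iN kN xik.
  apply/eqP; rewrite eq_sym; apply: contraT => ki.
  have [/(_ k kN ki) + _] := node_quotient_bound s0 m0 (fun k kn => (hx k kn).2) iN.
  by rewrite xik eqxx.
have hn : h <= 2 * n.+1%:R by have := le_trans hs s1; lra.
have XG x w : x \in X -> cabs (w - x) <= h / (2 * n.+1%:R) -> G w.
  move=> xX xw; apply: (margin x w (XK x xX)); apply: le_lt_trans xw _.
  apply: le_lt_trans sd; apply: le_trans hs.
  rewrite ler_pdivrMr ?mulr_gt0 // ler_peMr ?(ltW h0) //; lra.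
have [Q [Qm Qs QB]] := fekete_polynomial cap h0 hn Xuniq nX Xsep XG.
exists Q; split => // y Gy; have [x hx] := nodes y Gy.
have hx2 k kn := (hx k kn).2.
have B0 : 0 <= 64 * n.+1%:R / h.
  by apply: divr_ge0 (ltW h0); exact: mulr_ge0 (ler0n _ 64) (ltW NR).
apply: le_trans (@lagrange_bound _ Q n x (64 * n.+1%:R / h) y _ _ _) _.
- by rewrite Qs.
- move=> i j iN jN; rewrite eq_sym.
  by have [+ _] := node_quotient_bound s0 m0 hx2 iN; exact.
- by move=> i iN; apply: QB; exact: (hx i iN).1.
apply: le_trans (_ : \sum_(i < n.+1) 64 * n.+1%:R / h *
    (8 * m%:R ^+ 2 * 'C(n + m, m)%:R ^+ 2) <= _).
  apply: ler_sum => i _; apply: ler_wpM2l => //.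
  by have [_] := node_quotient_bound s0 m0 hx2 (leq_ord i).
rewrite sumr_const card_ord -[_ *+ n.+1]mulr_natl.
(* Here 8192 = 64 * 8 * 8 * 2, the last two factors from 1 / h = 8 (n+1) / s and 1 / s = 2 n^2 /
   r. *)
have -> : n.+1%:R * (64 * n.+1%:R / h * (8 * m%:R ^+ 2 * 'C(n + m, m)%:R ^+ 2)) =
    8192 / r * (n.+1%:R ^+ 3 * (n%:R ^+ 2 * m%:R ^+ 2)) * 'C(n + m, m)%:R ^+ 2.
  by rewrite /h -sE; field; rewrite !gt_eqF.
have c0 : 0 <= 8192 / r := divr_ge0 (ler0n _ _) (ltW r0).
apply: ler_wpM2r; first by rewrite exprn_ge0.
apply: ler_wpM2l => //; move=> {c0}.
rewrite (exprD _ 3 4); apply: ler_wpM2l; first by rewrite exprn_ge0.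
rewrite (exprD _ 2 2); apply: ler_pM; rewrite ?exprn_ge0 //; apply: lerXn2r.
all: by rewrite ?nnegrE ?ler_nat // leqW.
Qed.

(** On the outer boundary |Q| <= B <= 2 B |F|. The exterior maximum principle, with its pole [b] in
    G, extends the outer inequality |Q| <= 2 B |F| to [outer G]; the leading terms z^n and c z^n are
    then compared at infinity. *)
Lemma monic_le_lead_coef (G : set (Cplx R)) (Q F : {poly Cplx R}) (B c : R) n :
  bounded_region G -> 0 <= B -> 0 < c ->
  Q \is monic -> size Q = n.+1 -> size F = n.+1 -> lead_coef F = rc c ->
  (forall z, closure (outer G) z -> 1 / 2 <= cabs F.[z]) ->
  (forall z, closure G z -> cabs Q.[z] <= B) -> 1 <= 2 * B * c.
Proof.
move=> [[b Gb] oG _ bG] B0 c0 Qm Qs Fs Fl F2 QB.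
have [r0 hr0] := bounded_closure bG.
have [d d0 hd] := open_cplx_ball oG Gb.
have far z : closure (outer G) z -> d <= cabs (z - b).
  move=> /closure_cplxP cz; rewrite leNgt; apply/negP => zb.
  have e0 : 0 < d - cabs (z - b) by lra.
  have [w Ow wz] := cz _ e0; apply: (outer_not_closure Ow); apply: subset_closure.
  by apply: hd; have := cabs_triangle z w b; lra.
have [|A1 A10 hA1] := @horner_infty R Q n; first by rewrite Qs.
have [|A2 A20 hA2] := @horner_infty R F n; first by rewrite Fs.
have Qn : Q`_n = 1 by rewrite -(monicP Qm) lead_coefE Qs.
have Fn : F`_n = rc c by rewrite -Fl lead_coefE Fs.
rewrite Qn in hA1; rewrite Fn in hA2.
have Qlo z : 1 <= cabs z -> cabs z ^+ n * (cabs z - A1) <= cabs z * cabs Q.[z].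
  move=> z1; have := hA1 z z1; rewrite mul1r.
  have := cabs_lb (z ^+ n) Q.[z]; rewrite cabsX (cabsBC _ Q.[z]) => h.
  have {h} := ler_wpM2l (cabs_ge0 z) h.
  move: (cabs z * cabs (_ - _)) => x; move: (cabs z ^+ n) (cabs Q.[z]) (cabs z) => *; lra.
have Qup z : 1 <= cabs z -> cabs Q.[z] <= (1 + A1) * cabs z ^+ n.
  move=> z1; have := hA1 z z1; rewrite mul1r.
  have := cabs_lb Q.[z] (z ^+ n); rewrite cabsX => h h2.
  have h3 : cabs (Q.[z] - z ^+ n) <= A1 * cabs z ^+ n.
    by apply: le_trans h2; rewrite ler_peMl ?cabs_ge0.
  by move: h h3; move: (cabs z ^+ n) (cabs _) (cabs _) => *; lra.
have Flo z : 1 <= cabs z -> cabs z ^+ n * (c * cabs z - A2) <= cabs z * cabs F.[z].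
  move=> z1; have := hA2 z z1.
  have := cabs_lb (rc c * z ^+ n) F.[z]; rewrite cabsM cabsX cabs_rc gtr0_norm // (cabsBC _ F.[z]) => h.
  have {h} := ler_wpM2l (cabs_ge0 z) h.
  move: (cabs z * cabs (_ - _)) => x; move: (cabs z ^+ n) (cabs F.[z]) (cabs z) => *; lra.
have Fup z : 1 <= cabs z -> cabs z * cabs F.[z] <= cabs z ^+ n * (c * cabs z + A2).
  move=> z1; have := hA2 z z1.
  have := cabs_lb F.[z] (rc c * z ^+ n); rewrite cabsM cabsX cabs_rc gtr0_norm // => h.
  have {h} := ler_wpM2l (cabs_ge0 z) h.
  move: (cabs z * cabs (_ - _)) => x; move: (cabs z ^+ n) (cabs F.[z]) (cabs z) => *; lra.
pose C := 2 * (1 + A1) / c.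
have C0 : 0 <= C by rewrite divr_ge0 // ?ltW //; lra.
have B20 : 0 <= 2 * B by rewrite mulr_ge0.
have inf z : 1 + 2 * A2 / c < cabs z -> cabs Q.[z] <= C * cabs F.[z].
  move=> zr; have A2c : 0 <= 2 * A2 / c by rewrite divr_ge0 ?mulr_ge0 // ltW.
  have z1 : 1 <= cabs z by lra.
  have z0 : 0 < cabs z by lra.
  have h1 : c / 2 * cabs z <= c * cabs z - A2.
    have : c * (2 * A2 / c) <= c * cabs z by apply: ler_wpM2l; [exact: ltW|lra].
    by rewrite mulrC divfK ?gt_eqF //; lra.
  have zn : 0 < cabs z ^+ n by rewrite exprn_gt0.
  have h2 := le_trans (ler_wpM2l (ltW zn) h1) (Flo z z1).
  have h3 : c / 2 * cabs z ^+ n <= cabs F.[z].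
    have hE : cabs z * (c / 2 * cabs z ^+ n) = cabs z ^+ n * (c / 2 * cabs z) by ring.
    by rewrite -(ler_pM2l z0) hE.
  apply: le_trans (Qup z z1) _; apply: le_trans (ler_wpM2l C0 h3).
  by rewrite le_eqVlt; apply/orP; left; apply/eqP; rewrite /C; field; rewrite gt_eqF.
have main : forall z, outer G z -> cabs Q.[z] <= 2 * B * cabs F.[z].
  apply: (max_principle_ext (@open_outer R G) B20 C0 d0 far).
  - by move=> z /F2 h; rewrite -cabs_gt0; lra.
  - move=> z Oz nOz; apply: le_trans (QB z (boundary_outer Oz nOz)) _.
    have := ler_wpM2l B20 (F2 z Oz); lra.
  - by move=> z _; exact: inf.
rewrite leNgt; apply/negP => lt1.
pose D := A1 + 2 * B * A2.
have D0 : 0 <= D by rewrite addr_ge0 // mulr_ge0.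
pose e := 1 - 2 * B * c.
have e0 : 0 < e by rewrite subr_gt0.
have De : 0 <= D / e by rewrite divr_ge0 // ltW.
(* At this point of the positive axis the lower-order terms, collected in D, are too small to fill
   the gap e t. *)
pose t := 1 + `|r0| + D / e.
have t1 : 1 <= t by rewrite /t; have := normr_ge0 r0; lra.
have tE : cabs (rc t) = t by rewrite cabs_rc ger0_norm //; exact: le_trans t1.
have Ot : outer G (rc t).
  apply: (outer_far hr0); rewrite tE /t; have := ler_norm r0; lra.
have z1 : 1 <= cabs (rc t) by rewrite tE.
have := Qlo _ z1; have := Fup _ z1; have := main _ Ot; rewrite tE.
have tn : 0 < t ^+ n by rewrite exprn_gt0 //; lra.
have Dt : D < e * t.
  have -> : e * t = e * (1 + `|r0|) + D by rewrite /t; field; rewrite gt_eqF.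
  by rewrite ltrDr mulr_gt0 //; have := normr_ge0 r0; lra.
move: Dt; rewrite /D /e; clearbody t.
move: (cabs Q.[_]) (cabs F.[_]) (t ^+ n) tn => x y T tn Dt h1 h2 h3.
have h4 : t * x <= t * (2 * B * y) by apply: ler_wpM2l => //; lra.
have h5 := ler_wpM2l B20 h2.
have h6 : T * (t - A1) <= T * (2 * B * (c * t + A2)) by lra.
by rewrite (ler_pM2l tn) in h6; lra.
Qed.

End CapacityComparison.

(** If a < 1, [continuum_polynomial] and [monic_le_lead_coef] for n = L m bound 1 by exactly the
    quantity that [geometric_beats_binomial] makes less than 1. *)
Lemma derivative_infty_ge1 (R : realType) (G : set (Cplx R)) (phi : Cplx R -> Cplx R)
  (a : R) (F : nat -> {poly Cplx R}) :
  bounded_region G -> {within closure (outer G), continuous phi} ->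
  (forall z w, outer G z -> outer G w -> phi z = phi w -> z = w) ->
  (forall z, outer G z -> 1 < cabs (phi z)) ->
  (forall w, 1 < cabs w -> exists2 z, outer G z & phi z = w) ->
  0 < a -> phi z / z @[z --> near_infty] --> rc a ->
  (forall e : R, 0 < e -> exists n0, forall n, (n0 <= n)%N ->
     forall z, closure (outer G) z -> cabs ((F n).[z] - phi z ^+ n) <= e) ->
  log_capacity G = 1%E -> 1 <= a.
Proof.
move=> Greg cphi inj gt1 onto a0 phi_infty FE cap.
have [[p Gp] oG coG bG] := Greg.
rewrite leNgt; apply/negP => a1.
have [r0 hr0] := bounded_closure bG.
have cclG : compact (closure G) := compact_cplx (@closed_closure _ G) hr0.
have outfar : exists r : R, forall z, r < cabs z -> outer G z by exists r0; exact: outer_far.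
have [n0 hn0] : exists n0, forall n, (n0 <= n)%N ->
    forall z, closure (outer G) z -> 1 / 2 <= cabs (F n).[z].
  have h2 : 0 < 1 / 2 :> R by lra.
  have [n0 hn0] := FE _ h2; exists n0 => n nn0 z Oz.
  have := faber_lower (hn0 n nn0 z Oz).
  have := exprn_ege1 n (phi_ge1 cphi gt1 Oz); lra.
have [n1 hn1] := faber_size_lead outfar a0 phi_infty FE.
have [e e0 he] := open_cplx_ball oG Gp.
(* Both points are fixed before K: r determines L, which determines how close K must come to the
   closure of G, and K in turn determines how large m must be. *)
have [q Gq pq] : exists2 q, G q & p != q.
  exists (p + rc (e / 2)).
    by apply: he; rewrite addrAC subrr add0r cabs_rc ger0_norm; lra.
  rewrite -subr_eq0 opprD addrA subrr add0r oppr_eq0 -cabs_gt0 cabs_rc ger0_norm; lra.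
pose r := cabs (p - q) / 2.
have rpos : 0 < r by rewrite divr_gt0 // cabs_gt0 subr_eq0.
have [L L0 [m0 hm0]] := geometric_beats_binomial (2 * (8192 / r)) a0 a1.
have LR : 0 < L%:R :> R by rewrite ltr0n.
(* For n = L m this is s m^2, whatever m is; so K can be chosen before m. *)
have eta0 : 0 < r / (2 * L%:R ^+ 2) by rewrite divr_gt0 // mulr_gt0 // exprn_gt0.
have [K [[cK coK KG Kp Kq] near]] := open_connected_skeleton oG coG cclG Gp Gq eta0.
have [d d0 margin] := compact_open_margin oG cK KG.
(* Large m pushes s below 1 and below the margin d of K in G, so that the segments stay in G. *)
have [m1 hm1] : exists m1, forall m, (m1 <= m)%N -> r < m%:R * Num.min d 1.
  have dm : 0 < Num.min d 1 by rewrite lt_min d0 ltr01.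
  exists (Num.bound (r / Num.min d 1)) => m mm; rewrite -ltr_pdivrMr //.
  apply: lt_le_trans (archi_boundP _) _; first by rewrite divr_ge0 // ltW.
  by rewrite ler_nat.
pose m := (maxn (maxn m0 m1) (maxn n0 n1)).+1.
have [mm0 mm1 mn0 mn1] : [/\ (m0 <= m)%N, (m1 <= m)%N, (n0 <= m)%N & (n1 <= m)%N].
  by split; rewrite /m; apply: leqW; rewrite !leq_max leqnn ?orbT.
have mpos : (0 < m)%N by [].
move: (m) mm0 mm1 mn0 mn1 mpos => {}m mm0 mm1 mn0 mn1 mpos.
have mR : 1 <= m%:R :> R by rewrite ler1n.
have LR1 : 1 <= L%:R :> R by rewrite ler1n.
have mLm : (m <= L * m)%N by rewrite leq_pmull.
have sm : r / (2 * (L * m)%:R ^+ 2) < Num.min d 1.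
  have nR : 0 < (L * m)%:R :> R by rewrite ltr0n muln_gt0 L0.
  rewrite ltr_pdivrMr ?mulr_gt0 ?exprn_gt0 //; apply: lt_le_trans (hm1 m mm1) _.
  rewrite mulrC ler_wpM2l ?le_min ?ltW //.
  have h1 : m%:R <= (L * m)%:R :> R by rewrite ler_nat.
  have h2 : (L * m)%:R * 1 <= (L * m)%:R * (L * m)%:R :> R.
    by apply: ler_wpM2l; [exact: ltW|lra].
  by rewrite expr2; lra.
have [sd s1] : r / (2 * (L * m)%:R ^+ 2) < d /\ r / (2 * (L * m)%:R ^+ 2) < 1.
  by move: sm; rewrite lt_min => /andP.
have near' y : closure G y -> exists2 z, K z & cabs (z - y) < r / (2 * (L * m)%:R ^+ 2) * m%:R ^+ 2.
  move=> /near[z Kz zy]; exists z => //.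
  rewrite (_ : _ * _ = r / (2 * L%:R ^+ 2)) //.
  by rewrite natrM; field; rewrite !gt_eqF // (lt_le_trans ltr01).
have [Q [Qm Qs QB]] :=
  continuum_polynomial cap cK coK Kp Kq pq margin L0 mpos near' (ltW s1) sd.
have B0 : 0 <= 8192 / r * (L * m).+1%:R ^+ 7 * 'C(L * m + m, m)%:R ^+ 2.
  apply: mulr_ge0; last by rewrite exprn_ge0.
  by apply: mulr_ge0 (divr_ge0 (ler0n _ _) (ltW rpos)) _; rewrite exprn_ge0.
have [Fs Fl] := hn1 (L * m)%N (leq_trans mn1 mLm).
have := monic_le_lead_coef Greg B0 (exprn_gt0 (L * m) a0) Qm Qs Fs Fl
  (hn0 _ (leq_trans mn0 mLm)) QB.
have E (u v w y : R) : 2 * (u * v * w) * y = 2 * u * v * w * y by ring.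
by rewrite E leNgt hm0.
Qed.

Theorem theorem4p1 (R : realType) (G : set (Cplx R)) (phi : Cplx R -> Cplx R)
    (mu : {finite_measure set (borelC R) -> \bar R})
    (p : nat -> {poly Cplx R}) (N M : set nat)
    (G_region : bounded_region G)
    (phi_conformal : exterior_map G phi)
    (G_Gamma : class_Gamma G phi)
    (G_cap1 : log_capacity G = 1%E)
    (mu_compact : compact (supp mu))
    (mu_infinite : infinite_set (supp mu))
    (mu_G : supp mu `<=` closure G)
    (p_ortho : orthonormal_polys mu p)
    (N_infinite : infinite_set N)
    (M_infinite : infinite_set M)
    (kappa_ratio : forall j, M j ->
       lead_coef (p n) / lead_coef (p (n - j)%N) @[n --> within N \oo]
         --> (1 : Cplx R)) :
  exists k : nat -> nat,
    let ratio n := ext_sphere (fun z : Cplx R =>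
      phi z ^+ k n * (p (n - k n)%N).[z] / (p n).[z]) in
    [/\ forall n, N n -> M (k n),
        forall m n, N m -> N n -> (m <= n)%N -> (k m <= k n)%N,
        forall B, exists2 n, N n & (B <= k n)%N &
        \forall n \near within N \oo, (k n <= n)%N] /\
    (forall x : sphere R, ~ (fin @` ch mu) x ->
       ratio n x @[n --> within N \oo] --> (1 : Cplx R)) /\
    (forall K : set (sphere R), compact K -> K `<=` ~` (fin @` ch mu) ->
       {uniform K, ratio @ within N \oo --> (fun=> 1 : Cplx R)}).
Proof.
have [_ [phi_img phi_inj phi_surj] [a' a'0 phi_infty]] := phi_conformal.
have [cphi [F _ F_cvg]] := G_Gamma.
have aE : a' = rc (cRe a').
  by apply: cplx_eqP => //; rewrite cIm_rc; exact: ger0_Im (ltW a'0).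
move: (cRe a') aE => a aE; rewrite {}aE in a'0 phi_infty.
have a0 : 0 < a by rewrite -rc_lt.
have clE : fin @^-1` closure (Omega G) = closure (outer G).
  by apply/seteqP; split => z /closure_Omega.
have gt1 (w : Cplx R) : (1 < `|w|) = (1 < cabs w) by rewrite normr_cabs -rc1 rc_lt.
have phi_gt1 z : outer G z -> 1 < cabs (phi z).
  by move=> /phi_img /=; rewrite gt1.
have phi_onto w : 1 < cabs w -> exists2 z, outer G z & phi z = w.
  by rewrite -gt1 => /phi_surj.
have inj z w : outer G z -> outer G w -> phi z = phi w -> z = w.
  by move=> /mem_set Oz /mem_set Ow; exact: phi_inj.
rewrite clE in cphi.
have FE (e : R) : 0 < e -> exists n0, forall n, (n0 <= n)%N ->
    forall z, closure (outer G) z -> cabs ((F n).[z] - phi z ^+ n) <= e.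
  (* The uniform convergence is read off at the finite points of the closure of Omega, with the
     entourage of real radius e. *)
  move=> e0; pose E : set (Cplx R * Cplx R) := [set xy | cabs (xy.2 - xy.1) < e].
  have entE : entourage E.
    rewrite -entourage_ballE; exists (rc e); first by rewrite /= -rc0 rc_lt.
    by move=> [x y]; rewrite /= -ball_normE /= normr_cabs rc_lt /E /= cabsBC.
  have := F_cvg [set h | forall x, closure (Omega G) x -> E (0, h x)] _.
  move=> [|n0 _ hn0]; first by apply/uniform_nbhs; exists E; split.
  exists n0 => n n0n z /closure_Omega Oz.
  by have := hn0 n n0n _ Oz; rewrite /E /= subr0 => /ltW.
have a1 := derivative_infty_ge1 G_region cphi inj phi_gt1 phi_onto a0 phi_infty FE G_cap1.
have [_ _ _ G_bd] := G_region.
exact: (ratio_limit cphi inj phi_gt1 phi_onto a1 phi_infty FE G_bd mu_compact mu_G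
  p_ortho N_infinite M_infinite kappa_ratio).
Qed.
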